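(* Let $\mathbf{k}$ be a field of characteristic $0$ and let $$\mathbf{V}_1 \xrightarrow{f_1} \mathbf{V}_2 \xrightarrow{f_2} \mathbf{V}_3 \xrightarrow{f_3} \cdots$$ be a coherent sequence of representations of $\mathrm{Sp}_{2g}(\mathbb{Z})$ over $\mathbf{k}$. For some $g_0 \geq 2$, assume that the following hold for all $g \geq g_0$: (i) the cokernel of $f_{g-1}\colon \mathbf{V}_{g-1} \to \mathbf{V}_g$ is a finite dimensional algebraic representation of $\mathrm{Sp}_{2(g-1)}(\mathbb{Z})$; and (ii) the coinvariants $(\mathbf{V}_g)_{\mathrm{Sp}_{2g}(\mathbb{Z})}$ are finite dimensional. Then $\mathbf{V}_g$ is finite dimensional for $g \geq g_0$ and an algebraic representation of $\mathrm{Sp}_{2g}(\mathbb{Z})$ for $g \geq g_0+1$.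
   Context: A coherent sequence of representations of $\mathrm{Sp}_{2g}(\mathbb{Z})$ over a field $\mathbf{k}$ is a sequence $\mathbf{V}_1 \xrightarrow{f_1} \mathbf{V}_2 \xrightarrow{f_2} \cdots$ of $\mathbf{k}$-vector spaces and linear maps such that each $\mathbf{V}_g$ is a representation of $\mathrm{Sp}_{2g}(\mathbb{Z})$ (not assumed finite dimensional), and each $f_g\colon \mathbf{V}_g \boxtimes \mathbf{k} \to \mathbf{V}_{g+1}$ is $\mathrm{Sp}_{2g}(\mathbb{Z}) \times \mathrm{Sp}_2(\mathbb{Z})$-equivariant. Here $\mathbf{V}_g \boxtimes \mathbf{k}$ is the vector space $\mathbf{V}_g$ with $\mathrm{Sp}_{2g}(\mathbb{Z})$ acting as given and $\mathrm{Sp}_2(\mathbb{Z})$ acting trivially, and $\mathrm{Sp}_{2g}(\mathbb{Z}) \times \mathrm{Sp}_2(\mathbb{Z})$ acts on $\mathbf{V}_{g+1}$ via the standard block inclusion into $\mathrm{Sp}_{2(g+1)}(\mathbb{Z})$. In (i), the cokernel is regarded as a representation of $\mathrm{Sp}_{2(g-1)}(\mathbb{Z})$, ignoring the $\mathrm{Sp}_2(\mathbb{Z})$-action. A representation $\mathbf{V}$ of $\mathrm{Sp}_{2g}(\mathbb{Z})$ over a field $\mathbf{k}$ of characteristic $0$ is algebraic if the action extends to a polynomial (i.e. algebraic-group) representation of the $\mathbf{k}$-points $\mathrm{Sp}_{2g}(\mathbf{k})$ of the algebraic group $\mathrm{Sp}_{2g}$. The coinvariants $\mathbf{W}_G$ of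 a representation $\mathbf{W}$ of $G$ are $\mathbf{W}/\langle w - x\cdot w \mid w \in \mathbf{W}, x \in G\rangle$. *)

(* Defs.v *)
From HB Require Import structures.
From mathcomp Require Import all_boot all_order all_algebra.
From mathcomp Require Import boolp mpoly.

Set Implicit Arguments.
Unset Strict Implicit.
Unset Printing Implicit Defensive.

Import GRing.Theory.
Local Open Scope ring_scope.

(* The form is the orthogonal sum of g hyperbolic planes, in the ordered basis
   (a_1, b_1, ..., a_g, b_g), so that block-diagonal matrices of symplectic
   matrices are symplectic. *)
Definition symplectic_form (R : pzRingType) (g : nat) : 'M[R]_(g.*2) :=
  \matrix_(i, j) (if odd i then - (i == j.+1 :> nat)%:R
                  else (i.+1 == j :> nat)%:R).

Definition symplectic (R : comPzRingType) (g : nat) (A : 'M[R]_(g.*2)) : bool :=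
  A^T *m symplectic_form R g *m A == symplectic_form R g.

Record Sp (R : comUnitRingType) (g : nat) := MkSp {
  Sp_val :> 'M[R]_(g.*2);
  Sp_valP : symplectic Sp_val
}.

HB.instance Definition _ (R : comUnitRingType) (g : nat) :=
  [isSub for @Sp_val R g].
HB.instance Definition _ (R : comUnitRingType) (g : nat) :=
  [Choice of Sp R g by <:].

Section SymplecticGroup.
Variables (R : comUnitRingType) (g : nat).
Local Notation J := (symplectic_form R g).

Lemma mulmx_symplectic_form : J *m J = - 1%:M.
Proof.
apply/matrixP => i j; rewrite !mxE.
have [oi|ei] := boolP (odd i).
- have i0 : (0 < i)%N by case: (nat_of_ord i) oi.
  have li : (i.-1 < g.*2)%N by apply: leq_ltn_trans (leq_pred _) (ltn_ord i).
  rewrite (bigD1 (Ordinal li)) //= big1 => [|l /eqP nl]; last first.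
    rewrite !mxE oi; case: eqP => [il|]; last by rewrite oppr0 mul0r.
    by case: nl; apply: val_inj; rewrite /= il.
  rewrite !mxE oi /= prednK // eqxx -[in odd _]subn1 oddB // oi /=.
  by rewrite addr0 mulNr mul1r.
- have li : (i.+1 < g.*2)%N.
    rewrite ltn_neqAle ltn_ord andbT; apply/eqP => e.
    by have := odd_double g; rewrite -e /= ei.
  rewrite (bigD1 (Ordinal li)) //= big1 => [|l /eqP nl]; last first.
    rewrite !mxE (negPf ei); case: eqP => [il|]; last by rewrite mul0r.
    by case: nl; apply: val_inj; rewrite /= -il.
  by rewrite !mxE (negPf ei) /= ei eqxx mul1r addr0 eqSS.
Qed.

Lemma symplectic1 : symplectic (1%:M : 'M[R]_(g.*2)).
Proof. by rewrite /symplectic trmx1 mul1mx mulmx1. Qed.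

Lemma symplecticM (A B : 'M[R]_(g.*2)) :
  symplectic A -> symplectic B -> symplectic (A *m B).
Proof.
move=> /eqP hA /eqP hB; rewrite /symplectic trmx_mul.
by rewrite -!mulmxA [A^T *m _]mulmxA [_ *m (A *m B)]mulmxA hA mulmxA hB.
Qed.

Lemma symplectic_unit (A : 'M[R]_(g.*2)) : symplectic A -> A \in unitmx.
Proof.
move=> /eqP hA; apply: (@mulmx1_unit _ _ (- J *m A^T *m J) A _).2.
by rewrite -!mulmxA [A^T *m _]mulmxA hA mulNmx mulmx_symplectic_form opprK.
Qed.

Lemma symplecticV (A : 'M[R]_(g.*2)) : symplectic A -> symplectic (invmx A).
Proof.
move=> hA; have uA := symplectic_unit hA; move/eqP: hA => hA.
rewrite /symplectic -[X in _^T *m X]hA trmx_inv !mulmxA mulVmx ?unitmx_tr //.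
by rewrite mul1mx -mulmxA mulmxV // mulmx1.
Qed.

Definition Sp_one : Sp R g := MkSp symplectic1.
Definition Sp_mul (A B : Sp R g) : Sp R g :=
  MkSp (symplecticM (Sp_valP A) (Sp_valP B)).
Definition Sp_inv (A : Sp R g) : Sp R g := MkSp (symplecticV (Sp_valP A)).

Lemma Sp_mulA : associative Sp_mul.
Proof. by move=> A B C; apply: val_inj; rewrite /= mulmxA. Qed.
Lemma Sp_mul1 : left_id Sp_one Sp_mul.
Proof. by move=> A; apply: val_inj; rewrite /= mul1mx. Qed.
Lemma Sp_mulr1 : right_id Sp_one Sp_mul.
Proof. by move=> A; apply: val_inj; rewrite /= mulmx1. Qed.
Lemma Sp_mulV : left_inverse Sp_one Sp_inv Sp_mul.
Proof.
move=> A; apply: val_inj.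
by rewrite /= mulVmx // symplectic_unit // Sp_valP.
Qed.
Lemma Sp_mulrV : right_inverse Sp_one Sp_inv Sp_mul.
Proof.
move=> A; apply: val_inj.
by rewrite /= mulmxV // symplectic_unit // Sp_valP.
Qed.
End SymplecticGroup.

HB.instance Definition _ (R : comUnitRingType) (g : nat) :=
  isGroup.Build (Sp R g) (@Sp_mulA R g) (@Sp_mul1 R g) (@Sp_mulr1 R g)
    (@Sp_mulV R g) (@Sp_mulrV R g).

Section SymplecticMaps.
Variables (R S : comUnitRingType) (f : {rmorphism R -> S}) (g : nat).

Lemma symplectic_map (A : Sp R g) : symplectic (map_mx f A).
Proof.
have fJ : map_mx f (symplectic_form R g) = symplectic_form S g.
  apply/matrixP => i j; rewrite !mxE.
  by case: ifP => _; rewrite ?rmorphN rmorph_nat.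
have /eqP hA := Sp_valP A.
by rewrite /symplectic -fJ map_trmx -!map_mxM hA.
Qed.

Definition Sp_map (A : Sp R g) : Sp S g := MkSp (symplectic_map A).
End SymplecticMaps.

Section BlockInclusion.
Variables (R : comUnitRingType) (g : nat).

Definition block_diag (A : 'M[R]_(g.*2)) (B : 'M[R]_(1.*2)) : 'M[R]_(g.+1.*2) :=
  castmx (addn2 g.*2, addn2 g.*2) (block_mx A 0 0 B).

Lemma block_diagM A A' B B' :
  block_diag A B *m block_diag A' B' = block_diag (A *m A') (B *m B').
Proof.
have castM m n (e : m = n) (M N : 'M[R]_m) :
    castmx (e, e) M *m castmx (e, e) N = castmx (e, e) (M *m N).
  by case: n / e; rewrite !castmx_id.
by rewrite castM mulmx_block !mulmx0 !mul0mx !addr0 !add0r.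
Qed.

Lemma block_diag_tr A B : (block_diag A B)^T = block_diag A^T B^T.
Proof. by rewrite /block_diag trmx_cast /= tr_block_mx !trmx0. Qed.

Lemma block_diag1 : block_diag 1%:M 1%:M = 1%:M.
Proof.
rewrite /block_diag -scalar_mx_block; apply/matrixP => i j.
by rewrite castmxE !mxE.
Qed.

Lemma block_diag_form :
  block_diag (symplectic_form R g) (symplectic_form R 1) =
  symplectic_form R g.+1.
Proof.
apply/matrixP => i j; rewrite castmxE /= !mxE.
set i' := cast_ord _ i; set j' := cast_ord _ j.
have -> : nat_of_ord i = i' by [].
have -> : nat_of_ord j = j' by [].
case: splitP => [a ->|a ->]; rewrite mxE; case: splitP => [b ->|b ->];
  rewrite !mxE //=.
- have la := ltn_ord a; case: ifP => oa.
    by rewrite ltn_eqF ?oppr0 // ltnS ltnW // (leq_trans la) // leq_addr.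
  case: eqP => // e.
  have b0 : b = 0 :> nat.
    by apply/eqP; rewrite -leqn0 -(leq_add2l g.*2) addn0 -e.
  have := odd_double g; rewrite -[g.*2]addn0 -[X in (_ + X)%N]b0 -e /=.
  by rewrite oa.
- have lb := ltn_ord b; rewrite oddD odd_double /=; case: ifP => oa.
    case: eqP => [e|]; last by rewrite oppr0.
    have a0 : a = 0 :> nat.
      by apply/eqP; rewrite -leqn0 -(leq_add2l g.*2) addn0 e.
    by rewrite a0 in oa.
  by rewrite gtn_eqF // ltnS (leq_trans (ltnW lb)) // leq_addr.
- by rewrite oddD odd_double /= -!addnS !eqn_add2l.
Qed.

Lemma symplectic_block (A : Sp R g) (B : Sp R 1) : symplectic (block_diag A B).
Proof.
have /eqP hA := Sp_valP A; have /eqP hB := Sp_valP B.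
by rewrite /symplectic block_diag_tr -block_diag_form !block_diagM hA hB.
Qed.

Definition Sp_block (A : Sp R g) (B : Sp R 1) : Sp R g.+1 :=
  MkSp (symplectic_block A B).

Definition Sp_stab (A : Sp R g) : Sp R g.+1 := Sp_block A 1%g.

Lemma Sp_stab1 : Sp_stab 1%g = 1%g.
Proof. by apply: val_inj; rewrite /= block_diag1. Qed.
Lemma Sp_stabM : {morph Sp_stab : A B / (A * B)%g}.
Proof. by move=> A B; apply: val_inj; rewrite /= block_diagM mul1mx. Qed.

HB.instance Definition _ :=
  isMultiplicative.Build (Sp R g) (Sp R g.+1) Sp_stab Sp_stabM.
HB.instance Definition _ :=
  Multiplicative_isUMagmaMorphism.Build (Sp R g) (Sp R g.+1) Sp_stab Sp_stab1.
End BlockInclusion.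

Section Subspaces.
Variables (k : fieldType) (V : lmodType k).

Definition lin_span (S : V -> Prop) : {pred V} := fun v =>
  `[< exists (n : nat) (c : 'I_n -> k) (s : 'I_n -> V),
      (forall i, S (s i)) /\ v = \sum_(i < n) c i *: s i >].

Lemma lin_span_closed (S : V -> Prop) : GRing.subsemimod_closed (lin_span S).
Proof.
split; [split|].
- apply/asboolP; exists 0, (fun=> 0), (fun=> 0); split; first by case.
  by rewrite big_ord0.
- move=> u v /asboolP [m [c [s [Ss ->]]]] /asboolP [n [d [t [St ->]]]].
  apply/asboolP; exists (m + n)%N.
  exists (fun i => match split i with inl a => c a | inr b => d b end).
  exists (fun i => match split i with inl a => s a | inr b => t b end).
  split=> [i|]; first by case: split.
  rewrite big_split_ord /=; congr (_ + _); apply: eq_bigr => i _.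
    by rewrite (unsplitK (inl i)).
  by rewrite (unsplitK (inr i)).
- move=> a v /asboolP [n [c [s [Ss ->]]]]; apply/asboolP.
  exists n, (fun i => a * c i), s; split=> //.
  by rewrite scaler_sumr; apply: eq_bigr => i _; rewrite scalerA.
Qed.

HB.instance Definition _ (S : V -> Prop) :=
  GRing.isSubmodClosed.Build k V (lin_span S) (lin_span_closed S).

Variables (U : lmodType k) (f : {linear U -> V}).

Definition lin_image : {pred V} := fun v => `[< exists u, f u = v >].

Lemma lin_image_closed : GRing.subsemimod_closed lin_image.
Proof.
split; [split|].
- by apply/asboolP; exists 0; rewrite linear0.
- move=> _ _ /asboolP [u <-] /asboolP [v <-].
  by apply/asboolP; exists (u + v); rewrite linearD.
- by move=> a _ /asboolP [u <-]; apply/asboolP; exists (a *: u); rewrite linearZ.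
Qed.

HB.instance Definition _ :=
  GRing.isSubmodClosed.Build k V lin_image lin_image_closed.
End Subspaces.

Definition finite_dim (k : fieldType) (V : lmodType k) : Prop :=
  exists (n : nat) (s : 'I_n -> V),
  forall v, exists c : 'I_n -> k, v = \sum_(i < n) c i *: s i.

Section QuotientSpace.
Variables (k : fieldType) (V : lmodType k) (W : submodClosed V).
Local Open Scope quotient_scope.

(* submodClosed does not inherit from zmodClosed, which Quotient.quot needs. *)
Definition submod_pred : {pred V} := fun v => v \in W.
Lemma submod_pred_closed : zmod_closed submod_pred.
Proof. by exact: GRing.submod_closedB (submodClosedP W). Qed.
HB.instance Definition _ :=
  GRing.isZmodClosed.Build V submod_pred submod_pred_closed.

Definition quot_space : Type := Quotient.quot submod_pred.
HB.instance Definition _ := GRing.Zmodule.on quot_space.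

Definition quot_pi (v : V) : quot_space := \pi_(Quotient.quot submod_pred) v.
Definition quot_repr (x : quot_space) : V := repr (x : Quotient.quot submod_pred).

Lemma quot_reprK (x : quot_space) : quot_pi (quot_repr x) = x.
Proof. exact: reprK. Qed.

Lemma quot_piP (u v : V) : u - v \in W -> quot_pi u = quot_pi v.
Proof. by move=> h; apply/eqP; rewrite -Quotient.idealrBE. Qed.

Lemma quot_pi_repr (v : V) : quot_repr (quot_pi v) - v \in W.
Proof.
have /eqP := quot_reprK (quot_pi v).
by rewrite /quot_pi -Quotient.idealrBE.
Qed.

Lemma quot_piB : zmod_morphism quot_pi.
Proof. by move=> u v; rewrite /quot_pi raddfB. Qed.

HB.instance Definition _ :=
  GRing.isZmodMorphism.Build V quot_space quot_pi quot_piB.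

Definition quot_scale (a : k) (x : quot_space) : quot_space :=
  quot_pi (a *: quot_repr x).

Lemma quot_scaleE a v : quot_scale a (quot_pi v) = quot_pi (a *: v).
Proof. by apply: quot_piP; rewrite -scalerBr rpredZ // quot_pi_repr. Qed.

Lemma quot_scaleA a b x : quot_scale a (quot_scale b x) = quot_scale (a * b) x.
Proof. by rewrite -[x]quot_reprK !quot_scaleE scalerA. Qed.
Lemma quot_scale1 : left_id 1 quot_scale.
Proof. by move=> x; rewrite -[x]quot_reprK quot_scaleE scale1r. Qed.
Lemma quot_scaleDr : right_distributive quot_scale +%R.
Proof.
move=> a x y; rewrite -[x]quot_reprK -[y]quot_reprK -raddfD !quot_scaleE.
by rewrite scalerDr raddfD.
Qed.
Lemma quot_scaleDl x : {morph quot_scale^~ x : a b / a + b}.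
Proof.
by move=> a b; rewrite -[x]quot_reprK !quot_scaleE scalerDl raddfD.
Qed.

HB.instance Definition _ := GRing.Zmodule_isLmodule.Build k quot_space
  quot_scaleA quot_scale1 quot_scaleDr quot_scaleDl.

Lemma quot_piZ : scalable quot_pi.
Proof. by move=> a v; rewrite -quot_scaleE. Qed.
HB.instance Definition _ :=
  GRing.isScalable.Build k V quot_space *:%R quot_pi quot_piZ.
End QuotientSpace.

Record representation (G : groupType) (k : fieldType) (V : lmodType k) :=
  Representation {
    rep_act :> G -> {linear V -> V};
    rep_act1 : forall v, rep_act 1%g v = v;
    rep_actM : forall x y v, rep_act (x * y)%g v = rep_act x (rep_act y v)
  }.

Section RestrictedRepresentation.
Variables (H G : groupType) (phi : UMagmaMorphism.type H G).
Variables (k : fieldType) (V : lmodType k) (rho : representation G V).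

Lemma restrict_act1 v : rho (phi 1%g) v = v.
Proof. by rewrite gmulf1 rep_act1. Qed.
Lemma restrict_actM x y v : rho (phi (x * y)%g) v = rho (phi x) (rho (phi y) v).
Proof. by rewrite gmulfM rep_actM. Qed.

Definition restrict_rep : representation H V :=
  @Representation H k V (fun x => rho (phi x)) restrict_act1 restrict_actM.
End RestrictedRepresentation.

Section QuotientRepresentation.
Variables (G : groupType) (k : fieldType) (V : lmodType k).
Variables (rho : representation G V) (W : submodClosed V).
Hypothesis Wstable : forall x v, v \in W -> rho x v \in W.

Definition quot_act (x : G) (q : quot_space W) : quot_space W :=
  quot_pi W (rho x (quot_repr q)).

Lemma quot_actE x v : quot_act x (quot_pi W v) = quot_pi W (rho x v).
Proof. by apply: quot_piP; rewrite -linearB Wstable // quot_pi_repr. Qed.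

Lemma quot_act_linear x : linear (quot_act x).
Proof.
move=> a p q; rewrite -[p]quot_reprK -[q]quot_reprK -linearP !quot_actE.
by rewrite !linearP.
Qed.
HB.instance Definition _ x := GRing.isLinear.Build k (quot_space W)
  (quot_space W) *:%R (quot_act x) (quot_act_linear x).

Lemma quot_act1 q : quot_act 1%g q = q.
Proof. by rewrite -[q]quot_reprK quot_actE rep_act1. Qed.
Lemma quot_actM x y q : quot_act (x * y)%g q = quot_act x (quot_act y q).
Proof. by rewrite -[q]quot_reprK !quot_actE rep_actM. Qed.

Definition quot_rep : representation G (quot_space W) :=
  @Representation G k (quot_space W) quot_act quot_act1 quot_actM.
End QuotientRepresentation.

Definition coinvariants (G : groupType) (k : fieldType) (V : lmodType k)
    (rho : representation G V) : lmodType k :=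
  quot_space (lin_span (fun v => exists (w : V) (x : G), v = w - rho x w)).

(* For infinite-dimensional V this is the usual definition of a rational
   representation (a comodule over the coordinate ring); for finite-dimensional
   V it says that in a basis the matrix entries of sigma A are polynomials in
   the entries of A.  Inverse determinants are not needed since det A = 1, and
   k-points determine the algebraic representation when k is infinite. *)
Definition polynomial_rep (k : fieldType) (g : nat) (V : lmodType k)
    (sigma : representation (Sp k g) V) : Prop :=
  forall v : V,
  exists (n : nat) (p : 'I_n -> {mpoly k[g.*2 * g.*2]}) (w : 'I_n -> V),
  forall A : Sp k g, sigma A v = \sum_(i < n) (p i).@[mxvec A 0] *: w i.

Definition algebraic (k : fieldType) (g : nat) (V : lmodType k)
    (rho : representation (Sp int g) V) : Prop :=
  exists2 sigma : representation (Sp k g) V,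
    polynomial_rep sigma &
    forall (A : Sp int g) (v : V), sigma (Sp_map intr A) v = rho A v.

(* The sequence is indexed from 0: the n-th term is the representation usually
   written V_{n+1}, of the group Sp_{2(n+1)}(Z). *)
Record coherent_sequence (k : fieldType) := CoherentSequence {
  coh_space : nat -> lmodType k;
  coh_rep : forall n, representation (Sp int n.+1) (coh_space n);
  coh_map : forall n, {linear coh_space n -> coh_space n.+1};
  coh_equivariant : forall n (A : Sp int n.+1) (B : Sp int 1) (v : coh_space n),
    coh_map n (coh_rep n A v) = coh_rep n.+1 (Sp_block A B) (coh_map n v)
}.

Section Cokernels.
Variables (k : fieldType) (C : coherent_sequence k) (n : nat).

Definition coker : lmodType k := quot_space (lin_image (coh_map C n)).

Definition coh_restrict : representation (Sp int n.+1) (coh_space C n.+1) :=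
  restrict_rep (@Sp_stab int n.+1) (coh_rep C n.+1).

Lemma coh_image_stable (A : Sp int n.+1) (v : coh_space C n.+1) :
  v \in lin_image (coh_map C n) ->
  coh_restrict A v \in lin_image (coh_map C n).
Proof.
move=> /asboolP [u <-]; apply/asboolP; exists (coh_rep C n A u).
by rewrite (coh_equivariant A 1%g).
Qed.

Definition coker_rep : representation (Sp int n.+1) coker :=
  quot_rep coh_image_stable.
End Cokernels.

(* Main.v *)
From HB Require Import structures.
Require Import Defs.
From mathcomp Require Import all_boot all_order all_algebra.
From mathcomp Require Import boolp mpoly ring zify.

Set Implicit Arguments.
Unset Strict Implicit.
Unset Printing Implicit Defensive.

Import GRing.Theory.
Local Open Scope ring_scope.

(* Finite dimensionality: Sp_2g(Z) is generated by finitely many transvections,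
   each conjugate into the last Sp_2(Z), which acts trivially on the image W of
   V_(g-1).  As V/W is finite dimensional, so is (T - 1)V for each generator T, and
   hence the kernel of V -> V_G.

   Algebraicity: since V/W is algebraic and W is fixed by the last Sp_2(Z), the
   lantern relation shows (for g >= 3) that transvections act unipotently on V.
   Heisenberg relations make their logarithms q(x) a quadratic form in x, that is,
   an equivariant linear map sp_2g -> End V.  Over a differential field K, a product
   of exponentials exp(c q(x)) is then determined up to a constant by the
   corresponding product of transvections in Sp_2g(K), because both have the same
   logarithmic derivative.  Applied to the elimination that writes a generic
   symplectic matrix as a product of 2g transvections, over K = k(t), this yields a
   nonzero polynomial f with f(A) rho(A) polynomial in A.  Translating f removes the
   denominator, and density of Sp_2g(Z) in Sp_2g(k) makes the resulting polynomial
   map a representation. *)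


(** * Symplectic transvections *)

(** The extension of rho to Sp_2g(k) cannot simply be prescribed on generators: a relation between
    transvections over k need not come from relations over Z, so nothing says directly that the
    exponentials satisfy it. Over k(t) the derivation takes the place of the missing relations, at
    the price of an unknown constant matrix. Elimination serves as the second word because its
    vectors and pivots are polynomial in the matrix. The identity matrix is a bad starting point,
    since its first pivot w(e_0, e_0) vanishes; hence the paths start at a separate base point,
    where the constant is computed.

    The bound g >= 3 enters twice. The lantern relation uses three orthogonal vectors from different
    hyperbolic planes, and the bilinearity of the polarized logarithm is proved with a plane away
    from the at most two planes of a generator. Since g_0 >= 2, the condition g >= g_0 + 1
    guarantees it. *)

Lemma mulmx_eq (R : pzRingType) m (A B : 'M[R]_m) :
  (forall v : 'cV[R]_m, A *m v = B *m v) -> A = B.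
Proof.
move=> h; apply/matrixP => i j.
by have /matrixP/(_ i 0) := h (delta_mx j 0); rewrite -!colE !mxE.
Qed.

Section Transvections.
Variables (R : comUnitRingType) (g : nat).
Local Notation J := (symplectic_form R g).
Local Notation vec := 'cV[R]_(g.*2).

Definition sdot (x y : vec) : R := (x^T *m J *m y) 0 0.

Lemma sdotE x y : x^T *m J *m y = (sdot x y)%:M.
Proof. by apply/matrixP => i j; rewrite !ord1 [RHS]mxE eqxx. Qed.

Lemma symplectic_form_tr : J^T = - J.
Proof.
apply/matrixP => i j; rewrite !mxE; case: ifP => oj; case: ifP => oi.
- have -> : (j == i.+1 :> nat) = false.
    by apply/eqP => e; move: oj; rewrite e /= oi.
  have -> : (i == j.+1 :> nat) = false.
    by apply/eqP => e; move: oi; rewrite e /= oj.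
  by rewrite !mulr0n !oppr0.
- by rewrite eq_sym.
- by rewrite opprK eq_sym.
- have -> : (j.+1 == i) = false by apply/eqP => e; move: oi; rewrite -e /= oj.
  have -> : (i.+1 == j) = false by apply/eqP => e; move: oj; rewrite -e /= oi.
  by rewrite oppr0.
Qed.

Lemma sdotC x y : sdot x y = - sdot y x.
Proof.
have -> : sdot y x = ((y^T *m J *m x)^T) 0 0 by rewrite [RHS]mxE.
rewrite !trmx_mul trmxK symplectic_form_tr mulNmx mulmxN mxE opprK.
by rewrite mulmxA.
Qed.

Lemma sdotDl x y z : sdot (x + y) z = sdot x z + sdot y z.
Proof. by rewrite /sdot linearD !mulmxDl mxE. Qed.
Lemma sdotDr x y z : sdot x (y + z) = sdot x y + sdot x z.
Proof. by rewrite /sdot mulmxDr mxE. Qed.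
Lemma sdotZl c x y : sdot (c *: x) y = c * sdot x y.
Proof. by rewrite /sdot linearZ /= -!scalemxAl mxE. Qed.
Lemma sdotZr c x y : sdot x (c *: y) = c * sdot x y.
Proof. by rewrite /sdot -scalemxAr mxE. Qed.
Lemma sdot0l x : sdot 0 x = 0.
Proof. by rewrite -(scale0r 0) sdotZl mul0r. Qed.
Lemma sdot0r x : sdot x 0 = 0.
Proof. by rewrite -(scale0r 0) sdotZr mul0r. Qed.
Lemma sdotNl x y : sdot (- x) y = - sdot x y.
Proof. by rewrite -scaleN1r sdotZl mulN1r. Qed.
Lemma sdotNr x y : sdot x (- y) = - sdot x y.
Proof. by rewrite -scaleN1r sdotZr mulN1r. Qed.
Lemma sdotBl x y z : sdot (x - y) z = sdot x z - sdot y z.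
Proof. by rewrite sdotDl sdotNl. Qed.
Lemma sdotBr x y z : sdot x (y - z) = sdot x y - sdot x z.
Proof. by rewrite sdotDr sdotNr. Qed.

(* [J] is the difference of a matrix and its transpose, so the form is
   alternating even when 2 is a zero divisor. *)
Lemma sdotxx x : sdot x x = 0.
Proof.
pose U : 'M[R]_(g.*2) := \matrix_(i, j) (if odd i then 0 else (i.+1 == j :> nat)%:R).
have -> : sdot x x = (x^T *m (U - U^T) *m x) 0 0.
  congr ((_ *m _ *m _) _ _); apply/matrixP => i j; rewrite !mxE.
  case: ifP => oi; case: ifP => oj; rewrite ?sub0r ?subr0 //.
  - by case: eqP => // e; move: oi; rewrite e /= oj.
  - by rewrite eq_sym.
  have -> : (j.+1 == i) = false by apply/eqP => e; move: oi; rewrite -e /= oj.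
  by rewrite subr0.
rewrite mulmxBr mulmxBl mxE [X in _ + X]mxE.
have -> : x^T *m U^T *m x = (x^T *m U *m x)^T by rewrite !trmx_mul trmxK mulmxA.
by rewrite [(_^T) _ _]mxE subrr.
Qed.

Lemma symplectic_sdot (A : 'M[R]_(g.*2)) x y :
  symplectic A -> sdot (A *m x) (A *m y) = sdot x y.
Proof.
move=> /eqP hA; rewrite /sdot trmx_mul -!mulmxA [J *m _]mulmxA [A^T *m _]mulmxA.
by rewrite [A^T *m _]mulmxA hA mulmxA.
Qed.

Definition tvm (x : vec) (c : R) : 'M[R]_(g.*2) := 1%:M + c *: (x *m (x^T *m J)).

Lemma tvmE x c v : tvm x c *m v = v + (c * sdot x v) *: x.
Proof.
rewrite /tvm mulmxDl mul1mx -scalemxAl -mulmxA sdotE mul_mx_scalar.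
by rewrite scalerA.
Qed.

Lemma symplecticP (A : 'M[R]_(g.*2)) :
  (forall x y, sdot (A *m x) (A *m y) = sdot x y) -> symplectic A.
Proof.
move=> h; apply/eqP/matrixP => i j.
have entry (M : 'M[R]_(g.*2)) :
    ((delta_mx i 0 : vec)^T *m M *m (delta_mx j 0 : vec)) 0 0 = M i j.
  by rewrite trmx_delta -rowE -colE !mxE.
have := h (delta_mx i 0) (delta_mx j 0); rewrite {2}/sdot entry => <-.
rewrite -[LHS]entry /sdot.
by rewrite trmx_mul !mulmxA.
Qed.

Lemma tvm_symplectic x c : symplectic (tvm x c).
Proof.
apply: symplecticP => u v; rewrite !tvmE !(sdotDl, sdotDr, sdotZl, sdotZr).
by rewrite sdotxx (sdotC u x); ring.
Qed.

Definition tv x c : Sp R g := MkSp (tvm_symplectic x c).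

Lemma tvmD x c d : tvm x (c + d) = tvm x c *m tvm x d.
Proof.
apply: mulmx_eq => v; rewrite -mulmxA !tvmE sdotDr sdotZr sdotxx mulr0 addr0.
by rewrite -addrA -scalerDl; congr (_ + _ *: _); ring.
Qed.

Lemma tvm0 x : tvm x 0 = 1%:M.
Proof. by rewrite /tvm scale0r addr0. Qed.

Lemma tvm0v c : tvm 0 c = 1%:M.
Proof. by rewrite /tvm mul0mx scaler0 addr0. Qed.

Lemma tvmNr x c : tvm x c *m tvm x (- c) = 1%:M.
Proof. by rewrite -tvmD subrr tvm0. Qed.

Lemma tvmNl x c : tvm x (- c) *m tvm x c = 1%:M.
Proof. by rewrite -tvmD addNr tvm0. Qed.

Lemma tvmZ d x c : tvm (d *: x) c = tvm x (d ^+ 2 * c).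
Proof.
apply: mulmx_eq => v; rewrite !tvmE sdotZl scalerA.
by congr (_ + _ *: _); ring.
Qed.

Lemma tvmN x c : tvm (- x) c = tvm x c.
Proof. by rewrite -scaleN1r tvmZ sqrrN expr1n mul1r. Qed.

Lemma tvm_conj (A : 'M[R]_(g.*2)) x c : symplectic A ->
  A *m tvm x c = tvm (A *m x) c *m A.
Proof.
move=> hA; apply: mulmx_eq => v.
by rewrite -!mulmxA !tvmE mulmxDr -scalemxAr symplectic_sdot.
Qed.

(** Polarization: the terms along x x^T and y y^T cancel, and orthogonality removes everything
    quadratic in c. What remains is the exponential of c (x y^T + y x^T) J, whose square is zero. *)
Lemma tvm_pair x y c v : sdot x y = 0 ->
  tvm (x + y) c *m tvm x (- c) *m tvm y (- c) *m v =
  v + (c * sdot y v) *: x + (c * sdot x v) *: y.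
Proof.
move=> xy; have yx : sdot y x = 0 by rewrite sdotC xy oppr0.
rewrite -!mulmxA !tvmE.
rewrite !(sdotDl, sdotDr, sdotZl, sdotZr) !sdotxx xy yx.
by apply/colP => i; rewrite !mxE; ring.
Qed.

End Transvections.


(** * Words in elementary transvections *)

Section Words.
Variables (R : comUnitRingType) (g : nat).
Local Notation J := (symplectic_form R g).
Local Notation vec := 'cV[R]_(g.*2).

(* Basis vectors are indexed by [nat] and vanish out of range; the hyperbolic
   pairs are [(av p, cv p)], i.e. the paper's [(a_p, b_p)]. *)
Definition bv (i : nat) : vec := \col_j (j == i :> nat)%:R.
Definition av (p : nat) := bv p.*2.
Definition cv (p : nat) := bv p.*2.+1.

Lemma bv_delta (i : 'I_(g.*2)) : bv i = delta_mx i 0.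
Proof. by apply/colP => j; rewrite !mxE eqxx andbT. Qed.

Lemma bv_out i : (g.*2 <= i)%N -> bv i = 0.
Proof.
move=> h; apply/colP => j; rewrite !mxE; case: eqP => // e.
by have := ltn_ord j; rewrite e ltnNge h.
Qed.

Lemma sdot_bvl (i : 'I_(g.*2)) v : sdot (bv i) v = (J *m v) i 0.
Proof. by rewrite /sdot bv_delta trmx_delta -mulmxA -rowE mxE. Qed.

Lemma sdot_bv (i j : nat) : (i < g.*2)%N -> (j < g.*2)%N ->
  sdot (bv i) (bv j) = if odd i then - (i == j.+1)%:R else (i.+1 == j)%:R.
Proof.
move=> hi hj; rewrite (sdot_bvl (Ordinal hi)) (bv_delta (Ordinal hj)) -colE.
by rewrite !mxE.
Qed.

Lemma lt_av p : (p < g)%N -> (p.*2 < g.*2)%N. Proof. lia. Qed.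
Lemma lt_cv p : (p < g)%N -> (p.*2.+1 < g.*2)%N. Proof. lia. Qed.

Lemma sdot_aa p q : sdot (av p) (av q) = 0.
Proof.
have [hp|hp] := ltnP p g; last by rewrite /av bv_out ?sdot0l // leq_double.
have [hq|hq] := ltnP q g; last by rewrite /av [bv q.*2]bv_out ?sdot0r // leq_double.
rewrite sdot_bv ?lt_av // odd_double; case: eqP => // e.
by have := odd_double q; rewrite -e /= odd_double.
Qed.

Lemma sdot_cc p q : sdot (cv p) (cv q) = 0.
Proof.
have [hp|hp] := ltnP p g; last by rewrite /cv bv_out ?sdot0l //; lia.
have [hq|hq] := ltnP q g; last by rewrite /cv [bv q.*2.+1]bv_out ?sdot0r //; lia.
rewrite sdot_bv ?lt_cv //= odd_double /=; case: eqP => [e|]; last by rewrite oppr0.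
by exfalso; lia.
Qed.

Lemma sdot_ac p q : (p < g)%N -> (q < g)%N -> sdot (av p) (cv q) = (p == q)%:R.
Proof.
move=> hp hq; rewrite sdot_bv ?lt_cv ?lt_av //= odd_double /=.
by congr (_%:R); apply/eqP/eqP; lia.
Qed.

Lemma sdot_ca p q : (p < g)%N -> (q < g)%N -> sdot (cv p) (av q) = - (p == q)%:R.
Proof. by move=> hp hq; rewrite sdotC sdot_ac // eq_sym. Qed.

Lemma sdot_nondeg (v : vec) :
  (forall p, (p < g)%N -> sdot (av p) v = 0 /\ sdot (cv p) v = 0) -> v = 0.
Proof.
move=> h; have Jv : J *m v = 0.
  apply/colP => i; rewrite -sdot_bvl [RHS]mxE.
  have hi : (i./2 < g)%N by have := ltn_ord i; lia.
  have [h1 h2] := h _ hi; have := odd_double_half i.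
  by case: (odd i) => /= <-.
rewrite -[v]mul1mx -[1%:M]opprK -mulmx_symplectic_form mulNmx -mulmxA Jv.
by rewrite mulmx0 oppr0.
Qed.

Lemma sdot_inj (v w : vec) :
  (forall p, (p < g)%N -> sdot (av p) v = sdot (av p) w /\ sdot (cv p) v = sdot (cv p) w) ->
  v = w.
Proof.
move=> h; apply/eqP; rewrite -subr_eq0; apply/eqP/sdot_nondeg => p hp.
by have [h1 h2] := h p hp; rewrite !sdotBr h1 h2 !subrr.
Qed.

(** On the diagonal this is [bv i] and not twice it, so that one indexed family contains the three
    transvections combined in [pword]. *)
Definition sv (i j : nat) : vec := if i == j then bv i else bv i + bv j.

(* The letter [(i, j, c)] stands for the transvection [tvm (sv i j) c]; for
   [c = 1] these are finitely many generators. *)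
Definition letter : Type := (nat * nat * R)%type.
Definition lmx (a : letter) := tvm (sv a.1.1 a.1.2) a.2.
Fixpoint wmx (l : seq letter) : 'M[R]_(g.*2) :=
  if l is a :: l' then lmx a *m wmx l' else 1%:M.
(** [m] counts the initial hyperbolic planes that the word leaves alone (see [wok_fixes]); the
    reduction to the identity is an induction over these planes. *)
Definition wok (m : nat) (l : seq letter) :=
  all (fun a : letter => (m.*2 <= a.1.1 < g.*2)%N && (m.*2 <= a.1.2 < g.*2)%N) l.
Definition winv (l : seq letter) := rev [seq (a.1, - a.2) | a : letter <- l].

Lemma wmx_cat l1 l2 : wmx (l1 ++ l2) = wmx l1 *m wmx l2.
Proof. by elim: l1 => [|a l ih] /=; rewrite ?mul1mx // ih mulmxA. Qed.

Lemma wmx_catv n l1 l2 (v : 'M_(_, n)) :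
  wmx (l1 ++ l2) *m v = wmx l1 *m (wmx l2 *m v).
Proof. by rewrite wmx_cat mulmxA. Qed.

Lemma wok_cat m l1 l2 : wok m (l1 ++ l2) = wok m l1 && wok m l2.
Proof. exact: all_cat. Qed.

Lemma wok_winv m l : wok m (winv l) = wok m l.
Proof. by rewrite /wok /winv all_rev all_map; apply: eq_all => -[]. Qed.

Lemma wmx_winvr l : wmx l *m wmx (winv l) = 1%:M.
Proof.
elim: l => [|a l ih]; first by rewrite mul1mx.
rewrite /winv /= rev_cons -cats1 wmx_cat /= mulmx1.
rewrite mulmxA -[_ *m wmx l *m _]mulmxA ih mulmx1.
by rewrite /lmx /= tvmNr.
Qed.

Lemma winvK l : winv (winv l) = l.
Proof.
rewrite /winv map_rev revK -map_comp -[RHS]map_id; apply: eq_map => -[x y].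
by rewrite /= opprK.
Qed.

Lemma wmx_winvl l : wmx (winv l) *m wmx l = 1%:M.
Proof. by rewrite -{2}[l]winvK wmx_winvr. Qed.

Lemma wmx_symplectic l : symplectic (wmx l).
Proof.
by elim: l => [|a l ih]; rewrite ?symplectic1 // symplecticM ?tvm_symplectic.
Qed.

Definition wSp l : Sp R g := MkSp (wmx_symplectic l).

Lemma sdot_bv_far m i p : (m.*2 <= i)%N -> (p < m)%N ->
  sdot (bv i) (av p) = 0 /\ sdot (bv i) (cv p) = 0.
Proof.
move=> hi hp; have [hg|hg] := ltnP i g.*2; last by rewrite bv_out ?sdot0l.
rewrite /av /cv !sdot_bv; try lia.
by split; case: ifP => oi; case: eqP => e; rewrite ?oppr0 //; exfalso; lia.
Qed.

Lemma sdot_sv_far m i j p : (m.*2 <= i)%N -> (m.*2 <= j)%N -> (p < m)%N ->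
  sdot (sv i j) (av p) = 0 /\ sdot (sv i j) (cv p) = 0.
Proof.
move=> hi hj hp; rewrite /sv; case: ifP => _; first exact: sdot_bv_far hi hp.
rewrite !sdotDl; have [-> ->] := sdot_bv_far hi hp.
by have [-> ->] := sdot_bv_far hj hp; rewrite !addr0.
Qed.

Definition fixes m (A : 'M[R]_(g.*2)) :=
  forall p, (p < m)%N -> A *m av p = av p /\ A *m cv p = cv p.

Lemma fixesM m A B : fixes m A -> fixes m B -> fixes m (A *m B).
Proof.
move=> hA hB p hp; rewrite -!mulmxA.
by have [-> ->] := hB p hp; apply: hA.
Qed.

Lemma wok_fixes m l : wok m l -> fixes m (wmx l).
Proof.
elim: l => [|[[i j] c] l ih] /=; first by move=> _ p _; rewrite !mul1mx.
move=> /andP [/andP [/andP [hi _] /andP [hj _]] hl]; apply: fixesM (ih hl).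
move=> p hp; rewrite !tvmE /=; have [-> ->] := sdot_sv_far hi hj hp.
by rewrite !mulr0 !scale0r !addr0.
Qed.

Definition reach m (v w : vec) := exists2 l, wok m l & wmx l *m v = w.

Lemma reach_refl m v : reach m v v.
Proof. by exists [::]; rewrite // mul1mx. Qed.

Lemma reach_trans m u v w : reach m u v -> reach m v w -> reach m u w.
Proof.
move=> [l1 h1 <-] [l2 h2 <-]; exists (l2 ++ l1); first by rewrite wok_cat h1 h2.
by rewrite wmx_cat mulmxA.
Qed.

Lemma reach_tv m i c v : (m.*2 <= i < g.*2)%N ->
  reach m v (v + (c * sdot (bv i) v) *: bv i).
Proof.
move=> hi; exists [:: (i, i, c)]; first by rewrite /wok /= hi.
by rewrite /= mulmx1 /lmx /sv eqxx tvmE.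
Qed.

Definition pword i j (c : R) : seq letter := [:: (i, j, c); (i, i, - c); (j, j, - c)].

Lemma pwordE i j c v : i != j -> sdot (bv i) (bv j) = 0 ->
  wmx (pword i j c) *m v =
  v + (c * sdot (bv j) v) *: bv i + (c * sdot (bv i) v) *: bv j.
Proof.
move=> nij h; rewrite /= /lmx /sv (negPf nij) !eqxx mulmx1 mulmxA.
by rewrite tvm_pair.
Qed.

Lemma pword_ok m i j c : (m.*2 <= i < g.*2)%N -> (m.*2 <= j < g.*2)%N ->
  wok m (pword i j c).
Proof. by move=> hi hj; rewrite /wok /= hi hj. Qed.

Lemma reach_pair m i j c v : (m.*2 <= i < g.*2)%N -> (m.*2 <= j < g.*2)%N ->
  i != j -> sdot (bv i) (bv j) = 0 ->
  reach m v (v + (c * sdot (bv j) v) *: bv i + (c * sdot (bv i) v) *: bv j).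
Proof.
by move=> hi hj nij h; exists (pword i j c); rewrite ?pword_ok ?pwordE.
Qed.

(** Only additions occur, no swaps and no scalings: these are the operations that lift to symplectic
    words. *)
Inductive elem2 : R * R -> R * R -> Prop :=
| elem2_refl p : elem2 p p
| elem2_l x y c p : elem2 (x + c * y, y) p -> elem2 (x, y) p
| elem2_r x y c p : elem2 (x, y + c * x) p -> elem2 (x, y) p.

Lemma elem2_plane m p u (s t : R * R) : (m <= p < g)%N -> elem2 s t ->
  sdot (av p) u = 0 -> sdot (cv p) u = 0 ->
  reach m (u + s.1 *: av p + s.2 *: cv p) (u + t.1 *: av p + t.2 *: cv p).
Proof.
move=> /andP [mp pg] st h1 h2; elim: st => {s t} [s|x y c t _ ih|x y c t _ ih] /=.
- exact: reach_refl.
- apply: reach_trans ih.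
  have := @reach_tv m p.*2 c (u + x *: av p + y *: cv p).
  rewrite -/(av p) !(sdotDr, sdotZr) h1 sdotxx sdot_ac // eqxx => H.
  have -> : u + (x + c * y) *: av p + y *: cv p = u + x *: av p + y *: cv p +
      (c * (0 + x * 0 + y * 1)) *: av p by apply/colP => i; rewrite !mxE; ring.
  by apply: H; lia.
- apply: reach_trans ih.
  have := @reach_tv m p.*2.+1 (- c) (u + x *: av p + y *: cv p).
  rewrite -/(cv p) !(sdotDr, sdotZr) h2 sdotxx sdot_ca // eqxx => H.
  have -> : u + x *: av p + (y + c * x) *: cv p = u + x *: av p + y *: cv p +
      (- c * (0 + x * - 1 + y * 0)) *: cv p by apply/colP => i; rewrite !mxE; ring.
  by apply: H; lia.
Qed.

(** The words used here also add a multiple of [cv q] or [cv p]; its coefficient is a c coordinate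
    of the vector, and these are zero. *)
Lemma elem2_pair m p q u (s t : R * R) : (m <= p < g)%N -> (m <= q < g)%N ->
  p != q -> elem2 s t ->
  sdot (av p) u = 0 -> sdot (cv p) u = 0 -> sdot (av q) u = 0 -> sdot (cv q) u = 0 ->
  reach m (u + s.1 *: av p + s.2 *: av q) (u + t.1 *: av p + t.2 *: av q).
Proof.
move=> /andP [mp pg] /andP [mq qg] npq st h1 h2 h3 h4.
have nqp : q != p by rewrite eq_sym.
elim: st => {s t} [s|x y c t _ ih|x y c t _ ih] /=.
- exact: reach_refl.
- apply: reach_trans ih.
  have := @reach_pair m p.*2 q.*2.+1 (- c) (u + x *: av p + y *: av q).
  rewrite -/(av p) -/(cv q) !(sdotDr, sdotZr) h1 h4 !sdot_aa !sdot_ca // eqxx.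
  rewrite (negPf nqp) => H.
  have -> : u + (x + c * y) *: av p + y *: av q = u + x *: av p + y *: av q +
      (- c * (0 + x * - 0%:R + y * - 1%:R)) *: av p + (- c * (0 + x * 0 + y * 0)) *: cv q.
    by apply/colP => i; rewrite !mxE; ring.
  apply: H; rewrite ?sdot_ac ?(negPf npq) //; lia.
- apply: reach_trans ih.
  have := @reach_pair m q.*2 p.*2.+1 (- c) (u + x *: av p + y *: av q).
  rewrite -/(av q) -/(cv p) !(sdotDr, sdotZr) h2 h3 !sdot_aa !sdot_ca // eqxx.
  rewrite (negPf npq) => H.
  have -> : u + x *: av p + (y + c * x) *: av q = u + x *: av p + y *: av q +
      (- c * (0 + x * - 1%:R + y * - 0%:R)) *: av q + (- c * (0 + x * 0 + y * 0)) *: cv p.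
    by apply/colP => i; rewrite !mxE; ring.
  apply: H; rewrite ?sdot_ac ?(negPf nqp) //; lia.
Qed.

(** Isolating the gcd computation in this form lets generation be proved once, for [int] and for
    fields. *)
Definition euclidean := forall x y : R, exists d, elem2 (x, y) (d, 0).
Hypothesis eucl : euclidean.

Definition low m (v : vec) :=
  forall p, (p < m)%N -> sdot (av p) v = 0 /\ sdot (cv p) v = 0.

Lemma reach_low m v w : low m v -> reach m v w -> low m w.
Proof.
move=> hv [l hl <-] p hp; have [{1}<- {1}<-] := wok_fixes hl hp.
by rewrite !(symplectic_sdot _ _ (wmx_symplectic l)); apply: hv.
Qed.

(** By hyperbolicity, [sdot v (cv p)] and [sdot (av p) v] are the coordinates of [v] along [av p]
    and [cv p]. *)
Lemma plane_split p v : (p < g)%N -> exists u,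
  [/\ v = u + sdot v (cv p) *: av p + sdot (av p) v *: cv p,
      sdot (av p) u = 0, sdot (cv p) u = 0 &
      forall q, q != p -> (q < g)%N -> sdot (av q) u = sdot (av q) v /\
        sdot (cv q) u = sdot (cv q) v].
Proof.
move=> hp; exists (v - sdot v (cv p) *: av p - sdot (av p) v *: cv p); split.
- by apply/colP => i; rewrite !mxE; ring.
- by rewrite !sdotBr !sdotZr sdot_aa sdot_ac // eqxx mulr1 mulr0 subr0 subrr.
- rewrite !sdotBr !sdotZr sdot_cc sdot_ca // eqxx (sdotC (cv p) v).
  by rewrite mulr0 subr0 mulrN mulr1 subrr.
move=> q nqp hq; rewrite !sdotBr !sdotZr !sdot_aa !sdot_cc sdot_ac // sdot_ca //.
by rewrite (negPf nqp) oppr0 !mulr0 !subr0.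
Qed.

Lemma reduce_plane m p v : (m <= p < g)%N -> exists v',
  [/\ reach m v v', sdot (av p) v' = 0 &
      forall q, q != p -> (q < g)%N -> sdot (av q) v' = sdot (av q) v /\
        sdot (cv q) v' = sdot (cv q) v].
Proof.
move=> hp; have /andP [_ pg] := hp; have [u [vE u1 u2 u3]] := plane_split v pg.
have [d hd] := eucl (sdot v (cv p)) (sdot (av p) v).
exists (u + d *: av p); split.
- by rewrite {1}vE; have := elem2_plane hp hd u1 u2; rewrite /= scale0r addr0.
- by rewrite sdotDr sdotZr u1 sdot_aa mulr0 addr0.
move=> q nqp hq; have [<- <-] := u3 q nqp hq; rewrite !sdotDr !sdotZr sdot_aa.
by rewrite sdot_ca // (negPf nqp) oppr0 !mulr0 !addr0.
Qed.

(** Plane by plane, the Euclidean algorithm inside plane r clears the c coordinate, and the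
    Euclidean algorithm between [av m] and [av r] then absorbs what is left of that plane. *)
Lemma reduce_vec m v : (m < g)%N -> low m v -> exists d, reach m v (d *: av m).
Proof.
move=> mg hv.
suff [v' [h1 h2]] : exists v', reach m v v' /\ (forall p, (p < g)%N ->
    sdot (av p) v' = 0 /\ (p != m -> sdot (cv p) v' = 0)).
  exists (sdot v' (cv m)); suff <- : v' = sdot v' (cv m) *: av m by [].
  apply: sdot_inj => p hp; have [e1 e2] := h2 p hp.
  rewrite e1 !sdotZr sdot_aa mulr0 sdot_ca //; split=> //.
  case: (eqVneq p m) e2 => [-> _|_ ->] //; last by rewrite mulrN mulr0 oppr0.
  by rewrite sdotC mulrN mulr1.
suff H : forall r, (m < r <= g)%N -> exists v', reach m v v' /\
    (forall p, (p < r)%N -> sdot (av p) v' = 0 /\ (p != m -> sdot (cv p) v' = 0)).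
  by apply: H; rewrite mg /=.
have mmg : (m <= m < g)%N by lia.
elim=> [|r ih]; first by rewrite ltn0.
move=> /andP [mr rg]; case: (eqVneq r m) => [rm|nrm].
  have [v' [h1 h2 h3]] := reduce_plane v mmg.
  exists v'; split=> // p hp; case: (eqVneq p m) => [->|npm].
    by rewrite h2.
  have hpm : (p < m)%N by lia.
  have [-> ->] := h3 p npm (ltn_trans hpm mg).
  by have [-> ->] := hv p hpm.
have {mr} mr : (m < r)%N by lia.
have [v1 [hv1 h1]] : exists v', reach m v v' /\ (forall p, (p < r)%N ->
    sdot (av p) v' = 0 /\ (p != m -> sdot (cv p) v' = 0)).
  by apply: ih; rewrite mr ltnW.
have mrg : (m <= r < g)%N by lia.
have [v2 [hv2 e2 h2]] := reduce_plane v1 mrg.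
have [u [v2E u1 u2 u3]] := plane_split v2 rg.
have [w [uE w1 w2 w3]] := plane_split u mg.
have nmr : m != r by rewrite eq_sym.
have umr : sdot (av m) u = 0.
  by have [-> _] := u3 m nmr mg; have [-> _] := h2 m nmr mg; have [] := h1 m mr.
have wr : sdot (av r) w = 0 /\ sdot (cv r) w = 0.
  by have [-> ->] := w3 r nrm rg.
have [d hd] := eucl (sdot u (cv m)) (sdot v2 (cv r)).
exists (w + d *: av m); split.
  apply: reach_trans hv1 _; apply: reach_trans hv2 _.
  have v2E' : v2 = w + sdot u (cv m) *: av m + sdot v2 (cv r) *: av r.
    by rewrite {1}v2E e2 scale0r addr0 {1}uE umr scale0r addr0.
  have := elem2_pair mmg mrg nmr hd w1 w2 wr.1 wr.2.
  by rewrite /= scale0r addr0 -v2E'.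
move=> p hp; rewrite !sdotDr !sdotZr sdot_aa mulr0 addr0.
have pg : (p < g)%N by lia.
case: (eqVneq p m) => [->|npm]; first by split.
rewrite sdot_ca // (negPf npm) mulrN mulr0 subr0.
case: (eqVneq p r) => [->|npr]; first by have [-> ->] := wr.
have pr : (p < r)%N by lia.
have [-> ->] := w3 p npm pg; have [-> ->] := u3 p npr pg.
have [-> ->] := h2 p npr pg; have [-> h] := h1 p pr.
by rewrite h.
Qed.
End Words.


(** * Generation by transvections from the Euclidean algorithm *)

Section Generation.
Variables (R : comUnitRingType) (g : nat).
Local Notation vec := 'cV[R]_(g.*2).
Local Notation bv := (bv R g).
Local Notation av := (av R g).
Local Notation cv := (cv R g).
Hypothesis eucl : euclidean R.

Lemma unit_plane m d : (m < g)%N -> d \is a GRing.unit ->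
  reach m (d *: av m) (av m).
Proof.
move=> mg ud; have mm : (m <= m < g)%N by rewrite leqnn.
have h : elem2 (d, 0) (1, 0).
  (* The path is (d, 0), (d, 1), (1, 1), (1, 0). *)
  apply: (@elem2_r _ _ _ d^-1); rewrite mulVr // add0r.
  apply: (@elem2_l _ _ _ (1 - d)); rewrite mulr1 addrC subrK.
  by apply: (@elem2_r _ _ _ (-1)); rewrite mulr1 subrr; apply: elem2_refl.
have := elem2_plane mm h (sdot0r (av m)) (sdot0r (cv m)).
by rewrite /= !scale0r !addr0 !add0r scale1r.
Qed.

(** The pairing with [y] is transported to a pairing of [d *: av m] with value 1, so the gcd [d] is
    a unit and can be scaled away inside its own plane. *)
Lemma reduce_unimodular m x y : (m < g)%N -> low m x -> sdot x y = 1 ->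
  reach m x (av m).
Proof.
move=> mg hx xy; have [d hd] := reduce_vec eucl mg hx.
apply: reach_trans (hd) _; apply: unit_plane => //; have [l hl e] := hd.
apply/unitrPr; exists (sdot (av m) (wmx g l *m y)).
by rewrite -sdotZl -e (symplectic_sdot _ _ (wmx_symplectic _ l)).
Qed.

Lemma unimodular_conj x y x' y' : (0 < g)%N -> sdot x y = 1 -> sdot x' y' = 1 ->
  exists A : Sp R g, (A : 'M_(g.*2)) *m x = x'.
Proof.
move=> g0 xy xy'.
have [|l1 _ h1] := reduce_unimodular g0 _ xy; first by move=> p.
have [|l2 _ h2] := reduce_unimodular g0 _ xy'; first by move=> p.
exists (wSp g (winv l2) * wSp g l1)%g => /=.
by rewrite -mulmxA h1 -h2 mulmxA wmx_winvl mul1mx.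
Qed.

(** Each later plane r is cleared by the words pairing [av m] with [av r] and with [cv r], both of
    which fix [av m]. No division occurs, because the coordinate of [y] on [cv m] is 1. The
    transvection of [av m] finally removes the coordinate on [av m] itself. *)
Lemma fix_last m y : (m < g)%N -> low m y -> sdot (av m) y = 1 ->
  exists l, [/\ wok g m l, wmx g l *m av m = av m & wmx g l *m y = cv m].
Proof.
move=> mg hy ay.
suff H r : (m < r <= g)%N -> exists l,
    [/\ wok g m l, wmx g l *m av m = av m & forall p, (m < p < r)%N ->
      sdot (av p) (wmx g l *m y) = 0 /\ sdot (cv p) (wmx g l *m y) = 0].
  have [l [hl la h]] := H g (introT andP (conj mg (leqnn g))).
  set v := wmx g l *m y in h.
  have av_v : sdot (av m) v = 1.
    by rewrite -la /v (symplectic_sdot _ _ (wmx_symplectic _ l)).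
  have lowv : low m v by apply: reach_low hy _; exists l.
  pose c := sdot (cv m) v.
  exists ([:: (m.*2, m.*2, c)] ++ l).
  rewrite wok_cat hl !wmx_catv la -/v /= mulmx1 /lmx /sv eqxx !tvmE.
  rewrite -/(av m) sdotxx av_v mulr0 scale0r addr0 mulr1; split=> //.
    by rewrite !andbT; lia.
  apply: sdot_inj => p hp; rewrite !sdotDr !sdotZr sdot_aa mulr0 addr0.
  rewrite sdot_ac // sdot_cc sdot_ca //.
  case: (ltngtP p m) => [pm|pm|->].
  - by have [-> ->] := lowv p pm; rewrite !mulr0n oppr0 mulr0 addr0.
  - by have [|-> ->] := h p; rewrite ?pm // !mulr0n oppr0 mulr0 addr0.
  - by rewrite av_v mulrN mulr1 subrr.
elim: r => [|r ih]; first by rewrite ltn0.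
move=> /andP [mr rg]; case: (eqVneq m r) => [->|nmr].
  exists [::]; rewrite /= !mul1mx; split=> // p; lia.
have [|l [hl la h]] := ih; first by lia.
have nrm : r != m by rewrite eq_sym.
set v := wmx g l *m y in h.
have av_v : sdot (av m) v = 1.
  by rewrite -la /v (symplectic_sdot _ _ (wmx_symplectic _ l)).
pose c1 := sdot (cv r) v.
pose v1 := v + (c1 * sdot (av r) v) *: av m + c1 *: av r.
pose c2 := - sdot (av r) v.
pose v2 := v1 + c2 *: cv r.
have e1 : wmx g (pword m.*2 r.*2 c1) *m v = v1.
  rewrite pwordE -/(av m) -/(av r) ?sdot_aa // ?av_v ?mulr1 //; lia.
have e1' : sdot (cv r) v1 = 0.
  rewrite !sdotDr !sdotZr !sdot_ca // eqxx (negPf nrm).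
  by rewrite oppr0 mulr0 addr0 mulrN mulr1 subrr.
have e1'' : sdot (av m) v1 = 1 by rewrite !sdotDr !sdotZr !sdot_aa av_v !mulr0 !addr0.
have e2 : wmx g (pword m.*2 r.*2.+1 c2) *m v1 = v2.
  rewrite pwordE -/(av m) -/(cv r) ?sdot_ac ?(negPf nmr) //; last by lia.
  by rewrite e1' e1'' mulr0 scale0r addr0 mulr1.
exists (pword m.*2 r.*2.+1 c2 ++ pword m.*2 r.*2 c1 ++ l).
rewrite !wok_cat hl !wmx_catv la -/v e1 e2; split.
- by rewrite !pword_ok //; lia.
- have -> : wmx g (pword m.*2 r.*2 c1) *m av m = av m.
    rewrite pwordE -/(av m) -/(av r) ?sdot_aa //; last by lia.
    by rewrite !mulr0 !scale0r !addr0.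
  rewrite pwordE -/(av m) -/(cv r) ?sdot_ac ?(negPf nmr) //; last by lia.
  by rewrite sdot_ca // (negPf nrm) oppr0 sdot_aa !mulr0 !scale0r !addr0.
move=> p hp; rewrite /v2 !sdotDr !sdotZr.
have pg : (p < g)%N by lia.
have pm : (p == m) = false by apply/eqP; lia.
rewrite !sdot_aa !sdot_cc !sdot_ca // !sdot_ac // pm oppr0 !mulr0 !addr0.
case: (eqVneq p r) => [->|npr].
  by rewrite mulr1 subrr mulrN mulr1 subrr.
by have [|-> ->] := h p; rewrite ?oppr0 ?mulr0 ?addr0 //; lia.
Qed.

Lemma symplectic_fixes (A : 'M[R]_(g.*2)) : fixes g A -> A = 1%:M.
Proof.
move=> hA; apply/matrixP => i j; have /colP/(_ i) : A *m bv j = bv j.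
  have hj : (j./2 < g)%N by have := ltn_ord j; lia.
  have [h1 h2] := hA _ hj; have := odd_double_half j.
  by case: (odd j) => /= <-.
by rewrite bv_delta -colE !mxE andbT.
Qed.

Lemma symplectic_reduce (A : 'M[R]_(g.*2)) : symplectic A ->
  exists2 l, wok g 0 l & wmx g l *m A = 1%:M.
Proof.
move=> hA.
suff H n m (B : 'M[R]_(g.*2)) : (m + n = g)%N -> symplectic B -> fixes m B ->
    exists2 l, wok g 0 l & wmx g l *m B = 1%:M.
  by apply: (H g 0%N A) => //; rewrite add0n.
elim: n m B => [|n ih] m B mn hB fB.
  exists [::] => //; rewrite mul1mx; apply: symplectic_fixes => p pg.
  by apply: fB; rewrite -[m]addn0 mn.
have mg : (m < g)%N by lia.
have wok0 l : wok g m l -> wok g 0 l.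
  by apply: sub_all => -[[i j] c] /=; lia.
have lowB x : low m x -> low m (B *m x).
  move=> hx p hp; have [{1}<- {1}<-] := fB p hp.
  by rewrite !(symplectic_sdot _ _ hB); apply: hx.
have low_a : low m (av m) by move=> p pm; rewrite sdot_aa sdot_ca ?(ltn_eqF pm) ?oppr0 //; lia.
have low_c : low m (cv m) by move=> p pm; rewrite sdot_cc sdot_ac ?(ltn_eqF pm) //; lia.
have ac : sdot (B *m av m) (B *m cv m) = 1.
  by rewrite symplectic_sdot // sdot_ac // eqxx.
have [l1 hl1 e1] := reduce_unimodular mg (lowB _ low_a) ac.
have [||l2 [hl2 ea ec]] := @fix_last m (wmx g l1 *m (B *m cv m)) mg.
- by apply: reach_low (lowB _ low_c) _; exists l1.
- by rewrite -e1 (symplectic_sdot _ _ (wmx_symplectic _ l1)).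
have [|||l hl e] := ih m.+1 (wmx g l2 *m (wmx g l1 *m B)).
- lia.
- by rewrite !symplecticM ?wmx_symplectic.
- move=> p; rewrite ltnS leq_eqVlt => /orP [/eqP ->|pm].
    by rewrite -!mulmxA e1 ea ec.
  by have := fixesM (wok_fixes hl2) (fixesM (wok_fixes hl1) fB); apply.
exists (l ++ l2 ++ l1); first by rewrite !wok_cat hl !wok0.
by rewrite !wmx_catv e.
Qed.

Lemma symplectic_word (A : 'M[R]_(g.*2)) : symplectic A ->
  exists2 l, wok g 0 l & wmx g l = A.
Proof.
move=> /symplectic_reduce [l hl e]; exists (winv l); first by rewrite wok_winv.
by rewrite -[LHS]mulmx1 -e mulmxA wmx_winvl mul1mx.
Qed.
End Generation.

Lemma field_euclidean (F : fieldType) : euclidean F.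
Proof.
move=> x y; have [->|x0] := eqVneq x 0; last first.
  exists x; apply: (@elem2_r _ _ _ (- (y / x))); rewrite mulNr divfK // subrr.
  exact: elem2_refl.
exists y; apply: (@elem2_l _ _ _ 1); rewrite add0r mul1r.
by apply: (@elem2_r _ _ _ (-1)); rewrite mulN1r subrr; apply: elem2_refl.
Qed.

Lemma int_euclidean : euclidean int.
Proof.
move=> x y; have [n] := ubnP `|y|%N; elim: n x y => // n ih x y yn.
have [->|y0] := eqVneq y 0; first by exists x; apply: elem2_refl.
have [|d hd] := ih y (- (x %% y)%Z).
  have := modz_ge0 x y0; have := ltz_mod x y0; lia.
exists d; apply: (@elem2_l _ _ _ (- (x %/ y)%Z)).
have -> : x + - (x %/ y)%Z * y = (x %% y)%Z by rewrite mulNr {1}(divz_eq x y); lia.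
apply: (@elem2_r _ _ _ (-1)); rewrite mulN1r.
apply: (@elem2_l _ _ _ 1); rewrite mul1r addrC subrK.
by apply: (@elem2_r _ _ _ (-1)); rewrite mulN1r [y - _]addrC addrK.
Qed.


(** * Dual basis and relations between transvections *)

Section DualBasis.
Variables (R : comUnitRingType) (g : nat).
Local Notation vec := 'cV[R]_(g.*2).
Local Notation bv := (bv R g).
Local Notation av := (av R g).
Local Notation cv := (cv R g).

Definition dv i : vec := if odd i then - bv i.-1 else bv i.+1.

Lemma sdot_dv i j : (i < g.*2)%N -> (j < g.*2)%N ->
  sdot (bv j) (dv i) = (j == i)%:R.
Proof.
move=> hi hj; rewrite /dv; case: ifP => oi.
  rewrite sdotNr sdot_bv //; last by lia.
  case: ifP => oj; first by rewrite opprK; congr (_%:R); apply/eqP/eqP; lia.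
  case: eqP => [e|_]; first by exfalso; lia.
  by case: eqP => [e|_]; [rewrite e oi in oj | rewrite oppr0].
rewrite sdot_bv //; last by lia.
case: ifP => oj; last by congr (_%:R); apply/eqP/eqP; lia.
case: eqP => [e|_]; first by exfalso; lia.
by case: eqP => [e|_]; [rewrite e oi in oj | rewrite oppr0].
Qed.

Lemma sv_unimodular i j : (i < g.*2)%N -> (j < g.*2)%N ->
  exists y, sdot (sv R g i j) y = 1.
Proof.
move=> hi hj; exists (dv i); rewrite /sv; case: eqVneq => [_|nij].
  by rewrite sdot_dv // eqxx.
by rewrite sdotDl !sdot_dv // eqxx eq_sym (negPf nij) addr0.
Qed.

(* The lantern relation: every vector on the right other than multiples of [x]
   stays part of a hyperbolic pair orthogonal to [x]. *)
Lemma lantern (x y z : vec) : sdot x y = 0 -> sdot x z = 0 -> sdot y z = 0 ->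
  tvm x 1 = tvm (x + y) 1 *m (tvm (x + z) 1 *m (tvm (y + z) 1 *m
    (tvm y (-1) *m (tvm z (-1) *m tvm (x + y + z) (-1))))).
Proof.
move=> xy xz yz.
have yx : sdot y x = 0 by rewrite sdotC xy oppr0.
have zx : sdot z x = 0 by rewrite sdotC xz oppr0.
have zy : sdot z y = 0 by rewrite sdotC yz oppr0.
apply: mulmx_eq => v; rewrite -!mulmxA !tvmE.
rewrite !(sdotDl, sdotDr, sdotZl, sdotZr) !sdotxx xy xz yz yx zx zy.
by apply/colP => i; rewrite !mxE; ring.
Qed.

Lemma tv_conj (A : Sp R g) x c :
  (tv (Sp_val A *m x) c * A = A * tv x c)%g.
Proof. by apply: val_inj; rewrite /= tvm_conj // Sp_valP. Qed.

Lemma tv_add (x : vec) c d : tv x (c + d) = (tv x c * tv x d)%g.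
Proof. by apply: val_inj; rewrite /= tvmD. Qed.

Lemma tv_inv (x : vec) c : tv x (- c) = (tv x c)^-1%g.
Proof.
apply/esym/mulg1_eq; rewrite -tv_add subrr; apply: val_inj; exact: tvm0.
Qed.
End DualBasis.

(** * Transvections under the block inclusion *)

Section BlockTransvections.
Variables (R : comUnitRingType) (g : nat).

Lemma tvm_entry h i c (r s : 'I_(h.*2)) : (i < h.*2)%N ->
  tvm (bv R h i) c r s = (r == s)%:R +
   c * ((r == i :> nat)%:R * (if odd i then - (i == s.+1 :> nat)%:R
                               else (i.+1 == s :> nat)%:R)).
Proof.
move=> hi; rewrite /tvm !mxE big_ord1 !mxE (bigD1 (Ordinal hi)) //= big1.
  by rewrite !mxE /= eqxx mul1r addr0.
move=> j nj; rewrite !mxE; case: eqP => [e|]; last by rewrite mul0r.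
by case/eqP: nj; apply: val_inj.
Qed.

Lemma Sp_stab_tv i c : (i < g.*2)%N ->
  Sp_stab (tv (bv R g i) c) = tv (bv R g.+1 i) c.
Proof.
move=> hi; apply: val_inj; apply/matrixP => r s.
have hi' : (i < g.+1.*2)%N by rewrite doubleS; lia.
rewrite /= tvm_entry // /block_diag castmxE /= !mxE.
set r' := cast_ord _ r; set s' := cast_ord _ s.
have er : nat_of_ord r = r' by []. have es : nat_of_ord s = s' by [].
have -> : (r == s) = (r' == s' :> nat) by [].
rewrite er es.
case: splitP => [a ->|a ->]; rewrite mxE; case: splitP => [b ->|b ->].
- by rewrite tvm_entry.
- rewrite mxE; have la := ltn_ord a.
  have -> : (nat_of_ord a == g.*2 + b)%N = false by apply/eqP; lia.
  case: ifP => oi.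
    have -> : (i == (g.*2 + b).+1) = false by apply/eqP; lia.
    by rewrite oppr0 !mulr0 addr0.
  have -> : (i.+1 == g.*2 + b)%N = false by apply/eqP; lia.
  by rewrite !mulr0 addr0.
- rewrite mxE; have lb := ltn_ord b.
  have -> : (g.*2 + a == b)%N = false by apply/eqP; lia.
  have -> : (g.*2 + a == i)%N = false by apply/eqP; lia.
  by rewrite mul0r mulr0 addr0.
- rewrite mxE.
  have -> : (g.*2 + a == i)%N = false by apply/eqP; lia.
  by rewrite mul0r mulr0 addr0 eqn_add2l.
Qed.

Lemma Sp_block_tv c : Sp_block 1%g (tv (bv R 1 0) c) = tv (bv R g.+1 g.*2) c.
Proof.
apply: val_inj; apply/matrixP => r s.
have hi' : (g.*2 < g.+1.*2)%N by rewrite doubleS; lia.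
rewrite /= tvm_entry // /block_diag castmxE /= !mxE.
set r' := cast_ord _ r; set s' := cast_ord _ s.
have er : nat_of_ord r = r' by []. have es : nat_of_ord s = s' by [].
have -> : (r == s) = (r' == s' :> nat) by [].
rewrite er es odd_double.
case: splitP => [a ->|a ->]; rewrite mxE; case: splitP => [b ->|b ->].
- rewrite mxE; have la := ltn_ord a.
  have -> : (nat_of_ord a == g.*2) = false by apply/eqP; lia.
  by rewrite mul0r mulr0 addr0.
- rewrite mxE; have la := ltn_ord a.
  have -> : (nat_of_ord a == g.*2 + b)%N = false by apply/eqP; lia.
  have -> : (nat_of_ord a == g.*2) = false by apply/eqP; lia.
  by rewrite mul0r mulr0 addr0.
- rewrite mxE; have lb := ltn_ord b.
  have -> : (g.*2 + a == b)%N = false by apply/eqP; lia.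
  have -> : ((g.*2).+1 == b) = false by apply/eqP; lia.
  by rewrite !mulr0 addr0.
- rewrite tvm_entry //= eqn_add2l.
  have -> : (g.*2 + a == g.*2)%N = (nat_of_ord a == 0%N) by apply/eqP/eqP; lia.
  by have -> : ((g.*2).+1 == g.*2 + b)%N = (1%N == b) by apply/eqP/eqP; lia.
Qed.
End BlockTransvections.

(** * Finite dimensionality *)

Section Spans.
Variables (k : fieldType) (V : lmodType k).

Lemma lin_span_in (S : V -> Prop) v : S v -> v \in lin_span S.
Proof.
move=> Sv; apply/asboolP; exists 1%N, (fun=> 1), (fun=> v); split=> //.
by rewrite big_ord1 scale1r.
Qed.

Lemma lin_span_sub (S : V -> Prop) (W : submodClosed V) :
  (forall v, S v -> v \in W) -> forall v, v \in lin_span S -> v \in W.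
Proof.
move=> h v /asboolP [n [c [s [Ss ->]]]]; apply: rpred_sum => i _.
by apply: rpredZ; apply: h.
Qed.

Lemma rpred_oppm (W : submodClosed V) v : v \in W -> - v \in W.
Proof. by move=> hv; rewrite -scaleN1r rpredZ. Qed.

Lemma rpred_subm (W : submodClosed V) u v : u \in W -> v \in W -> u - v \in W.
Proof. by move=> hu hv; rewrite rpredD // rpred_oppm. Qed.

Lemma lin_span_seq (s : seq V) v : v \in lin_span (fun x => x \in s) ->
  exists c : 'I_(size s) -> k, v = \sum_(i < size s) c i *: s`_i.
Proof.
move=> /asboolP [n [c [t [ts ->]]]].
elim: n c t ts => [|n ih] c t ts.
  exists (fun=> 0); rewrite big_ord0 big1 // => i _; exact: scale0r.
have [d hd] := ih (fun i => c (lift ord0 i)) (fun i => t (lift ord0 i)) (fun i => ts _).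
have h := ts ord0; have hi : (index (t ord0) s < size s)%N by rewrite index_mem.
exists (fun i => (if i == Ordinal hi then c ord0 else 0) + d i).
rewrite big_ord_recl hd; under [RHS]eq_bigr do rewrite scalerDl.
rewrite big_split /=; congr (_ + _); rewrite (bigD1 (Ordinal hi)) //= eqxx.
rewrite nth_index // big1 ?addr0 // => i /negPf ->; exact: scale0r.
Qed.

Lemma finite_dimP : finite_dim V <->
  exists s : seq V, forall v, v \in lin_span (fun x => x \in s).
Proof.
split=> [[n [s hs]]|[s hs]].
  exists [seq s i | i <- enum 'I_n] => v; have [c ->] := hs v.
  apply: rpred_sum => i _; apply: rpredZ; apply: lin_span_in.
  by apply: map_f; rewrite mem_enum.
by exists (size s), (fun i => s`_i) => v; apply: lin_span_seq.
Qed.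

Definition fd_set (P : V -> Prop) :=
  exists s : seq V, forall v, P v -> v \in lin_span (fun x => x \in s).

Lemma lin_span_catl (s t : seq V) v : v \in lin_span (fun x => x \in s) ->
  v \in lin_span (fun x => x \in s ++ t).
Proof.
apply: lin_span_sub => w hw; apply: lin_span_in.
by rewrite mem_cat hw.
Qed.

Lemma lin_span_catr (s t : seq V) v : v \in lin_span (fun x => x \in t) ->
  v \in lin_span (fun x => x \in s ++ t).
Proof.
apply: lin_span_sub => w hw; apply: lin_span_in.
by rewrite mem_cat hw orbT.
Qed.

Lemma fd_set_bigcup (P : nat -> V -> Prop) N :
  (forall i, (i < N)%N -> fd_set (P i)) ->
  fd_set (fun v => exists2 i, (i < N)%N & P i v).
Proof.
elim: N => [|N ih] h; first by exists [::] => v [].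
have [|s hs] := ih; first by move=> i hi; apply: h; apply: ltnW.
have [t ht] := h N (ltnSn N); exists (s ++ t) => v [i].
rewrite ltnS leq_eqVlt => /orP [/eqP ->|hi] Pv.
  by apply: lin_span_catr; apply: ht.
by apply: lin_span_catl; apply: hs; exists i.
Qed.

Lemma quot_pi_inj (W : submodClosed V) (u v : V) :
  quot_pi W u = quot_pi W v -> u - v \in W.
Proof.
move=> e; have h := quot_pi_repr W u; have := quot_pi_repr W v.
rewrite -e => h'; have -> : u - v = (quot_repr (quot_pi W u) - v) -
  (quot_repr (quot_pi W u) - u) by rewrite opprB [RHS]addrC addrA subrK.
exact: rpred_subm.
Qed.

Lemma finite_dim_quot (W : submodClosed V) : finite_dim (quot_space W) ->
  exists s : seq V, forall v, exists2 w, w \in W &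
    v - w \in lin_span (fun x => x \in s).
Proof.
move=> [n [s hs]]; exists [seq quot_repr (s i) | i <- enum 'I_n] => v.
have [c hc] := hs (quot_pi W v); pose u := \sum_(i < n) c i *: quot_repr (s i).
exists (v - u); last first.
  rewrite opprB [v + _]addrC subrK; apply: rpred_sum => i _; apply: rpredZ.
  by apply: lin_span_in; apply: map_f; rewrite mem_enum.
apply: quot_pi_inj; rewrite hc linear_sum; apply: eq_bigr => i _.
by rewrite linearZ /= quot_reprK.
Qed.
End Spans.

Section FiniteDimension.
Variables (G : groupType) (k : fieldType) (V : lmodType k).
Variable rho : representation G V.

Lemma rep_actK x v : rho x (rho x^-1%g v) = v.
Proof. by rewrite -rep_actM mulgV rep_act1. Qed.

Definition moves_in (W : submodClosed V) x := forall v, rho x v - v \in W.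

Lemma moves_inM W x y : moves_in W x -> moves_in W y -> moves_in W (x * y)%g.
Proof.
move=> hx hy v; rewrite rep_actM -[_ - v](subrKA (rho y v)).
by rewrite rpredD.
Qed.

Lemma moves_inV W x : moves_in W x -> moves_in W x^-1%g.
Proof.
by move=> hx v; have := rpred_oppm (hx (rho x^-1%g v)); rewrite rep_actK opprB.
Qed.

Lemma moves_in_coinvariants (s : seq V) :
  (forall x, moves_in (lin_span (fun v => v \in s)) x) ->
  finite_dim (coinvariants rho) -> finite_dim V.
Proof.
move=> hs /finite_dim_quot [t ht]; apply/finite_dimP; exists (t ++ s) => v.
have [w hw hvw] := ht v; rewrite -[v](subrK w); apply: rpredD.
  exact: lin_span_catl.
apply: lin_span_catr; move: hw; apply: lin_span_sub => _ [u [x ->]].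
by rewrite -opprB; apply: rpred_oppm; apply: hs.
Qed.
End FiniteDimension.

Section CoherentFiniteDimension.
Variables (k : fieldType) (C : coherent_sequence k) (n : nat).
Local Notation g := n.+2.
Local Notation V := (coh_space C n.+1).
Local Notation rho := (coh_rep C n.+1).

Lemma last_fixes_image c v : v \in lin_image (coh_map C n) ->
  rho (tv (av int g n.+1) c) v = v.
Proof.
move=> /asboolP [u <-]; rewrite -(Sp_block_tv n.+1 c).
by rewrite -coh_equivariant rep_act1.
Qed.

Lemma last_moves_fd c : finite_dim (coker C n) ->
  fd_set (fun v => exists w, v = rho (tv (av int g n.+1) c) w - w).
Proof.
move=> /finite_dim_quot [s hs].
pose D : V -> V := fun w => rho (tv (av int g n.+1) c) w - w.
exists [seq D w | w <- s] => _ [w ->].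
have [u hu hw] := hs w; move: (w - u) hw (subrK u w) => w' hw' <-.
rewrite linearD (last_fixes_image c hu) opprD [- w' - u]addrC addrA addrK.
have [d ->] := lin_span_seq hw'; rewrite linear_sum -sumrB.
apply: rpred_sum => i _; rewrite linearZ -scalerBr; apply: rpredZ.
by apply: lin_span_in; apply: map_f; apply: mem_nth.
Qed.

(* Every letter is conjugate to the transvection of the last plane, which fixes
   the image of [coh_map] pointwise. *)
Lemma letter_moves_fd i j : (i < g.*2)%N -> (j < g.*2)%N ->
  finite_dim (coker C n) ->
  fd_set (fun v => exists w, v = rho (tv (sv int g i j) 1) w - w).
Proof.
move=> hi hj hC; have [y hy] := sv_unimodular int hi hj.
have ha : sdot (av int g n.+1) (cv int g n.+1) = 1 by rewrite sdot_ac // eqxx.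
have [A hA] := unimodular_conj int_euclidean (isT : 0 < g)%N ha hy.
have [s hs] := last_moves_fd 1 hC; exists [seq rho A w | w <- s] => _ [w ->].
have -> : rho (tv (sv int g i j) 1) w - w =
    rho A (rho (tv (av int g n.+1) 1) (rho A^-1%g w) - rho A^-1%g w).
  rewrite linearB rep_actK -(rep_actM rho A) -tv_conj hA rep_actM rep_actK.
  by [].
have [|d ->] := @lin_span_seq _ _ s (rho (tv (av int g n.+1) 1) (rho A^-1%g w) - rho A^-1%g w).
  by apply: hs; exists (rho A^-1%g w).
rewrite linear_sum; apply: rpred_sum => a _; rewrite linearZ; apply: rpredZ.
by apply: lin_span_in; apply: map_f; apply: mem_nth.
Qed.

Lemma finite_dim_coherent : finite_dim (coker C n) ->
  finite_dim (coinvariants rho) -> finite_dim V.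
Proof.
move=> hC; have [s hs] : exists s : seq V, forall i j, (i < g.*2)%N -> (j < g.*2)%N ->
    moves_in rho (lin_span (fun v => v \in s)) (tv (sv int g i j) 1).
  have [s hs] := fd_set_bigcup (fun i hi =>
    fd_set_bigcup (fun j hj => @letter_moves_fd i j hi hj hC)).
  exists s => i j hi hj v; apply: hs; exists i => //; exists j => //.
  by exists v.
apply: moves_in_coinvariants (s) _ => x.
have [l hl hx] := symplectic_word int_euclidean (Sp_valP x).
have {hx} -> : x = wSp g l by apply: val_inj.
elim: l hl => [_ v|[[i j] c] l ih] /=.
  have -> : wSp g [::] = 1%g :> Sp int g by apply: val_inj.
  by rewrite rep_act1 subrr rpred0.
move=> /andP [/andP [/= hi hj] hl].
have -> : wSp g ((i, j, c) :: l) = (tv (sv int g i j) c * wSp g l)%g by apply: val_inj.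
apply: moves_inM (ih hl); have {}hs := hs i j hi hj.
have tv1 : tv (sv int g i j) 0 = 1%g by apply: val_inj; rewrite /= tvm0.
(* Finiteness of the generating set required coefficient 1; the other transvections are powers of
   these. *)
elim/int_rect: c => [|m IH|m IH].
- by move=> v; rewrite tv1 rep_act1 subrr rpred0.
- have -> : m.+1%:Z = m%:Z + 1 by lia.
  by rewrite tv_add; apply: moves_inM.
- have -> : - m.+1%:Z = - m%:Z - 1 by lia.
  rewrite tv_add; apply: moves_inM => //.
  by rewrite tv_inv; apply: moves_inV.
Qed.
End CoherentFiniteDimension.


(** * Unipotence of transvections *)

Section PolynomialCurves.
Variable k : fieldType.

Lemma mpoly_line N (p : {mpoly k[N]}) (a b : 'I_N -> k) :
  exists P : {poly k}, forall c, P.[c] = p.@[fun i => a i + c * b i].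
Proof.
exists (\sum_(m <- msupp p) p@_m *: \prod_(i < N) ((a i)%:P + b i *: 'X) ^+ m i) => c.
rewrite mevalE horner_sum; apply: eq_bigr => m _; rewrite hornerZ horner_prod.
congr (_ * _); apply: eq_bigr => i _.
by rewrite horner_exp hornerD hornerC hornerZ hornerX mulrC.
Qed.

Lemma size_poly_shift (P : {poly k}) m : (size P <= m.+1)%N ->
  (size (P \Po ('X + 1%:P) - P : {poly k})%R <= m)%N.
Proof.
move=> hP; have sP : size (P \Po ('X + 1%:P) : {poly k}) = size P.
  by rewrite size_comp_poly2 // size_XaddC.
have [P0|P0] := eqVneq P 0; first by rewrite P0 comp_poly0 subrr size_poly0.
apply/leq_sizeP => j; rewrite leq_eqVlt => /orP [/eqP <-|mj]; last first.
  by rewrite coefB !nth_default ?subrr // ?sP; apply: leq_trans hP _.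
have [hs|hs] := ltnP (size P) m.+1.
  by rewrite coefB !nth_default ?subrr // ?sP.
have {hs} hs : size P = m.+1 by apply/eqP; rewrite eqn_leq hP.
have lcE : lead_coef (P \Po ('X + 1%:P)) = lead_coef P.
  by rewrite lead_coef_comp ?size_XaddC // lead_coefXaddC expr1n mulr1.
by move: lcE; rewrite !lead_coefE sP hs coefB /= => ->; rewrite subrr.
Qed.

(** Along an orbit that is polynomial in j, the operator T - 1 is the finite difference, which
    lowers the degree. *)
Lemma iter_diff_poly (U : lmodType k) (T : {linear U -> U}) n (w : 'I_n -> U) m :
  forall (P : 'I_n -> {poly k}) (f : nat -> U),
  (forall i, size (P i) <= m)%N -> (forall j, f j.+1 = T (f j)) ->
  (forall j, f j = \sum_(i < n) (P i).[j%:R] *: w i) ->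
  iter m (fun u => T u - u) (f 0%N) = 0.
Proof.
elim: m => [|m ih] P f sP fS fE.
  rewrite /= fE big1 // => i _; have := sP i; rewrite leqn0 size_poly_eq0.
  by move=> /eqP ->; rewrite horner0 scale0r.
rewrite iterSr.
apply: (ih (fun i => P i \Po ('X + 1%:P) - P i) (fun j => T (f j) - f j)).
- by move=> i; apply: size_poly_shift.
- by move=> j; rewrite fS linearB.
move=> j; rewrite -fS !fE -sumrB; apply: eq_bigr => i _.
rewrite -scalerBl hornerD hornerN horner_comp; congr (_ *: _).
by congr (_.[_] - _); rewrite hornerD hornerX hornerC mulrS addrC.
Qed.

Lemma iter_diff0 (U : lmodType k) (T : {linear U -> U}) m :
  iter m (fun u => T u - u) 0 = 0.
Proof. by elim: m => //= m ->; rewrite linear0 subrr. Qed.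

Lemma iter_diffD (U : lmodType k) (T : {linear U -> U}) m u v :
  iter m (fun u => T u - u) (u + v) =
  iter m (fun u => T u - u) u + iter m (fun u => T u - u) v.
Proof. by elim: m => //= m ->; rewrite linearD opprD addrACA. Qed.

Lemma iter_diffZ (U : lmodType k) (T : {linear U -> U}) m c u :
  iter m (fun u => T u - u) (c *: u) = c *: iter m (fun u => T u - u) u.
Proof. by elim: m => //= m ->; rewrite linearZ -scalerBr. Qed.

Lemma finite_dim_iter (U : lmodType k) (T : {linear U -> U}) : finite_dim U ->
  (forall u, exists m, iter m (fun u => T u - u) u = 0) ->
  exists m, forall u, iter m (fun u => T u - u) u = 0.
Proof.
move=> [n [s hs]] /choice [f hf].
have [m hm] : exists m, forall i, (f (s i) <= m)%N.
  by exists (\max_(i < n) f (s i)) => i; apply: (leq_bigmax (F := fun i => f (s i))).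
exists m => u; have [c ->] := hs u.
elim/big_rec: _ => [|i v _ ih]; first exact: iter_diff0.
rewrite iter_diffD iter_diffZ ih addr0.
by rewrite -(subnK (hm i)) iterD hf iter_diff0 scaler0.
Qed.

End PolynomialCurves.

Section AlgebraicUnipotent.
Variables (k : fieldType) (g : nat) (V : lmodType k).
Variable rho : representation (Sp int g) V.

Lemma Sp_map_tv i (c : int) :
  Sp_map intr (tv (bv int g i) c) = tv (bv k g i) c%:~R :> Sp k g.
Proof.
have [hi|hi] := ltnP i g.*2; last first.
  apply: val_inj; rewrite /= !bv_out // !tvm0v map_mx1 //.
apply: val_inj; apply/matrixP => r s; rewrite /= mxE !tvm_entry //.
rewrite rmorphD rmorphM rmorphM !rmorph_nat.
by case: ifP; rewrite ?rmorphN rmorph_nat.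
Qed.

(** A transvection is affine in its parameter, so its powers act on a vector by polynomials in the
    exponent. *)
Lemma algebraic_unipotent i : finite_dim V -> algebraic rho ->
  exists m, forall v, iter m (fun v => rho (tv (bv int g i) 1) v - v) v = 0.
Proof.
move=> fV [sigma psig sigE]; apply: finite_dim_iter => // v.
have [n [p [w hw]]] := psig v.
pose a (r : 'I_(g.*2 * g.*2)) : k := mxvec (1%:M : 'M[k]_(g.*2)) 0 r.
pose b (r : 'I_(g.*2 * g.*2)) : k :=
  mxvec (bv k g i *m ((bv k g i)^T *m symplectic_form k g)) 0 r.
have [P hP] := choice (fun j => mpoly_line (p j) a b).
exists (\max_(j < n) size (P j)).
pose f (j : nat) := rho (tv (bv int g i) j%:Z) v.
have -> : v = f 0%N.
  rewrite /f; have -> : tv (bv int g i) 0%:Z = 1%g by apply: val_inj; rewrite /= tvm0.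
  by rewrite rep_act1.
apply: (@iter_diff_poly _ _ _ n w _ P) => j.
- exact: (leq_bigmax (F := fun j => size (P j))).
- rewrite /f -rep_actM; congr (rho _ v); apply: val_inj; rewrite /= -tvmD.
  by congr tvm; lia.
rewrite /f -sigE Sp_map_tv hw; apply: eq_bigr => l _; congr (_ *: _).
rewrite hP; apply: meval_eq => r; rewrite /a /b /= /tvm linearD linearZ /=.
by rewrite [LHS]mxE [X in _ + X = _]mxE.
Qed.
End AlgebraicUnipotent.

Section CoherentUnipotent.
Variables (k : fieldType) (C : coherent_sequence k) (n : nat).
Local Notation g := n.+2.
Local Notation V := (coh_space C n.+1).
Local Notation rho := (coh_rep C n.+1).
Local Notation av := (av int g).
Local Notation cv := (cv int g).

(* On [R = (T - 1) ^ m V], where [T] is the transvection of [a_0], all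
   transvections conjugate to that of the last plane under the stabilizer of [a_0]
   act trivially, because algebraicity of the cokernel puts [R] in the image of
   [coh_map].  The lantern relation then makes [T] itself trivial on [R]. *)
Lemma coherent_unipotent : (0 < n)%N -> finite_dim (coker C n) ->
  algebraic (coker_rep C n) ->
  exists m, forall v, iter m (fun v => rho (tv (av 0) 1) v - v) v = 0.
Proof.
move=> n0 fC aC; have [m hm] := algebraic_unipotent 0 fC aC.
(* [m] applications of T - 1 land in the image of [coh_map]; one more kills the result. *)
exists m.+1 => v; pose D m (v : V) := iter m (fun v => rho (tv (av 0) 1) v - v) v.
pose good x := forall v, rho (tv x 1) (D m v) = D m v.
have D_image u : D m u \in lin_image (coh_map C n).
  have := hm (quot_pi _ u); suff -> : iter m (fun q => coker_rep C n
      (tv (bv int n.+1 0) 1) q - q) (quot_pi _ u) = quot_pi _ (D m u).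
    by rewrite -[RHS](linear0 (quot_pi _)) => /quot_pi_inj; rewrite subr0.
  elim: (m) => //= j ->; rewrite quot_actE ?linearB /=; last exact: coh_image_stable.
  by rewrite Sp_stab_tv.
have good_last : good (av n.+1) by move=> u; apply: last_fixes_image.
have D_comm (A : Sp int g) u : Sp_val A *m av 0 = av 0 -> rho A (D m u) = D m (rho A u).
  move=> hA; rewrite /D; elim: (m) => //= j <-; rewrite linearB.
  by rewrite -!rep_actM -tv_conj hA.
have good_act (A : Sp int g) x : Sp_val A *m av 0 = av 0 -> good x -> good (Sp_val A *m x).
  move=> hA hx u; rewrite -{1}[u](rep_actK rho A) -D_comm // -rep_actM tv_conj.
  by rewrite rep_actM hx D_comm // rep_actK.
(* Three such words fix [av 0] and produce all the vectors of the lantern relation from [av n.+1]: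
   one adds [av 0], one adds [av 1], and the third removes [av n.+1] in the presence of [av 1]. They
   need plane 1 to differ from plane [n.+1], which is where [n0] is used. *)
pose A i j c : Sp int g := wSp g (pword i j c).
have AE i j c u : i != j -> sdot (bv int g i) (bv int g j) = 0 -> Sp_val (A i j c) *m u =
   u + (c * sdot (bv int g j) u) *: bv int g i + (c * sdot (bv int g i) u) *: bv int g j.
  exact: pwordE.
have g1 : (n.+1 < g)%N by lia.
have A1 u : Sp_val (A 0 n.+1.*2.+1 (-1)) *m u =
    u - sdot (cv n.+1) u *: av 0 - sdot (av 0) u *: cv n.+1.
  rewrite AE //; last by rewrite -/(av 0) -/(cv n.+1) sdot_ac.
  by rewrite -/(av 0) -/(cv n.+1) !mulN1r !scaleNr.
have A2 u : Sp_val (A 2 n.+1.*2.+1 (-1)) *m u =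
    u - sdot (cv n.+1) u *: av 1 - sdot (av 1) u *: cv n.+1.
  have e : (1%N == n.+1) = false by lia.
  rewrite AE //; last by rewrite -/(av 1) -/(cv n.+1) sdot_ac // e.
  by rewrite -/(av 1) -/(cv n.+1) !mulN1r !scaleNr.
have A3 u : Sp_val (A n.+1.*2 3 1) *m u =
    u + sdot (cv 1) u *: av n.+1 + sdot (av n.+1) u *: cv 1.
  have e : (n.+1 == 1)%N = false by lia.
  rewrite AE; first by rewrite -/(av n.+1) -/(cv 1) !mul1r.
    by lia.
  by rewrite -/(av n.+1) -/(cv 1) sdot_ac // e.
have n1 : (n.+1 == 1)%N = false by lia.
have ca p q : (p < g)%N -> (q < g)%N -> sdot (cv p) (av q) = - (p == q)%:R.
  exact: sdot_ca.
have A1_0 : Sp_val (A 0 n.+1.*2.+1 (-1)) *m av 0 = av 0.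
  by rewrite A1 sdot_aa ca //= oppr0 !scale0r !subr0.
have A2_0 : Sp_val (A 2 n.+1.*2.+1 (-1)) *m av 0 = av 0.
  by rewrite A2 sdot_aa ca //= oppr0 !scale0r !subr0.
have A3_0 : Sp_val (A n.+1.*2 3 1) *m av 0 = av 0.
  by rewrite A3 sdot_aa ca //= oppr0 !scale0r !addr0.
have g_0l : good (av 0 + av n.+1).
  have := good_act _ _ A1_0 good_last.
  by rewrite A1 sdot_aa ca // eqxx scaleN1r scale0r subr0 opprK addrC.
have g_1l : good (av 1 + av n.+1).
  have := good_act _ _ A2_0 good_last.
  by rewrite A2 sdot_aa ca // eqxx scaleN1r scale0r subr0 opprK addrC.
have g_01l : good (av 0 + av 1 + av n.+1).
  have := good_act _ _ A1_0 g_1l.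
  rewrite A1 !sdotDr !sdot_aa !ca // eqxx n1 oppr0 add0r addr0 scaleN1r scale0r.
  by rewrite subr0 opprK addrC addrA.
have g_1 : good (av 1).
  have := good_act _ _ A3_0 g_1l.
  rewrite A3 !sdotDr !sdot_aa !ca // eqxx [1%N == n.+1]eq_sym n1 oppr0 !addr0 scaleN1r scale0r.
  by rewrite addr0 addrK.
have g_01 : good (av 0 + av 1).
  have := good_act _ _ A3_0 g_01l.
   rewrite A3 !sdotDr !sdot_aa !ca // eqxx [1%N == n.+1]eq_sym n1 oppr0 !addr0 add0r scaleN1r.
  by rewrite scale0r addr0 addrK.
have goodV x u : good x -> rho (tv x (-1)) (D m u) = D m u.
  move=> hx; rewrite -{1}(hx u) -rep_actM -tv_add addNr.
  have -> : tv x 0 = 1%g by apply: val_inj; rewrite /= tvm0.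
  by rewrite rep_act1.
have lan := lantern (sdot_aa int g 0 1) (sdot_aa int g 0 n.+1) (sdot_aa int g 1 n.+1).
rewrite iterS -/(D m v); apply/eqP; rewrite subr_eq0; apply/eqP.
have -> : tv (av 0) 1 = (tv (av 0 + av 1) 1 * (tv (av 0 + av n.+1) 1 *
   (tv (av 1 + av n.+1) 1 * (tv (av 1) (-1) * (tv (av n.+1) (-1) *
    tv (av 0 + av 1 + av n.+1) (-1))))))%g.
  by apply: val_inj; rewrite /= lan.
by rewrite !rep_actM !goodV // g_1l g_0l g_01.
Qed.
End CoherentUnipotent.


(** * Exponentials and logarithms of matrices *)

Section NilpotentExponential.
Variables (R : comUnitRingType) (d n0 : nat).
Hypothesis natu : forall m, (m.+1)%:R \is a @GRing.unit R.

Lemma fact_unit m : (m`!)%:R \is a @GRing.unit R.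
Proof.
elim: m => [|m ih]; first by rewrite fact0 unitr1.
by rewrite factS natrM unitrM natu.
Qed.

(** The exponential of c Y, cut off at a nilpotency bound [n0] of Y. Being a polynomial in c, it
    makes sense over k[t] and k(t) as well as over k, and commutes with specialization of t. *)
Definition nexp (Y : 'M[R]_d) (c : R) : 'M[R]_d :=
  \sum_(m < n0) (c ^+ m / (m`!)%:R) *: Y ^+ m.

Lemma scalemx_expr (a : R) (Y : 'M[R]_d) m : (a *: Y) ^+ m = a ^+ m *: Y ^+ m.
Proof.
elim: m => [|m ih]; first by rewrite !expr0 scale1r.
by rewrite !exprS ih -!mulmxE -scalemxAl -scalemxAr scalerA.
Qed.

Lemma nexpZ (Y : 'M[R]_d) a c : nexp (a *: Y) c = nexp Y (a * c).
Proof.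
apply: eq_bigr => m _; rewrite scalemx_expr scalerA exprMn.
by congr (_ *: _); rewrite mulrC mulrA.
Qed.

Lemma nexp_conj (U Y Y' : 'M[R]_d) c : U * Y = Y' * U ->
  U * nexp Y c = nexp Y' c * U.
Proof.
move=> h; rewrite /nexp mulr_sumr mulr_suml; apply: eq_bigr => m _.
rewrite -!mulmxE -scalemxAl -scalemxAr !mulmxE; congr (_ *: _).
elim: (m : nat) => [|j ih]; first by rewrite !expr0 mulr1 mul1r.
by rewrite !exprSr mulrA ih -mulrA h mulrA.
Qed.

Lemma nexp0 (Y : 'M[R]_d) : (0 < n0)%N -> nexp Y 0 = 1.
Proof.
move=> h; rewrite /nexp (bigD1 (Ordinal h)) //= big1 => [|[[|m] hm] //= _].
  by rewrite expr0 fact0 divr1 scale1r addr0 expr0.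
by rewrite exprS !mul0r scale0r.
Qed.

Lemma nexpD (Y : 'M[R]_d) c e : Y ^+ n0 = 0 -> nexp Y (c + e) = nexp Y c * nexp Y e.
Proof.
move=> Y0.
pose G i j : 'M[R]_d := (c ^+ i / (i`!)%:R * (e ^+ j / (j`!)%:R)) *: Y ^+ (i + j).
have -> : nexp Y c * nexp Y e = \sum_(i < n0) \sum_(j < n0) G i j.
  rewrite /nexp mulr_suml; apply: eq_bigr => i _; rewrite mulr_sumr.
  apply: eq_bigr => j _; rewrite -!mulmxE -scalemxAl -scalemxAr scalerA mulmxE.
  by rewrite -exprD.
(* Nilpotency kills the terms with i + j >= n0, so the square sum becomes triangular and can be
   regrouped by total degree. *)
have -> : \sum_(i < n0) \sum_(j < n0) G i j =
    \sum_(i < n0) \sum_(m < n0 | (i <= m)%N) G i (m - i)%N.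
  apply: eq_bigr => i _.
  rewrite -(big_mkord xpredT (G i)) (@big_cat_nat _ _ _ (n0 - i)%N 0%N n0) ?leq_subr //=.
  rewrite [X in _ + X = _]big1_seq => [|j /andP [_]]; last first.
    rewrite mem_index_iota => /andP [h _].
    rewrite /G; have -> : (i + j = n0 + (i + j - n0))%N by lia.
    by rewrite exprD Y0 mul0r scaler0.
  rewrite addr0 -(big_mkord (fun m => i <= m)%N (fun m => G i (m - i)%N)).
  rewrite (@big_cat_nat _ _ _ i 0%N n0) //=; last exact: ltnW.
  rewrite [X in _ = X + _]big1_seq => [|j /andP [h]]; last first.
    by rewrite mem_index_iota; lia.
  rewrite add0r -[X in _ = \sum_(X <= _ < _ | _) _]add0n big_addn; apply: congr_big_nat => // j hj.
    by rewrite leq_addl.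
  by rewrite addnK.
rewrite (exchange_big_dep xpredT) //=; apply: eq_bigr => m _.
transitivity (\sum_(i < m.+1) G i (m - i)%N); last first.
  by rewrite (big_ord_widen n0 (fun i => G i (m - i)%N)) ?ltn_ord.
rewrite [c + e]addrC exprDn mulr_suml scaler_suml; apply: eq_bigr => i _.
have im : (i <= m)%N by rewrite -ltnS.
rewrite /G subnKC //; congr (_ *: _).
have h : 'C(m, i)%:R * ((i`!)%:R * ((m - i)`!)%:R) = (m`!)%:R :> R.
  by rewrite -!natrM bin_fact.
have ui := fact_unit i; have umi := fact_unit (m - i); have um := fact_unit m.
have ub : 'C(m, i)%:R \is a @GRing.unit R by move: um; rewrite -h unitrM => /andP [].
rewrite -h -mulr_natr !invrM ?unitrM ?ui ?umi ?ub //.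
transitivity ('C(m, i)%:R / 'C(m, i)%:R *
  (c ^+ i / (i`!)%:R * (e ^+ (m - i) / ((m - i)`!)%:R))); first by ring.
by rewrite divrr // mul1r.
Qed.
End NilpotentExponential.

Lemma mulmxX_map (R S : comUnitRingType) (f : {rmorphism R -> S}) d (Y : 'M[R]_d) m :
  map_mx f (Y ^+ m) = map_mx f Y ^+ m.
Proof.
elim: m => [|m ih]; first by rewrite !expr0 map_mx1.
by rewrite !exprS -!mulmxE map_mxM ih.
Qed.

Lemma nexp_map (R S : comUnitRingType) (f : {rmorphism R -> S}) d n0 (Y : 'M[R]_d) c :
  (forall m, (m.+1)%:R \is a @GRing.unit R) ->
  map_mx f (nexp n0 Y c) = nexp n0 (map_mx f Y) (f c).
Proof.
move=> hu; rewrite /nexp map_mx_sum; apply: eq_bigr => m _.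
rewrite map_mxZ mulmxX_map; congr (_ *: _).
by rewrite rmorphM rmorphV ?fact_unit // rmorphXn rmorph_nat.
Qed.

Lemma scalemx_mull (R : comUnitRingType) d (a : R) (X Z : 'M[R]_d) :
  (a *: X) * Z = a *: (X * Z).
Proof. by rewrite -!mulmxE scalemxAl. Qed.

Lemma scalemx_mulr (R : comUnitRingType) d (a : R) (X Z : 'M[R]_d) :
  X * (a *: Z) = a *: (X * Z).
Proof. by rewrite -!mulmxE scalemxAr. Qed.

Section PolynomialMatrices.
Variables (k : fieldType) (char0 : [pchar k] =i pred0).

Lemma natr0 m : (m.+1)%:R != 0 :> k.
Proof. by rewrite ((pcharf0P k).1 char0). Qed.

Lemma natr_inj i j : i%:R = j%:R :> k -> i = j.
Proof.
wlog ij : i j / (i <= j)%N => [h e|].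
  by have [/h|/ltnW /h <-] := leqP i j; rewrite ?e //; apply.
move=> e; have := subrr (i%:R : k); rewrite {1}e -natrB // => /eqP.
rewrite ((pcharf0P k).1 char0) subn_eq0 => ji; by apply/eqP; rewrite eqn_leq ij.
Qed.

Lemma poly_nat_eq (p q : {poly k}) : (forall j : nat, p.[j%:R] = q.[j%:R]) -> p = q.
Proof.
move=> h; apply/eqP; rewrite -subr_eq0; apply/eqP.
apply: (@roots_geq_poly_eq0 _ _ [seq j%:R | j <- iota 0 (size (p - q))]).
- by apply/allP => _ /mapP [j _ ->]; rewrite rootE hornerD hornerN h subrr.
- by rewrite map_inj_uniq ?iota_uniq // => i j /natr_inj.
- by rewrite size_map size_iota.
Qed.

Variable d : nat.
Local Notation pmx := 'M[{poly k}]_d.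

Definition ev (c : k) (P : pmx) : 'M[k]_d := map_mx (horner_eval c) P.
Definition lin (P : pmx) : 'M[k]_d := map_mx (fun p : {poly k} => p^`().[0]) P.

Lemma evM c P Q : ev c (P * Q) = ev c P * ev c Q.
Proof. by rewrite /ev -!mulmxE map_mxM. Qed.

Lemma evC c (A : 'M[k]_d) : ev c (map_mx polyC A) = A.
Proof. by apply/matrixP => i j; rewrite !mxE /horner_eval hornerC. Qed.

Lemma linC (A : 'M[k]_d) : lin (map_mx polyC A) = 0.
Proof. by apply/matrixP => i j; rewrite !mxE derivC horner0. Qed.

Lemma linM P Q : lin (P * Q) = lin P * ev 0 Q + ev 0 P * lin Q.
Proof.
apply/matrixP => i j; rewrite -!mulmxE !mxE linear_sum horner_sum -big_split /=.
by apply: eq_bigr => l _; rewrite derivM !hornerE !mxE /horner_eval.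
Qed.

Lemma ev_nat_eq P Q : (forall j : nat, ev j%:R P = ev j%:R Q) -> P = Q.
Proof.
move=> h; apply/matrixP => a b; apply: poly_nat_eq => j.
by have /matrixP/(_ a b) := h j; rewrite !mxE.
Qed.

(* [f] is polynomial with [f 0 = 1] and derivative [D] at 0. *)
Definition curve (f : nat -> 'M[k]_d) (D : 'M[k]_d) :=
  exists P : pmx, [/\ forall j, f j = ev j%:R P, ev 0 P = 1 & lin P = D].

Lemma curve_uniq f D D' : curve f D -> curve f D' -> D = D'.
Proof.
move=> [P [fP _ <-]] [Q [fQ _ <-]]; congr lin; apply: ev_nat_eq => j.
by rewrite -fP fQ.
Qed.

Lemma curve_ext f f' D : (forall j, f j = f' j) -> curve f D -> curve f' D.
Proof. by move=> e [P [h1 h2 h3]]; exists P; split=> // j; rewrite -e. Qed.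

Lemma curveM f f' D D' : curve f D -> curve f' D' ->
  curve (fun j => f j * f' j) (D + D').
Proof.
move=> [P [fP P0 <-]] [Q [fQ Q0 <-]]; exists (P * Q); split=> [j||].
- by rewrite evM fP fQ.
- by rewrite evM P0 Q0 mulr1.
- by rewrite linM P0 Q0 mulr1 mul1r.
Qed.

Lemma polyC_natu m : (m.+1)%:R \is a @GRing.unit {poly k}.
Proof. by rewrite -polyC_natr poly_unitE coefC /= size_polyC natr0 unitfE natr0. Qed.

Lemma natuF m : (m.+1)%:R \is a @GRing.unit k.
Proof. by rewrite unitfE natr0. Qed.

(** A polynomial exponent covers the linear parameters j as well as the error term j^2 of the
    Heisenberg relation, which has derivative 0. The bound [1 < n0] keeps the linear term of the
    truncated series. *)
Lemma curve_nexp n0 (Y : 'M[k]_d) (p : {poly k}) : (1 < n0)%N -> p.[0] = 0 ->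
  curve (fun j => nexp n0 Y p.[j%:R]) (p^`().[0] *: Y).
Proof.
move=> h1 p0; exists (nexp n0 (map_mx polyC Y) p).
have evE c : ev c (nexp n0 (map_mx polyC Y) p) = nexp n0 Y p.[c].
  by rewrite /ev nexp_map -/(ev _ _) ?evC //; apply: polyC_natu.
split=> [j||]; first by rewrite evE.
  by rewrite evE p0 nexp0 // ltnW.
apply/matrixP => a b; rewrite !mxE /nexp summxE linear_sum horner_sum.
rewrite (bigD1 (Ordinal h1)) //= big1 ?addr0 => [|[[|[|m]] hm] //= _].
- by rewrite !expr1 factS fact0 divr1 !mxE derivM derivC !hornerE.
- rewrite expr0 fact0 divr1 expr0 scale1r -[1]/(1%:M) -(map_mx1 polyC) mxE.
  by rewrite derivC horner0.
- have h q : (p * (p * q))^`().[0] = 0.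
    by rewrite !(derivM, hornerD, hornerM) p0 !(mul0r, mulr0, addr0).
  by rewrite mxE -mulmxX_map mxE -mulrA !exprS -!mulrA h.
Qed.

(** Both sides are polynomial in j; this is their derivative at 0. *)
Lemma curve_conj f D Z Z1 : curve f D ->
  (forall j, f j * Z = (Z + j%:R *: Z1) * f j) -> D * Z = Z * D + Z1.
Proof.
move=> [P [fP P0 <-]] h.
have e : P * map_mx polyC Z = (map_mx polyC Z + 'X *: map_mx polyC Z1) * P.
  apply: ev_nat_eq => j; rewrite !evM evC -fP h; congr (_ * _).
  by apply/matrixP => a b; rewrite !mxE /horner_eval !hornerE.
have := congr1 lin e; rewrite !linM P0 mul1r mulr1 linC evC addr0 => ->.
rewrite addrC; congr (_ * _ + _).
  by apply/matrixP => a b; rewrite !mxE /horner_eval hornerD hornerM hornerX !hornerC mul0r addr0.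
apply/matrixP => a b; rewrite !mxE derivD derivC derivM derivX derivC.
by rewrite mulr0 addr0 mul1r add0r hornerC.
Qed.

Lemma ffact_poly m : exists p : {poly k}, forall j, p.[j%:R] = (j ^_ m)%:R.
Proof.
elim: m => [|m [p hp]]; first by exists 1 => j; rewrite hornerC ffactn0.
exists (p * ('X - (m%:R)%:P)) => j; rewrite hornerM hp hornerXsubC ffactnSr natrM.
have [mj|jm] := leqP m j; first by rewrite natrB.
by rewrite ffact_small // !mul0r.
Qed.

(** The binomial expansion of (1 + (u - 1))^j stops at N, and each binomial coefficient is a
    polynomial in j. *)
Lemma unipotent_poly (u : 'M[k]_d) N : (u - 1) ^+ N = 0 ->
  exists P : pmx, forall j, u ^+ j = ev j%:R P.
Proof.
move=> hu; have [p hp] := choice ffact_poly.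
exists (\sum_(m < N) (p m * ((m`!)%:R^-1)%:P) *: map_mx polyC ((u - 1) ^+ m)) => j.
have -> : ev j%:R (\sum_(m < N) (p m * ((m`!)%:R^-1)%:P) *: map_mx polyC ((u - 1) ^+ m)) =
    \sum_(m < N) 'C(j, m)%:R *: (u - 1) ^+ m.
  rewrite /ev map_mx_sum; apply: eq_bigr => m _.
  rewrite map_mxZ -/(ev _ _) evC /horner_eval; congr (_ *: _).
  rewrite -[LHS]/((p m * _).[j%:R]) hornerM hornerC hp -bin_ffact natrM mulfK //.
  by have := fact_gt0 m; case: (m`!) => // l _; apply: natr0.
have ext a M (F : nat -> 'M[k]_d) : (a <= M)%N ->
    (forall i, (a <= i)%N -> F i = 0) -> \sum_(i < a) F i = \sum_(i < M) F i.
  move=> aM F0; rewrite (big_ord_widen _ F aM) big_mkcond; apply: eq_bigr => i _.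
  by case: ltnP => // /F0.
pose F m := 'C(j, m)%:R *: (u - 1) ^+ m.
rewrite -[RHS]/(\sum_(m < N) F m) (ext _ (maxn N j.+1)) ?leq_maxl //; last first.
  by move=> i hi; rewrite /F -(subnKC hi) exprD hu mul0r scaler0.
rewrite -(ext j.+1) ?leq_maxr //; last first.
  by move=> i hi; rewrite /F bin_small // scale0r.
rewrite -{1}[u](subrK 1) addrC exprDn_comm; last exact/commr_sym/commr1.
by apply: eq_bigr => i _; rewrite expr1n mul1r /F scaler_nat.
Qed.

(* If [u ^ j = P(j)] for a polynomial [P], comparing coefficients in
   [P(i + j) = u ^ i P(j)] gives [P' = P Y] with [Y = P'(0)], so [P = exp(t Y)]. *)
Lemma unipotent_log (u : 'M[k]_d) N : (u - 1) ^+ N = 0 ->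
  exists n0 (Y : 'M[k]_d), [/\ (1 < n0)%N, Y ^+ n0 = 0 &
    forall j : nat, u ^+ j = nexp n0 Y j%:R].
Proof.
move=> /unipotent_poly [P hP].
pose Y := lin P; pose co m : 'M[k]_d := map_mx (fun p : {poly k} => p`_m) P.
have PS i : map_mx (fun p : {poly k} => p \Po ('X + (i%:R)%:P)) P =
    map_mx polyC (u ^+ i) * P.
  apply: ev_nat_eq => j; rewrite evM evC -hP -exprD hP addnC.
  apply/matrixP => a b; rewrite !mxE /horner_eval horner_comp hornerD hornerX.
  by rewrite hornerC natrD.
have dP : map_mx (@deriv k) P = P * map_mx polyC Y.
  apply: ev_nat_eq => i; rewrite evM evC -hP.
  have := congr1 lin (PS i); rewrite linM linC mul0r add0r evC => <-.
  apply/matrixP => a b; rewrite !mxE deriv_comp derivD derivX derivC addr0 mulr1.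
  by rewrite /horner_eval horner_comp hornerD hornerX hornerC add0r.
have coS m : (m.+1)%:R *: co m.+1 = co m * Y.
  apply/matrixP => a b; have /matrixP/(_ a b) := dP.
  rewrite !mxE => /(congr1 (fun p : {poly k} => p`_m)).
  rewrite coef_deriv coef_sum mulr_natl => ->; apply: eq_bigr => l _.
  by rewrite !mxE coefMC.
have co0 : co 0%N = 1.
  rewrite -(expr0 u) hP; apply/matrixP => a b.
  by rewrite !mxE /horner_eval horner_coef0.
have coE m : co m = ((m`!)%:R^-1) *: Y ^+ m.
  elim: m => [|m ih]; first by rewrite co0 fact0 invr1 scale1r expr0.
  apply: (@scalerI _ _ (m.+1)%:R); first exact: natr0.
  rewrite coS ih scalerA factS natrM invfM mulrA divff ?natr0 // mul1r exprSr.
  by rewrite -!mulmxE scalemxAl.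
(* This exceeds the degree of every entry of P; the [.+2] also forces [1 < n0]. *)
pose n0 := (\max_(a < d) \max_(b < d) size (P a b)).+2.
have sP a b : (size (P a b) <= n0)%N.
  apply: leq_trans (leqW (leqnSn _)).
  apply: leq_trans (leq_bigmax (F := fun a => \max_(b < d) size (P a b)) a).
  exact: (leq_bigmax (F := fun b => size (P a b))).
exists n0, Y; split=> // [|j].
  have : co n0 = 0 by apply/matrixP => a b; rewrite !mxE nth_default.
  rewrite coE => /eqP; rewrite scaler_eq0 invr_eq0.
  have := fact_gt0 n0; case: (n0`!) => // l _.
  by rewrite (negPf (natr0 l)) /= => /eqP.
rewrite hP /nexp; apply/matrixP => a b; rewrite !mxE summxE /horner_eval.
rewrite (horner_coef_wide _ (sP a b)); apply: eq_bigr => m _.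
by rewrite -scalerA -coE !mxE mulrC.
Qed.
End PolynomialMatrices.


(** * The infinitesimal representation *)

Section SymmetricSquare.
Variables (k : comUnitRingType) (n d : nat) (beta : 'I_n -> 'I_n -> 'M[k]_d).

(** On [x *m y^T] this is the bilinear map with values [beta] on basis vectors. Using all matrices
    instead of the symmetric ones makes linearity arguments run over [delta_mx]. *)
Definition phi (S : 'M[k]_n) : 'M[k]_d := \sum_(i < n) \sum_(j < n) S i j *: beta i j.

Lemma phi_is_linear : linear phi.
Proof.
move=> c S T; rewrite /phi scaler_sumr -big_split /=; apply: eq_bigr => i _.
rewrite scaler_sumr -big_split /=; apply: eq_bigr => j _.
by rewrite !mxE scalerDl scalerA.
Qed.
HB.instance Definition _ := GRing.isLinear.Build k 'M[k]_n 'M[k]_d *:%R phi phi_is_linear.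

Lemma phi_delta i j : phi (delta_mx i j) = beta i j.
Proof.
rewrite /phi (bigD1 i) //= (bigD1 j) //= !mxE !eqxx scale1r !big1 ?addr0 //.
  by move=> l /negPf nl; apply: big1 => m _; rewrite mxE nl scale0r.
by move=> l /negPf nl; rewrite mxE nl andbF scale0r.
Qed.
End SymmetricSquare.

Lemma matrix_linear_eq0 (R : comUnitRingType) m n (V : lmodType R)
    (F : 'M[R]_(m, n) -> V) :
  (forall c S T, F (c *: S + T) = c *: F S + F T) ->
  (forall i j, F (delta_mx i j) = 0) -> forall S, F S = 0.
Proof.
move=> F_lin Fd S.
have F0 : F 0 = 0 by have := F_lin (-1) 0 0; rewrite scaler0 add0r scaleN1r addNr.
rewrite [S]matrix_sum_delta; elim/big_rec: _ => // i T _ hT.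
rewrite -[X in X + _]scale1r F_lin hT addr0 scale1r.
by elim/big_rec: _ => // j U _ hU; rewrite F_lin hU addr0 Fd scaler0.
Qed.

Lemma phi_map (R S : comUnitRingType) (f : {rmorphism R -> S}) n d
    (beta : 'I_n -> 'I_n -> 'M[R]_d) (A : 'M[R]_n) :
  map_mx f (phi beta A) = phi (fun i j => map_mx f (beta i j)) (map_mx f A).
Proof.
rewrite /phi map_mx_sum; apply: eq_bigr => i _; rewrite map_mx_sum.
by apply: eq_bigr => j _; rewrite map_mxZ mxE.
Qed.

Section Infinitesimal.
Variables (k : fieldType) (char0 : [pchar k] =i pred0) (g : nat) (g3 : (2 < g)%N).
Variables (d : nat) (rho : Sp int g -> 'M[k]_d).
Hypothesis rho1 : rho 1%g = 1.
Hypothesis rhoM : forall A B, rho (A * B)%g = rho A * rho B.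
Local Notation vec := 'cV[int]_(g.*2).
Local Notation bv := (bv int g).
Local Notation av := (av int g).
Local Notation cv := (cv int g).

(* [Y x] is the logarithm of [rho] at the transvection of [x]. *)
Variables (n0 : nat) (Y : vec -> 'M[k]_d).
Hypothesis n01 : (1 < n0)%N.
Hypothesis Y_nil : forall x, Y x ^+ n0 = 0.
Hypothesis rho_tv : forall x (j : nat), rho (tv x j%:Z) = nexp n0 (Y x) j%:R.

Lemma rhoV A : rho A * rho A^-1%g = 1.
Proof. by rewrite -rhoM mulgV. Qed.
Lemma rhoVl A : rho A^-1%g * rho A = 1.
Proof. by rewrite -rhoM mulVg. Qed.

Lemma rho_tv_int x (c : int) : rho (tv x c) = nexp n0 (Y x) c%:~R.
Proof.
case: c => j; first exact: rho_tv.
rewrite NegzE tv_inv mulrNz -pmulrn.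
have h : rho (tv x j.+1%:Z) * nexp n0 (Y x) (- j.+1%:R) = 1.
  by rewrite rho_tv -nexpD ?subrr ?nexp0 // ?(ltnW n01) //; apply: natuF.
by rewrite -[LHS]mulr1 -h mulrA rhoVl mul1r.
Qed.

Lemma curve_tv x (a : int) : curve (fun j => rho (tv x (a * j%:Z))) (a%:~R *: Y x).
Proof.
have := @curve_nexp k char0 d n0 (Y x) (a%:~R *: 'X) n01.
rewrite hornerZ hornerX mulr0 derivZ derivX hornerZ hornerC mulr1 => /(_ erefl).
apply: curve_ext => j; rewrite rho_tv_int hornerZ hornerX intrM.
by rewrite -pmulrn.
Qed.

Lemma curve_tv2 x (a : int) : curve (fun j => rho (tv x (a * (j ^ 2)%:Z))) 0.
Proof.
have := @curve_nexp k char0 d n0 (Y x) (a%:~R *: 'X^2) n01.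
rewrite hornerZ hornerXn expr0n mulr0 derivZ derivXn hornerZ hornerMn hornerXn.
rewrite expr0n mul0rn mulr0 scale0r => /(_ erefl).
apply: curve_ext => j; rewrite rho_tv_int hornerZ hornerXn intrM.
by rewrite -[in RHS]pmulrn natrX.
Qed.

(** A logarithm is determined as the derivative at 0 of its curve, and the conjugate of the curve of
    x is the curve of A x. *)
Lemma Y_act A x : rho A * Y x = Y (Sp_val A *m x) * rho A.
Proof.
suff -> : Y (Sp_val A *m x) = rho A * Y x * rho A^-1%g by rewrite -mulrA rhoVl mulr1.
have := curve_tv (Sp_val A *m x) 1; rewrite scale1r => /curve_uniq; apply=> //.
have := @curve_nexp k char0 d n0 (rho A * Y x * rho A^-1%g) 'X n01.
rewrite hornerX derivX hornerC scale1r => /(_ erefl).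
apply: curve_ext => j; rewrite hornerX mul1r.
rewrite -[LHS]mulr1 -(rhoV A) mulrA -(@nexp_conj _ _ _ (rho A) (Y x)); last first.
  by rewrite -[RHS]mulrA rhoVl mulr1.
by rewrite -rho_tv -!rhoM -tv_conj -mulgA mulgV mulg1.
Qed.

Lemma Y_Z c x : Y (c *: x) = (c ^+ 2)%:~R *: Y x.
Proof.
have := curve_tv (c *: x) 1; rewrite scale1r => /curve_uniq; apply=> //.
have := curve_tv x (c ^+ 2); apply: curve_ext => j; congr rho.
by apply: val_inj; rewrite /= tvmZ mul1r.
Qed.

(** The polarization of [Y]. For orthogonal x and y it is the logarithm of [pairSp x y], and this is
    the case from which additivity is first obtained. *)
Definition B x y := Y (x + y) - Y x - Y y.

Lemma B_sym x y : B x y = B y x.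
Proof. by rewrite /B [x + y]addrC addrAC. Qed.

Lemma B_xx x : B x x = Y x *+ 2.
Proof.
rewrite /B -mulr2n -scaler_nat Y_Z.
have -> : ((2%:R : int) ^+ 2)%:~R = (2 + 2 : k) by rewrite rmorphXn /= expr2; ring.
by rewrite scalerDl !scaler_nat !mulr2n addrA addrK addrK.
Qed.

Lemma B_act A x y : rho A * B x y = B (Sp_val A *m x) (Sp_val A *m y) * rho A.
Proof. by rewrite /B !mulrBr !mulrBl !Y_act mulmxDr. Qed.

Definition pairSp (x y : vec) (c : int) : Sp int g := (tv (x + y) c * tv x (- c) * tv y (- c))%g.

Lemma SpMv (A A' : Sp int g) (v : vec) : Sp_val (A * A')%g *m v = Sp_val A *m (Sp_val A' *m v).
Proof. by rewrite mulmxA. Qed.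

Lemma pairSpE x y c v : sdot x y = 0 -> Sp_val (pairSp x y c) *m v =
  v + (c * sdot y v) *: x + (c * sdot x v) *: y.
Proof. exact: tvm_pair. Qed.

Lemma curve_pair x y : curve (fun j => rho (pairSp x y j%:Z)) (B x y).
Proof.
have h1 := curve_tv (x + y) 1; have h2 := curve_tv x (-1); have h3 := curve_tv y (-1).
have := curveM (curveM h1 h2) h3; rewrite scale1r !scaleN1r -/(B x y).
by apply: curve_ext => j; rewrite -!rhoM !mulN1r mul1r.
Qed.

(* Linear coefficients in [j] of the Heisenberg relation
   [E(x,j) E(x',j) = E(x + x',j) T_y(j^2 w(x,x'))], with [E(x,j) = pairSp x y j]. *)
Lemma B_add x x' y : sdot x y = 0 -> sdot x' y = 0 -> B (x + x') y = B x y + B x' y.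
Proof.
move=> xy xy'.
have h := curveM (curve_pair (x + x') y) (curve_tv2 y (sdot x x')).
rewrite addr0 in h; apply: (curve_uniq char0 h).
have := curveM (curve_pair x y) (curve_pair x' y); apply: curve_ext => j.
rewrite -!rhoM; congr rho; apply: val_inj; apply: mulmx_eq => v.
have yx : sdot y x = 0 by rewrite sdotC xy oppr0.
have yx' : sdot y x' = 0 by rewrite sdotC xy' oppr0.
have xxy : sdot (x + x') y = 0 by rewrite sdotDl xy xy' addr0.
rewrite SpMv.
rewrite pairSpE //.
rewrite pairSpE //.
rewrite SpMv.
rewrite pairSpE //.
rewrite [tv _ _ *m _]tvmE.
rewrite !(sdotDl, sdotDr, sdotZl, sdotZr) !sdotxx ?xy ?xy' ?yx ?yx'.
have -> : (j ^ 2)%:Z = j%:Z * j%:Z by lia.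
by apply/colP => i; rewrite !mxE; ring.
Qed.

Lemma B_addr x y y' : sdot y x = 0 -> sdot y' x = 0 -> B x (y + y') = B x y + B x y'.
Proof. by move=> h h'; rewrite !(B_sym x) B_add. Qed.

(** The predicate [P] is there because additivity is available only on sublattices such as the
    orthogonal complement of a vector. *)
Lemma additive_int (F : vec -> 'M[k]_d) (P : vec -> Prop) x (c : int) :
  (forall u v, P u -> P v -> P (u + v)) -> (forall u, P u -> P (- u)) -> P 0 ->
  (forall u v, P u -> P v -> F (u + v) = F u + F v) -> P x ->
  P (c *: x) /\ F (c *: x) = c%:~R *: F x.
Proof.
move=> PD PN P0 FD Px.
have F0 : F 0 = 0 by apply: (addrI (F 0)); rewrite -FD // !addr0.
have FN u : P u -> F (- u) = - F u.
  by move=> Pu; apply: (addrI (F u)); rewrite -FD ?subrr //; apply: PN.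
elim/int_rect: c => [|m [ih1 ih2]|m [ih1 ih2]].
- by rewrite !scale0r F0.
- have -> : m.+1%:Z = m%:Z + 1 by lia.
  by rewrite intrD !scalerDl !scale1r FD // ih2; split=> //; apply: PD.
- have -> : - m.+1%:Z = - m%:Z - 1 by lia.
  rewrite intrB scalerBl scale1r scalerBl scale1r FD ?FN ?ih2 //; last exact: PN.
  by split=> //; apply: PD => //; apply: PN.
Qed.

(** [pairSp x y j] fixes y and moves x' by j w(x, x') y. Conjugating [B x' y] by it and
    differentiating at j = 0 gives the bracket, with [B y y] equal to twice [Y y]. *)
Lemma B_bracket x x' y : sdot x y = 0 -> sdot x' y = 0 ->
  B x y * B x' y = B x' y * B x y + (sdot x x' *+ 2)%:~R *: Y y.
Proof.
move=> xy xy'; apply: (curve_conj char0 (curve_pair x y)) => j.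
rewrite B_act !pairSpE // sdotxx xy (sdotC y x') xy' oppr0 mulr0 !scale0r !addr0.
congr (_ * _).
have P1 u v : sdot u y = 0 -> sdot v y = 0 -> sdot (u + v) y = 0.
  by move=> hu hv; rewrite sdotDl hu hv addr0.
have P2 u : sdot u y = 0 -> sdot (- u) y = 0 by move=> hu; rewrite sdotNl hu oppr0.
have [_ h] := @additive_int (fun u => B u y) (fun u => sdot u y = 0) y
  (j%:Z * sdot x x') P1 P2 (sdot0l y)
  (fun u v hu hv => B_add hu hv) (sdotxx y).
rewrite B_add ?sdotZl ?sdotxx ?mulr0 // h B_xx; congr (_ + _).
by rewrite -scaler_nat !scalerA intrM -pmulrn; congr (_ *: _); rewrite rmorphMn /=; ring.
Qed.

Definition bracket (X Z : 'M[k]_d) := X * Z - Z * X.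

Lemma bracketDl X X' Z : bracket (X + X') Z = bracket X Z + bracket X' Z.
Proof. by rewrite /bracket mulrDl mulrDr opprD addrACA. Qed.

Lemma bracketDr X Z Z' : bracket X (Z + Z') = bracket X Z + bracket X Z'.
Proof. by rewrite /bracket mulrDl mulrDr opprD addrACA. Qed.

Lemma Y_bracket e f x : sdot e f = 1 -> sdot e x = 0 -> sdot f x = 0 ->
  Y x *+ 2 = bracket (B e x) (B f x).
Proof.
move=> ef ex fx; rewrite /bracket (B_bracket ex fx) ef addrAC subrr add0r.
by rewrite -scaler_nat; congr (_ *: _); rewrite rmorphMn.
Qed.

(** A hyperbolic pair (e, f) orthogonal to all vectors replaces their mutual orthogonality: twice
    [Y u] is the bracket of [B e u] and [B f u], both additive in u by [B_add], so [Y] is quadratic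
    on the complement of e and f. *)
Lemma B_add_far e f x x' z : sdot e f = 1 ->
  sdot e x = 0 -> sdot f x = 0 -> sdot e x' = 0 -> sdot f x' = 0 ->
  sdot e z = 0 -> sdot f z = 0 -> B (x + x') z = B x z + B x' z.
Proof.
move=> ef ex fx ex' fx' ez fz.
pose P u := sdot e u = 0 /\ sdot f u = 0.
have PD u v : P u -> P v -> P (u + v).
  by move=> [h1 h2] [h3 h4]; rewrite /P !sdotDr h1 h2 h3 h4 !addr0.
have eD u v : P u -> P v -> B e (u + v) = B e u + B e v.
  by move=> [h1 h2] [h3 h4]; rewrite B_addr // sdotC ?h1 ?h3 oppr0.
have fD u v : P u -> P v -> B f (u + v) = B f u + B f v.
  by move=> [h1 h2] [h3 h4]; rewrite B_addr // sdotC ?h2 ?h4 oppr0.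
have YP u : P u -> Y u *+ 2 = bracket (B e u) (B f u) by move=> [h1 h2]; exact: Y_bracket.
have hB u v : P u -> P v -> B u v *+ 2 = bracket (B e u) (B f v) + bracket (B e v) (B f u).
  move=> Pu Pv; rewrite {1}/B !mulrnBl !YP //; last exact: PD.
  rewrite eD // fD // (bracketDl (B e u)) !(bracketDr _ (B f u)).
  by rewrite -[bracket (B e u) (B f u) + _ + _]addrA [_ + (_ + _)]addrC addrK addrA addrK.
have Px : P x by []. have Px' : P x' by []. have Pz : P z by [].
apply: (@scalerI _ _ 2%:R); first exact: natr0.
rewrite [RHS]scalerDr !scaler_nat !hB //; last exact: PD.
by rewrite eD // fD // (bracketDl (B e x)) (bracketDr _ (B f x)) addrACA.
Qed.

(** The bilinear candidate for [B], read off from basis vectors. Since [B] is additive only on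
    suitable sublattices, the two are compared vector by vector, through [agree]. *)
Definition bilin (x y : vec) : 'M[k]_d :=
  \sum_(i < g.*2) \sum_(j < g.*2) (x i 0 * y j 0)%:~R *: B (bv i) (bv j).

Lemma bilin_sym x y : bilin x y = bilin y x.
Proof.
rewrite /bilin exchange_big; apply: eq_bigr => i _; apply: eq_bigr => j _.
by rewrite mulrC B_sym.
Qed.

Lemma bilinDl x x' y : bilin (x + x') y = bilin x y + bilin x' y.
Proof.
rewrite /bilin -big_split; apply: eq_bigr => i _; rewrite -big_split /=.
by apply: eq_bigr => j _; rewrite mxE mulrDl intrD scalerDl.
Qed.

Lemma bilinZl c x y : bilin (c *: x) y = c%:~R *: bilin x y.
Proof.
rewrite /bilin scaler_sumr; apply: eq_bigr => i _; rewrite scaler_sumr.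
by apply: eq_bigr => j _; rewrite mxE -mulrA intrM scalerA.
Qed.

Lemma bilin_bv i j : (i < g.*2)%N -> (j < g.*2)%N -> bilin (bv i) (bv j) = B (bv i) (bv j).
Proof.
move=> hi hj; rewrite /bilin (bigD1 (Ordinal hi)) //= (bigD1 (Ordinal hj)) //= !mxE !eqxx.
rewrite mulr1 scale1r !big1 ?addr0 // => l nl.
  apply: big1 => m _; rewrite !mxE; case: eqP => [e|]; last by rewrite mul0r scale0r.
  by case/eqP: nl; apply: val_inj.
rewrite !mxE; case: eqP => [e|]; last by rewrite mulr0 scale0r.
by case/eqP: nl; apply: val_inj.
Qed.

Definition agree (P : vec -> Prop) y x := P x /\ B x y = bilin x y.

Definition additive_on (P : vec -> Prop) y :=
  [/\ forall u v, P u -> P v -> P (u + v), forall u, P u -> P (- u), P 0 &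
      forall u v, P u -> P v -> B (u + v) y = B u y + B v y].

Lemma agreeD P y u v : additive_on P y -> agree P y u -> agree P y v -> agree P y (u + v).
Proof.
move=> [PD PN P0 hB] [Pu hu] [Pv hv]; split; first exact: PD.
by rewrite hB // bilinDl hu hv.
Qed.

Lemma agreeZ P y c u : additive_on P y -> agree P y u -> agree P y (c *: u).
Proof.
move=> [PD PN P0 hB] [Pu hu].
have [Pc h] := @additive_int (fun u => B u y) P u c PD PN P0 hB Pu.
by split=> //; rewrite h bilinZl hu.
Qed.

Lemma agree_combo P y i i0 j0 c : additive_on P y ->
  agree P y (bv i) -> agree P y (bv i0) -> agree P y (bv j0) ->
  agree P y (bv i + c *: sv int g i0 j0).
Proof.
move=> ha hi hi0 hj0; apply: agreeD => //; apply: agreeZ => //; rewrite /sv.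
by case: ifP => _ //; apply: agreeD.
Qed.

Lemma additive_perp y : additive_on (fun u => sdot u y = 0) y.
Proof.
split=> [u v hu hv|u hu||u v hu hv]; first by rewrite sdotDl hu hv addr0.
- by rewrite sdotNl hu oppr0.
- exact: sdot0l.
exact: B_add.
Qed.

Lemma additive_far e f y : sdot e f = 1 -> sdot e y = 0 -> sdot f y = 0 ->
  additive_on (fun u => sdot e u = 0 /\ sdot f u = 0) y.
Proof.
move=> ef ey fy; split=> [u v [h1 h2] [h3 h4]|u [h1 h2]||u v [h1 h2] [h3 h4]].
- by rewrite !sdotDr h1 h2 h3 h4 addr0.
- by rewrite !sdotNr h1 h2 oppr0.
- by rewrite !sdot0r.
exact: (B_add_far ef).
Qed.

Lemma sdot_bv_planes i j : i./2 != j./2 -> sdot (bv i) (bv j) = 0.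
Proof.
move=> ij; have [hi|hi] := ltnP i g.*2; last by rewrite bv_out ?sdot0l.
have [hj|hj] := ltnP j g.*2; last by rewrite (bv_out _ hj) sdot0r.
by rewrite sdot_bv //; case: ifP => oi; case: eqP => e; rewrite ?oppr0 //; lia.
Qed.

(* If both basis vectors lie in the planes of the letter, a third plane makes
   [B_add_far] available, and otherwise [B_add] suffices. *)
Lemma bilin_letter i0 j0 i j : (i0 < g.*2)%N -> (j0 < g.*2)%N ->
  (i < g.*2)%N -> (j < g.*2)%N -> let s := sv int g i0 j0 in
  B (bv i + sdot s (bv i) *: s) (bv j + sdot s (bv j) *: s) =
  bilin (bv i + sdot s (bv i) *: s) (bv j + sdot s (bv j) *: s).
Proof.
move=> hi0 hj0 hi hj s.
pose near l := (l./2 == i0./2) || (l./2 == j0./2).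
have far l : ~~ near l -> sdot s (bv l) = 0.
  rewrite negb_or => /andP [h1 h2]; rewrite /s /sv; case: ifP => _.
    by apply: sdot_bv_planes; rewrite eq_sym.
  by rewrite sdotDl !sdot_bv_planes ?addr0 // eq_sym.
wlog ij : i j hi hj / near i || ~~ near j => [H|].
  have [h|] := boolP (near i || ~~ near j); first exact: H.
  rewrite negb_or negbK => /andP [ni nj].
  by rewrite B_sym bilin_sym H // nj.
have [nj|nj] := boolP (near j); last first.
  rewrite (far j) // scale0r addr0.
  have [ni|ni] := boolP (near i); last by rewrite (far i) // scale0r addr0 bilin_bv.
  have ijp : i./2 != j./2 by apply: contraNneq nj => e; rewrite /near -e.
  have base l : (l < g.*2)%N -> l./2 != j./2 -> agree (fun u => sdot u (bv j) = 0) (bv j) (bv l).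
    by move=> hl nl; split; rewrite ?bilin_bv // sdot_bv_planes.
  move: nj; rewrite negb_or => /andP [n1 n2].
  by have [] := @agree_combo _ _ i i0 j0 (sdot s (bv i)) (additive_perp (bv j))
    (base _ hi ijp) (base _ hi0 ltac:(by rewrite eq_sym)) (base _ hj0 ltac:(by rewrite eq_sym)).
have ni : near i by move: ij; rewrite nj orbF.
(* The letter meets at most two planes, so by [g3] one of planes 0, 1, 2 is free. *)
have [q qg [nq1 nq2]] : exists2 q, (q < g)%N & q != i0./2 /\ q != j0./2.
  have [h0|h0] := boolP ((0%N != i0./2) && (0%N != j0./2)).
    by exists 0%N; [lia|move/andP: h0].
  have [h1|h1] := boolP ((1%N != i0./2) && (1%N != j0./2)).
    by exists 1%N; [lia|move/andP: h1].
  by exists 2%N; lia.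
have ef : sdot (av q) (cv q) = 1 by rewrite sdot_ac // eqxx.
pose P u := sdot (av q) u = 0 /\ sdot (cv q) u = 0.
have nearP l : near l -> P (bv l).
  move=> nl; have ql : q != l./2 by case/orP: nl => /eqP ->.
  by split; apply: sdot_bv_planes; lia.
have near_i0 : near i0 by rewrite /near eqxx.
have near_j0 : near j0 by rewrite /near eqxx orbT.
have addP l : P l -> additive_on P l by move=> [h1 h2]; apply: (additive_far ef).
have base l m : (l < g.*2)%N -> (m < g.*2)%N -> near l -> near m -> agree P (bv m) (bv l).
  by move=> hl hm nl nm; split; [exact: nearP|rewrite bilin_bv].
have stepx m : (m < g.*2)%N -> near m -> agree P (bv m) (bv i + sdot s (bv i) *: s).
  by move=> hm nm; apply: agree_combo; auto.
set x := bv i + _ in stepx *.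
have Px : P x by have [] := stepx i0 hi0 near_i0.
have basex m : (m < g.*2)%N -> near m -> agree P x (bv m).
  by move=> hm nm; have [_ h] := stepx m hm nm; split; [exact: nearP|rewrite B_sym bilin_sym].
rewrite B_sym bilin_sym.
by have [] := @agree_combo P x j i0 j0 (sdot s (bv j)) (addP _ Px)
  (basex _ hj nj) (basex _ hi0 near_i0) (basex _ hj0 near_j0).
Qed.

(** The factor 1/2 compensates [B x x] being twice [Y x], so that x x^T is sent to [Y x]. *)
Definition beta (i j : 'I_(g.*2)) : 'M[k]_d := (2%:R)^-1 *: B (bv i) (bv j).
Local Notation icast := (map_mx (intr : int -> k)).

Lemma phi_bilin x y : phi beta (icast x *m (icast y)^T) = (2%:R)^-1 *: bilin x y.
Proof.
rewrite /phi /bilin scaler_sumr; apply: eq_bigr => i _; rewrite scaler_sumr.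
apply: eq_bigr => j _; rewrite /beta !scalerA mulrC; congr (_ *: _).
by rewrite mxE big_ord1 !mxE intrM.
Qed.

Definition equivariant_at (A : Sp int g) := forall S : 'M[k]_(g.*2),
  phi beta (icast (Sp_val A) *m S *m (icast (Sp_val A))^T) * rho A = rho A * phi beta S.

(** [rho A] carries [B x y] to [B (A x) (A y)], so equivariance only requires [B] to agree with its
    bilinear model at the images of basis vectors. *)
Lemma equivariant_delta A :
  (forall i j : 'I_(g.*2), B (Sp_val A *m bv i) (Sp_val A *m bv j) =
     bilin (Sp_val A *m bv i) (Sp_val A *m bv j)) -> equivariant_at A.
Proof.
move=> h; rewrite /equivariant_at; set A1 := icast (Sp_val A).
have hd i j : phi beta (A1 *m delta_mx i j *m A1^T) * rho A = rho A * phi beta (delta_mx i j).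
  rewrite phi_delta.
  have -> : A1 *m delta_mx i j *m A1^T =
      icast (Sp_val A *m bv i) *m (icast (Sp_val A *m bv j))^T.
    have -> : delta_mx i j = icast (bv i) *m (icast (bv j))^T :> 'M[k]_(g.*2).
      by rewrite !bv_delta !map_delta_mx trmx_delta mul_delta_mx.
    by rewrite !map_mxM trmx_mul !mulmxA.
  by rewrite phi_bilin -h /beta scalemx_mull scalemx_mulr -B_act.
pose F S := phi beta (A1 *m S *m A1^T) * rho A - rho A * phi beta S.
have F_lin c S T : F (c *: S + T) = c *: F S + F T.
  rewrite /F mulmxDr mulmxDl -scalemxAr -scalemxAl !linearP mulrDl mulrDr.
  rewrite scalemx_mull scalemx_mulr.
  by rewrite opprD addrACA scalerBr.
move=> S; apply/eqP; rewrite -subr_eq0; apply/eqP/(@matrix_linear_eq0 _ _ _ _ F) => //.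
by move=> i j; rewrite /F hd subrr.
Qed.

Lemma equivariantM A A' : equivariant_at A -> equivariant_at A' -> equivariant_at (A * A')%g.
Proof.
move=> hA hA' S; rewrite rhoM mulrA /= map_mxM trmx_mul.
have := hA (icast (Sp_val A') *m S *m (icast (Sp_val A'))^T).
by rewrite !mulmxA => ->; rewrite -!mulrA hA' .
Qed.

Lemma equivariantV A : equivariant_at A -> equivariant_at A^-1%g.
Proof.
move=> hA S; set A1 := icast _.
have e1 : icast (Sp_val A) *m A1 = 1%:M.
  by rewrite -map_mxM mulmxV ?map_mx1 // symplectic_unit // Sp_valP.
have := hA (A1 *m S *m A1^T).
rewrite !mulmxA e1 mul1mx -mulmxA -trmx_mul e1 trmx1 mulmx1 => h.
rewrite -[LHS]mul1r -(rhoVl A) -mulrA [X in _ * X]mulrA -h -mulrA rhoV mulr1.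
by [].
Qed.

Lemma equivariant_all A : equivariant_at A.
Proof.
have [l hl e] := symplectic_word int_euclidean (Sp_valP A).
have {e} -> : A = wSp g l by apply: val_inj.
elim: l hl => [_|[[i j] c] l ih] /=.
  have -> : wSp g [::] = 1%g :> Sp int g by apply: val_inj.
  by move=> S; rewrite /= map_mx1 trmx1 mul1mx mulmx1 rho1 mul1r mulr1.
move=> /andP [/andP [/= hi hj] hl].
have -> : wSp g ((i, j, c) :: l) = (tv (sv int g i j) c * wSp g l)%g by apply: val_inj.
apply: equivariantM (ih hl).
have h1 : equivariant_at (tv (sv int g i j) 1).
  by apply: equivariant_delta => a b; rewrite !tvmE !mul1r bilin_letter.
have h0 : equivariant_at (tv (sv int g i j) 0).
  have -> : tv (sv int g i j) 0 = 1%g by apply: val_inj; apply: tvm0.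
  by move=> S; rewrite /= map_mx1 trmx1 mul1mx mulmx1 rho1 mul1r mulr1.
elim/int_rect: c => // m IH.
  have -> : m.+1%:Z = m%:Z + 1 by lia.
  by rewrite tv_add; apply: equivariantM.
have -> : - m.+1%:Z = - m%:Z - 1 by lia.
by rewrite tv_add (tv_inv _ 1); apply: equivariantM => //; apply: equivariantV.
Qed.

(** Both sides are equivariant and scale by c^2, and every x can be moved to a multiple of the basis
    vector [av 0]. This avoids proving that [B] is bilinear on all pairs of vectors. *)
Lemma Y_phi x : Y x = phi beta (icast x *m (icast x)^T).
Proof.
have g0 : (0 < g)%N by lia.
have [|c [l _ e]] := reduce_vec int_euclidean g0 (_ : low 0 x); first by [].
pose A := wSp g l : Sp int g.
have h : rho A * Y x = rho A * phi beta (icast x *m (icast x)^T).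
  rewrite Y_act -equivariant_all.
  have -> : icast (Sp_val A) *m (icast x *m (icast x)^T) *m (icast (Sp_val A))^T =
      icast (Sp_val A *m x) *m (icast (Sp_val A *m x))^T.
    by rewrite map_mxM trmx_mul !mulmxA.
  rewrite phi_bilin e Y_Z bilinZl bilin_sym bilinZl bilin_bv ?lt_av //.
  rewrite B_xx scalerA -expr2 -rmorphXn -scaler_nat !scalerA; congr (_ * _); congr (_ *: _).
  by rewrite [X in _ = X * _]mulrC -mulrA mulVf ?mulr1 //; apply: natr0.
by rewrite -[LHS]mul1r -(rhoVl A) -mulrA h mulrA rhoVl mul1r.
Qed.
End Infinitesimal.


(** * Words over extensions of the ground field *)

Section MapTransvections.
Variables (R S : comUnitRingType) (f : {rmorphism R -> S}) (g : nat).

Lemma map_bv i : map_mx f (bv R g i) = bv S g i.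
Proof. by apply/colP => j; rewrite !mxE rmorph_nat. Qed.

Lemma map_sv i j : map_mx f (sv R g i j) = sv S g i j.
Proof. by rewrite /sv; case: ifP; rewrite ?map_mxD !map_bv. Qed.

Lemma map_form : map_mx f (symplectic_form R g) = symplectic_form S g.
Proof.
apply/matrixP => i j; rewrite !mxE.
by case: ifP => _; rewrite ?rmorphN rmorph_nat.
Qed.

Lemma map_tvm x c : map_mx f (tvm x c) = tvm (map_mx f x) (f c) :> 'M_(g.*2).
Proof. by rewrite /tvm map_mxD map_mx1 map_mxZ !map_mxM map_form map_trmx. Qed.

Definition map_word (l : seq (letter R)) : seq (letter S) := [seq (a.1, f a.2) | a <- l].

Lemma wok_map m l : wok g m (map_word l) = wok g m l.
Proof. by rewrite /wok all_map. Qed.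

Lemma map_wmx l : map_mx f (wmx g l) = wmx g (map_word l).
Proof.
elim: l => [|a l ih] /=; first by rewrite map_mx1.
by rewrite map_mxM map_tvm map_sv ih.
Qed.
End MapTransvections.

(* Under [S |-> S J], symmetric matrices are the Lie algebra sp_2g, and [x x^T]
   is the logarithm of the transvection of [x]; [phi inf_beta] is the differential
   of the representation in these coordinates. *)
Record infinitesimal_data (k : fieldType) (g d : nat) := InfinitesimalData {
  inf_n0 : nat;
  inf_beta : 'I_(g.*2) -> 'I_(g.*2) -> 'M[k]_d;
  inf_n01 : (1 < inf_n0)%N;
  inf_nil : forall i j, phi inf_beta (sv k g i j *m (sv k g i j)^T) ^+ inf_n0 = 0;
  inf_equiv : forall i j (c : nat) S, (i < g.*2)%N -> (j < g.*2)%N ->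
    phi inf_beta (tvm (sv k g i j) c%:R *m S *m (tvm (sv k g i j) c%:R)^T) *
      nexp inf_n0 (phi inf_beta (sv k g i j *m (sv k g i j)^T)) c%:R =
    nexp inf_n0 (phi inf_beta (sv k g i j *m (sv k g i j)^T)) c%:R * phi inf_beta S
}.

Section ExponentialWords.
Variables (k : fieldType) (char0 : [pchar k] =i pred0) (g d : nat).
Variable I : infinitesimal_data k g d.
Local Notation n0 := (inf_n0 I).

Section Ring.
Variables (R : comUnitRingType) (iota : {rmorphism k -> R}).

Definition betaR i j := map_mx iota (inf_beta I i j).
Definition quadR (x : 'cV[R]_(g.*2)) := phi betaR (x *m x^T).
(** The exponential counterpart of [wmx], for words with parameters in any k-algebra R. *)
Fixpoint fmx (l : seq (letter R)) : 'M[R]_d :=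
  if l is a :: l' then nexp n0 (quadR (sv R g a.1.1 a.1.2)) a.2 * fmx l' else 1.

Lemma natuR m : (m.+1)%:R \is a @GRing.unit R.
Proof. by rewrite -(rmorph_nat iota) rmorph_unit // natuF. Qed.

Lemma quadR_sv i j :
  quadR (sv R g i j) = map_mx iota (phi (inf_beta I) (sv k g i j *m (sv k g i j)^T)).
Proof. by rewrite phi_map map_mxM -map_trmx map_sv. Qed.

Lemma quadR_nil i j : quadR (sv R g i j) ^+ n0 = 0.
Proof. by rewrite quadR_sv -mulmxX_map inf_nil map_mx0. Qed.

Lemma n0_gt0 : (0 < n0)%N. Proof. exact: ltnW (inf_n01 I). Qed.

Lemma fmx_cat l1 l2 : fmx (l1 ++ l2) = fmx l1 * fmx l2.
Proof. by elim: l1 => [|a l ih] /=; rewrite ?mul1r // ih mulrA. Qed.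

Lemma nexpNr i j c : nexp n0 (quadR (sv R g i j)) c * nexp n0 (quadR (sv R g i j)) (- c) = 1.
Proof. by rewrite -nexpD ?subrr ?nexp0 ?n0_gt0 //; [exact: natuR|exact: quadR_nil]. Qed.

Lemma fmx_winvr l : fmx l * fmx (winv l) = 1.
Proof.
elim: l => [|a l ih]; first by rewrite mulr1.
rewrite /winv /= rev_cons -cats1 fmx_cat /= mulr1.
rewrite mulrA -[_ * fmx l * _]mulrA ih mulr1.
exact: nexpNr.
Qed.

Lemma fmx_winvl l : fmx (winv l) * fmx l = 1.
Proof. by rewrite -{2}[l]winvK fmx_winvr. Qed.
End Ring.

Lemma fmx_map (R S : comUnitRingType) (f : {rmorphism R -> S}) (iR : {rmorphism k -> R})
    (iS : {rmorphism k -> S}) (l : seq (letter R)) : (forall c, f (iR c) = iS c) ->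
  map_mx f (fmx iR l) = fmx iS (map_word f l).
Proof.
move=> hf; elim: l => [|a l ih] /=; first by rewrite map_mx1.
rewrite -mulmxE map_mxM ih mulmxE nexp_map; last exact: natuR iR.
congr (nexp _ _ _ * _); rewrite !quadR_sv -map_mx_comp.
by apply: eq_map_mx => c /=; rewrite hf.
Qed.

Section RingEquivariance.
Variables (R : comUnitRingType) (iota : {rmorphism k -> R}).
Local Notation phiR := (phi (betaR iota)).

(** For fixed S the identity is polynomial in c. It holds at the natural numbers, hence in k[X] by
    characteristic 0, and X may then be specialized to any c in R. *)
Lemma letter_equivariant i j c S : (i < g.*2)%N -> (j < g.*2)%N ->
  phiR (tvm (sv R g i j) c *m S *m (tvm (sv R g i j) c)^T) *
    nexp n0 (quadR iota (sv R g i j)) c =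
  nexp n0 (quadR iota (sv R g i j)) c * phiR S.
Proof.
move=> hi hj; apply/eqP; rewrite -subr_eq0; apply/eqP; move: S.
apply: matrix_linear_eq0 => [a S T|r t].
  rewrite mulmxDr mulmxDl -scalemxAr -scalemxAl !linearP mulrDl mulrDr.
  by rewrite scalemx_mull scalemx_mulr opprD addrACA scalerBr.
pose P := {poly k}; pose iP : {rmorphism k -> P} := polyC.
have hP : phi (betaR iP) (tvm (sv P g i j) 'X *m delta_mx r t *m (tvm (sv P g i j) 'X)^T) *
    nexp n0 (quadR iP (sv P g i j)) 'X =
    nexp n0 (quadR iP (sv P g i j)) 'X * phi (betaR iP) (delta_mx r t).
  apply: ev_nat_eq => // l; rewrite !evM /ev !phi_map nexp_map; last exact: natuR iP.
  rewrite !map_mxM -map_trmx map_tvm map_sv map_delta_mx quadR_sv.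
  have eb : (fun r t => map_mx (horner_eval l%:R) (betaR iP r t)) = inf_beta I.
    by apply: funext => a; apply: funext => b; rewrite -/(ev _ _) evC.
  rewrite eb -/(ev _ (map_mx iP _)) evC.
  have -> : (horner_eval (l%:R : k) : {rmorphism {poly k} -> k}) 'X = l%:R by exact: hornerX.
  exact: inf_equiv.
have cf : commr_rmorph iota c by move=> a; apply: mulrC.
pose h : {rmorphism P -> R} := horner_morph cf.
have hX : h 'X = c by apply: horner_morphX.
have hC a : h (iP a) = iota a by apply: horner_morphC.
have eb : (fun r t => map_mx h (betaR iP r t)) = betaR iota.
  apply: funext => a; apply: funext => b; rewrite /betaR -map_mx_comp.
  by apply: eq_map_mx => x /=; rewrite hC.
have := congr1 (map_mx h) hP; rewrite -!mulmxE !map_mxM !phi_map eb.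
rewrite nexp_map; last exact: natuR iP.
rewrite /quadR phi_map eb !map_mxM -!map_trmx map_tvm map_sv hX map_delta_mx => ->.
by rewrite subrr.
Qed.

Lemma fmx_equivariant l S : wok g 0 l ->
  phiR (wmx g l *m S *m (wmx g l)^T) * fmx iota l = fmx iota l * phiR S.
Proof.
elim: l => [|[[i j] c] l ih] /=; first by rewrite trmx1 mul1mx mulmx1 mulr1 mul1r.
move=> /andP [/andP [/= hi hj] hl].
have := letter_equivariant c (wmx g l *m S *m (wmx g l)^T) hi hj.
rewrite trmx_mul !mulmxA mulrA => ->.
by rewrite -!mulrA ih.
Qed.

Lemma quadR_equivariant l x : wok g 0 l ->
  quadR iota (wmx g l *m x) * fmx iota l = fmx iota l * quadR iota x.
Proof. by move=> hl; rewrite -fmx_equivariant // /quadR trmx_mul !mulmxA. Qed.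
End RingEquivariance.
End ExponentialWords.


(** * Logarithmic derivatives over a differential field *)

Section DifferentialField.
Variables (k : fieldType) (char0 : [pchar k] =i pred0) (g d : nat) (g0 : (0 < g)%N).
Variable I : infinitesimal_data k g d.
Local Notation n0 := (inf_n0 I).
Variables (K : fieldType) (iota : {rmorphism k -> K}).
Local Notation quad := (quadR I iota).
Local Notation fmx := (fmx I iota).
Local Notation phiK := (phi (betaR I iota)).
Local Notation J := (symplectic_form K g).

(** A relation and not a function: different words for A might give different G, and
    [realizes_const] measures the ambiguity. *)
Definition realizes (A : 'M[K]_(g.*2)) (G : 'M[K]_d) :=
  exists l, [/\ wok g 0 l, wmx g l = A & fmx l = G].

Lemma realizes1 : realizes 1%:M 1.
Proof. by exists [::]. Qed.

Lemma realizesM A A' G G' : realizes A G -> realizes A' G' -> realizes (A *m A') (G * G').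
Proof.
move=> [l [hl <- <-]] [l' [hl' <- <-]]; exists (l ++ l').
by rewrite wok_cat hl hl' wmx_cat fmx_cat.
Qed.

(** Elimination uses transvections along arbitrary vectors, while letters only know [sv]. Over a
    field z is conjugate to a multiple e of [bv 0], and [tvmZ] turns the multiple into the
    coefficient c e^2. *)
Lemma realizes_tvm z c : realizes (tvm z c) (nexp n0 (quad z) c).
Proof.
have [|e [l hl hz]] := reduce_vec (field_euclidean (F := K)) g0 (_ : low 0 z); first by [].
exists (winv l ++ [:: (0%N, 0%N, c * e ^+ 2)] ++ l).
have h0 : (0 < g.*2)%N by lia.
split; first by rewrite !wok_cat wok_winv hl /wok /= h0.
  rewrite !wmx_cat /= mulmx1 /lmx /sv eqxx /= -[bv K g 0]/(av K g 0) mulrC -tvmZ -hz.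
  by rewrite -tvm_conj ?wmx_symplectic // mulmxA wmx_winvl mul1mx.
rewrite !fmx_cat /= mulr1 /sv eqxx.
have hq : fmx l * quad z = (e ^+ 2 *: quad (bv K g 0)) * fmx l.
  rewrite -quadR_equivariant // hz /quadR linearZ /= -scalemxAl -scalemxAr scalerA.
  by rewrite linearZ.
by rewrite [c * _]mulrC -nexpZ -(nexp_conj _ _ hq) mulrA fmx_winvl ?mul1r.
Qed.

Variable delta : K -> K.
Hypothesis deltaD : forall x y, delta (x + y) = delta x + delta y.
Hypothesis deltaM : forall x y, delta (x * y) = delta x * y + x * delta y.
Hypothesis delta_iota : forall c, delta (iota c) = 0.

Lemma delta0 : delta 0 = 0.
Proof. by rewrite -{1}(rmorph0 iota) delta_iota. Qed.

Lemma delta_sum (T : Type) (r : seq T) (F : T -> K) :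
  delta (\sum_(i <- r) F i) = \sum_(i <- r) delta (F i).
Proof. by elim/big_rec2: _ => [|i x y _ <-]; rewrite ?delta0 // deltaD. Qed.

Local Notation D := (map_mx delta).

Lemma DmxD m n (A B : 'M[K]_(m, n)) : D (A + B) = D A + D B.
Proof. by apply/matrixP => i j; rewrite !mxE deltaD. Qed.

Lemma DmxM m n p (A : 'M[K]_(m, n)) (B : 'M[K]_(n, p)) :
  D (A *m B) = D A *m B + A *m D B.
Proof.
apply/matrixP => i j; rewrite !mxE delta_sum -big_split /=.
by apply: eq_bigr => l _; rewrite deltaM !mxE.
Qed.

Lemma DmxZ m n c (A : 'M[K]_(m, n)) : D (c *: A) = delta c *: A + c *: D A.
Proof. by apply/matrixP => i j; rewrite !mxE deltaM. Qed.

Lemma Dmx_iota m n (A : 'M[k]_(m, n)) : D (map_mx iota A) = 0.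
Proof. by apply/matrixP => i j; rewrite !mxE delta_iota. Qed.

Lemma Dmx1 m : D (1%:M : 'M[K]_m) = 0.
Proof. by rewrite -(map_mx1 iota) Dmx_iota. Qed.

Lemma delta_fact c m : delta (c ^+ m.+1 / (m.+1`!)%:R) = delta c * (c ^+ m / (m`!)%:R).
Proof.
have hf l : (l`!)%:R != 0 :> K.
  by rewrite -unitfE; apply: fact_unit => i; apply: natuR iota _.
have -> : ((m.+1)`!)%:R^-1 = iota (((m.+1)`!)%:R^-1) by rewrite fmorphV rmorph_nat.
rewrite deltaM delta_iota mulr0 addr0 fmorphV rmorph_nat.
have -> : delta (c ^+ m.+1) = m.+1%:R * (delta c * c ^+ m).
  elim: m => [|m ih]; first by rewrite expr1 expr0 mul1r mulr1.
  by rewrite exprS deltaM ih exprS -[m.+2]addn1 natrD; ring.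
have hm : m.+1%:R != 0 :> K by rewrite -unitfE; apply: natuR iota _.
by rewrite factS natrM invfM mulrACA divff // mul1r mulrA.
Qed.

(** The matrix in the exponent has entries from k, so only c is differentiated; the series loses its
    last term, which would carry the power [n0] and is zero. *)
Lemma D_nexp i j c : D (nexp n0 (quad (sv K g i j)) c) =
  delta c *: (quad (sv K g i j) * nexp n0 (quad (sv K g i j)) c).
Proof.
set Y := quad _; have DY m : D (Y ^+ m) = 0.
  by rewrite /Y quadR_sv -mulmxX_map Dmx_iota.
have Y0 : Y ^+ n0 = 0 by apply: quadR_nil.
have [n e] : exists n, n0 = n.+1 by exists n0.-1; rewrite prednK // n0_gt0.
have -> : Y * nexp n0 Y c = \sum_(l < n) (c ^+ l / (l`!)%:R) *: Y ^+ l.+1.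
  rewrite /nexp e big_ord_recr /= mulrDr scalemx_mulr -exprS -e Y0 scaler0 addr0.
  by rewrite mulr_sumr; apply: eq_bigr => l _; rewrite scalemx_mulr -exprS.
rewrite /nexp e big_ord_recl DmxD.
have -> : D ((c ^+ (ord0 : 'I_n.+1) / (0`!)%:R) *: Y ^+ 0) = 0.
  rewrite DmxZ DY scaler0 addr0 /= expr0 fact0 divr1.
  by rewrite -(rmorph1 iota) delta_iota scale0r.
rewrite add0r scaler_sumr.
have -> : D (\sum_(l < n) (c ^+ (bump 0 l) / (bump 0 l)`!%:R) *: Y ^+ (bump 0 l)) =
   \sum_(l < n) D ((c ^+ (bump 0 l) / (bump 0 l)`!%:R) *: Y ^+ (bump 0 l)).
  elim/big_rec2: _ => [|l A B _ <-]; last by rewrite DmxD.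
  by apply/matrixP => a b; rewrite !mxE delta0.
apply: eq_bigr => l _; rewrite DmxZ DY scaler0 addr0 /bump leq0n add1n.
by rewrite delta_fact scalerA.
Qed.

(* [logd l *m J] is the logarithmic derivative of the word [wmx g l]. *)
Fixpoint logd (l : seq (letter K)) : 'M[K]_(g.*2) :=
  if l is a :: l' then let s := sv K g a.1.1 a.1.2 in
    delta a.2 *: (s *m s^T) + tvm s a.2 *m logd l' *m (tvm s a.2)^T
  else 0.

Lemma D_tvm i j c : let s := sv K g i j in
  D (tvm s c) = delta c *: (s *m s^T) *m J *m tvm s c.
Proof.
move=> s; rewrite /tvm DmxD DmxZ Dmx1.
have -> : D (s *m (s^T *m J)) = 0.
  by rewrite /s -(map_sv iota) map_trmx -(map_form iota) -!map_mxM Dmx_iota.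
rewrite scaler0 addr0 add0r mulmxDr mulmx1 -!scalemxAl -!scalemxAr.
rewrite [X in _ + _ *: (_ *: X)](_ : _ = 0) ?scaler0 ?addr0 ?mulmxA //.
by rewrite -!mulmxA [s^T *m (J *m _)]mulmxA [s^T *m J *m (s *m _)]mulmxA sdotE sdotxx
  raddf0 !(mul0mx, mulmx0).
Qed.

Lemma symplectic_conj (T : 'M[K]_(g.*2)) X : symplectic T ->
  T *m X *m J = T *m X *m T^T *m J *m T.
Proof. by move=> /eqP h; rewrite -!mulmxA; congr (_ *m (_ *m _)); rewrite !mulmxA h. Qed.

Lemma D_wmx l : D (wmx g l) = logd l *m J *m wmx g l.
Proof.
elim: l => [|[[i j] c] l ih] /=.
  by rewrite mul0mx mul0mx Dmx1.
rewrite DmxM ih /lmx /= D_tvm; set s := sv K g i j; set T := tvm s c.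
have hT : symplectic T by apply: tvm_symplectic.
set X := delta c *: _; rewrite [(X + _) *m J]mulmxDl [(X *m J + _) *m _]mulmxDl.
congr (_ + _); first by rewrite !mulmxA.
by rewrite !mulmxA symplectic_conj.
Qed.

(** Matches [D_wmx] letter by letter: equivariance turns conjugation by an exponential into the
    action of the transvection on the argument of [phiK]. *)
Lemma D_fmx l : wok g 0 l -> D (fmx l) = phiK (logd l) * fmx l.
Proof.
elim: l => [|[[i j] c] l ih] /=.
  by rewrite linear0 mul0r -[1]/(1%:M) Dmx1.
move=> /andP [/andP [/= hi hj] hl].
rewrite -{1}mulmxE DmxM !mulmxE ih // D_nexp linearD mulrDl.
rewrite linearZ scalemx_mull scalemx_mull mulrA; congr (_ + _).
by rewrite [LHS]mulrA [RHS]mulrA letter_equivariant.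
Qed.

(* [fmx l] and [wmx l] have corresponding logarithmic derivatives, so [fmx l] is
   constant as soon as [wmx l] is 1. *)
Lemma realizes_const G : realizes 1%:M G -> D G = 0.
Proof.
move=> [l [hl e <-]]; have := D_wmx l.
rewrite e mulmx1 Dmx1 => h.
have : logd l *m J *m J = 0 by rewrite -h mul0mx.
rewrite -mulmxA mulmx_symplectic_form mulmxN mulmx1 => /eqP; rewrite oppr_eq0 => /eqP e0.
by rewrite D_fmx // e0 linear0 mul0r.
Qed.
End DifferentialField.


Lemma quotient_ruleD (L : fieldType) (p p' q q' r r' s s' : L) : q != 0 -> s != 0 ->
  ((p' * s + p * s' + (r' * q + r * q')) * (q * s) - (p * s + r * q) * (q' * s + q * s')) /
    (q * s) ^+ 2 = (p' * q - p * q') / q ^+ 2 + (r' * s - r * s') / s ^+ 2.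
Proof. by move=> q0 s0; field; rewrite q0 s0. Qed.

Lemma quotient_ruleM (L : fieldType) (p p' q q' r r' s s' : L) : q != 0 -> s != 0 ->
  ((p' * r + p * r') * (q * s) - p * r * (q' * s + q * s')) / (q * s) ^+ 2 =
  (p' * q - p * q') / q ^+ 2 * (r / s) + p / q * ((r' * s - r * s') / s ^+ 2).
Proof. by move=> q0 s0; field; rewrite q0 s0. Qed.

(** * The derivation on rational functions *)

Lemma cross_mul (L : fieldType) (a b c d : L) : b != 0 -> d != 0 ->
  a / b = c / d -> a * d = c * b.
Proof. by move=> b0 d0 /eqP; rewrite eqr_div // => /eqP. Qed.

Lemma cross_div (L : fieldType) (a b c d : L) : b != 0 -> d != 0 ->
  a * d = c * b -> a / b = c / d.
Proof. by move=> b0 d0 h; apply/eqP; rewrite eqr_div // h. Qed.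

Section RationalFunctions.
Variable k : fieldType.
Local Notation K := {fraction {poly k}}.
Local Notation frac := (@FracField.tofrac {poly k}).

Lemma frac_inj : injective frac.
Proof. by move=> p q /eqP; rewrite tofrac_eq => /eqP. Qed.

Lemma map_frac_inj m n (A B : 'M[{poly k}]_(m, n)) :
  map_mx frac A = map_mx frac B -> A = B.
Proof.
move=> h; apply/matrixP => i j; apply: frac_inj.
by have /matrixP/(_ i j) := h; rewrite !mxE.
Qed.

Lemma frac_ex (x : K) : exists p : {poly k} * {poly k}, p.2 != 0 /\ x = frac p.1 / frac p.2.
Proof.
elim/quotW: x => r; exists (\n_r, \d_r); split; first exact: denom_ratioP.
have d0 : frac \d_r != 0 by rewrite tofrac_eq0 denom_ratioP.
apply: (mulIf d0); rewrite divfK //=.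
suff -> : \pi_(K)%qT r * frac \d_r = FracField.mul (\pi_(K)%qT r) (frac \d_r).
  rewrite !piE; apply/eqmodP; rewrite /= FracField.equivfE /FracField.mulf.
  by rewrite !numden_Ratio ?mulr1 ?oner_eq0 ?denom_ratioP //= mulrC.
by [].
Qed.

Definition fnum (x : K) := (sval (cid (frac_ex x))).1.
Definition fden (x : K) := (sval (cid (frac_ex x))).2.

Lemma fden_neq0 x : fden x != 0.
Proof. by rewrite /fden; case: cid => p []. Qed.

Lemma fracE x : x = frac (fnum x) / frac (fden x).
Proof. by rewrite /fnum /fden; case: cid => p []. Qed.

(** The quotient rule on a chosen representation; [fderivE] shows independence of the choice. *)
Definition fderiv (x : K) : K :=
  frac ((fnum x)^`() * fden x - fnum x * (fden x)^`()) / frac (fden x) ^+ 2.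

Lemma fderivE (p q : {poly k}) : q != 0 ->
  fderiv (frac p / frac q) = frac (p^`() * q - p * q^`()) / frac q ^+ 2.
Proof.
move=> q0; rewrite /fderiv; set x := frac p / frac q.
have d0 := fden_neq0 x; have := fracE x; move: (fnum x) (fden x) d0 => n d d0 e.
have fq : frac q != 0 by rewrite tofrac_eq0.
have fd : frac d != 0 by rewrite tofrac_eq0.
have nq : n * q = p * d.
  have h := cross_mul fq fd e.
  by apply: frac_inj; rewrite (rmorphM frac) (rmorphM frac) -h.
have nq' : n^`() * q = p^`() * d + p * d^`() - n * q^`().
  by have := congr1 (@deriv k) nq; rewrite !derivM => <-; rewrite addrK.
have fd2 := expf_neq0 2 fd; have fq2 := expf_neq0 2 fq.
apply: (cross_div fd2 fq2).
rewrite -(rmorphXn frac) -(rmorphXn frac) -(rmorphM frac) -(rmorphM frac); congr (frac _).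
transitivity (d * q * (n^`() * q) - d^`() * q * (n * q)); first by ring.
rewrite nq' nq.
transitivity (p^`() * d ^+ 2 * q - d * q^`() * (n * q)); first by ring.
by rewrite nq; ring.
Qed.

Lemma fderiv_frac p : fderiv (frac p) = frac p^`().
Proof.
have := @fderivE p 1 (oner_neq0 _).
by rewrite rmorph1 divr1 derivC mulr0 subr0 mulr1 expr1n divr1.
Qed.

Lemma fderivD x y : fderiv (x + y) = fderiv x + fderiv y.
Proof.
rewrite [x in LHS]fracE [y in LHS]fracE [x in RHS]fracE [y in RHS]fracE.
have := fden_neq0 x; have := fden_neq0 y.
move: (fnum x) (fden x) (fnum y) (fden y) => p q r s s0 q0.
have fq : frac q != 0 by rewrite tofrac_eq0.
have fs : frac s != 0 by rewrite tofrac_eq0.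
rewrite (fderivE p q0) (fderivE r s0) (addf_div (frac p) (frac r) fq fs).
rewrite -(rmorphM frac p) -(rmorphM frac r) -(rmorphM frac q) -(rmorphD frac).
rewrite (fderivE _ (mulf_neq0 q0 s0)) derivD !derivM.
rewrite !(rmorphB frac, rmorphD frac, rmorphM frac).
exact: (quotient_ruleD (frac p) (frac p^`()) (frac q^`()) (frac r) (frac r^`()) (frac s^`()) fq fs).
Qed.

Lemma fderivM x y : fderiv (x * y) = fderiv x * y + x * fderiv y.
Proof.
rewrite [x in LHS]fracE [y in LHS]fracE [x in RHS]fracE [y in RHS]fracE.
have := fden_neq0 x; have := fden_neq0 y.
move: (fnum x) (fden x) (fnum y) (fden y) => p q r s s0 q0.
have fq : frac q != 0 by rewrite tofrac_eq0.
have fs : frac s != 0 by rewrite tofrac_eq0.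
rewrite (fderivE p q0) (fderivE r s0) (mulf_div (frac p)).
rewrite -(rmorphM frac p) -(rmorphM frac q) (fderivE _ (mulf_neq0 q0 s0)) !derivM.
rewrite !(rmorphB frac, rmorphD frac, rmorphM frac).
exact: (quotient_ruleM (frac p) (frac p^`()) (frac q^`()) (frac r) (frac r^`()) (frac s^`()) fq fs).
Qed.

Definition fconst : k -> K := frac \o polyC.
HB.instance Definition _ := GRing.RMorphism.on fconst.

Lemma fderiv_const c : fderiv (fconst c) = 0.
Proof. by rewrite /fconst /= fderiv_frac derivC rmorph0. Qed.

Hypothesis char0 : [pchar k] =i pred0.

Lemma deriv_eq0_const (p : {poly k}) : p^`() = 0 -> p = (p`_0)%:P.
Proof.
move=> e; apply/size1_polyC/leq_sizeP => -[//|j] _.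
have := congr1 (fun p : {poly k} => p`_j) e; rewrite coef_deriv coef0 => /eqP.
by rewrite -mulr_natr mulf_eq0 (negPf (natr0 char0 j)) orbF => /eqP.
Qed.

Lemma dvdp_deriv (p : {poly k}) : p %| p^`() -> p^`() = 0.
Proof.
have [->|p0] := eqVneq p 0; first by rewrite deriv0.
move=> h; apply/eqP; apply: contraTT h => d0; apply/negP => /dvdp_leq => /(_ d0).
by rewrite leqNgt lt_size_deriv.
Qed.

(** In lowest terms p' q = p q' makes p divide p' and q divide q', so both derivatives vanish by
    degree. *)
Lemma fderiv_eq0 x : fderiv x = 0 -> exists c, x = fconst c.
Proof.
rewrite {1 2}[x]fracE; have := fden_neq0 x; move: (fnum x) (fden x) => p0 q0 q00.
pose e := gcdp p0 q0; have e0 : e != 0 by rewrite gcdp_eq0 negb_and q00 orbT.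
pose p := p0 %/ e; pose q := q0 %/ e.
have pE : p0 = p * e by rewrite divpK // dvdp_gcdl.
have qE : q0 = q * e by rewrite divpK // dvdp_gcdr.
have cpq : coprimep p q by apply: coprimep_div_gcd; rewrite q00 orbT.
have qn : q != 0 by apply: contraNneq q00 => h; rewrite qE h mul0r.
have -> : frac p0 / frac q0 = frac p / frac q.
  by rewrite pE qE !rmorphM -mulf_div divff ?mulr1 // tofrac_eq0.
have fq : frac q != 0 by rewrite tofrac_eq0.
rewrite (fderivE p qn) => /eqP; rewrite mulf_eq0 invr_eq0 expf_eq0 /= (negPf fq).
rewrite orbF tofrac_eq0 subr_eq0 => /eqP h.
have hp : p^`() = 0.
  by apply: dvdp_deriv; rewrite -(Gauss_dvdpl _ cpq) h dvdp_mulr.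
have hq : q^`() = 0.
  by apply: dvdp_deriv; rewrite coprimep_sym in cpq; rewrite -(Gauss_dvdpr _ cpq) -h dvdp_mull.
rewrite (deriv_eq0_const hp) (deriv_eq0_const hq).
exists (p`_0 / q`_0); rewrite (rmorphM fconst); congr (_ * _).
by rewrite (fmorphV fconst).
Qed.
End RationalFunctions.


(** * Elimination by transvections *)

(* Division-free form of the elimination
   [A_(i+1) = tvm z (1 / w(e_i, A_i e_i)) * A_i] with [z = A_i e_i - e_i], which
   makes [A_i] fix [e_0, ..., e_(i-1)]: the pair [(N, d)] stands for [A_i = N / d]. *)
Section Elimination.
Variables (R : comUnitRingType) (g : nat).
Local Notation mat := 'M[R]_(g.*2).
Local Notation J := (symplectic_form R g).
Local Notation bv := (bv R g).

(** For A_i = N / d this is d z, and [elim_piv] is d^2 w(e_i, A_i e_i): the factors d cancel in the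
    transvection, because a scalar on the vector enters squared. *)
Definition elim_vec i (P : mat * R) := P.1 *m bv i - P.2 *: bv i.
Definition elim_piv i (P : mat * R) := P.2 * sdot (bv i) (P.1 *m bv i).
Definition elim_step i (P : mat * R) : mat * R :=
  (elim_piv i P *: P.1 + elim_vec i P *m ((elim_vec i P)^T *m J *m P.1),
   P.2 * elim_piv i P).

Fixpoint elim_run m (A : mat) : mat * R :=
  if m is m'.+1 then elim_step m' (elim_run m' A) else (A, 1).

Definition pivot i A := elim_piv i (elim_run i A).
Definition evec i A := elim_vec i (elim_run i A).
End Elimination.

Section EliminationMap.
Variables (R S : comUnitRingType) (f : {rmorphism R -> S}) (g : nat).

Lemma map_sdot (x y : 'cV[R]_(g.*2)) : f (sdot x y) = sdot (map_mx f x) (map_mx f y).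
Proof. by rewrite /sdot -(map_form f) map_trmx -!map_mxM [RHS]mxE. Qed.

Lemma elim_run_map m (A : 'M[R]_(g.*2)) :
  elim_run m (map_mx f A) = (map_mx f (elim_run m A).1, f (elim_run m A).2).
Proof.
elim: m => [|m ih]; first by rewrite /= rmorph1.
rewrite /= /elim_step ih /=.
have hv : elim_vec m (map_mx f (elim_run m A).1, f (elim_run m A).2) =
    map_mx f (elim_vec m (elim_run m A)).
  by rewrite /elim_vec /= map_mxB map_mxZ map_mxM map_bv.
have hp : elim_piv m (map_mx f (elim_run m A).1, f (elim_run m A).2) =
    f (elim_piv m (elim_run m A)).
  by rewrite /elim_piv /= rmorphM map_sdot map_mxM map_bv.
rewrite hv hp; congr (_, _); last by rewrite rmorphM.
by rewrite [RHS]map_mxD [X in _ = X + _]map_mxZ !map_mxM map_form -map_trmx.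
Qed.

Lemma pivot_map i (A : 'M[R]_(g.*2)) : pivot i (map_mx f A) = f (pivot i A) :> S.
Proof. by rewrite /pivot elim_run_map /elim_piv /= rmorphM map_sdot map_mxM map_bv. Qed.

Lemma evec_map i (A : 'M[R]_(g.*2)) : evec i (map_mx f A) = map_mx f (evec i A) :> 'cV_(g.*2).
Proof. by rewrite /evec elim_run_map /elim_vec /= map_mxB map_mxZ map_mxM map_bv. Qed.
End EliminationMap.

Section EliminationField.
Variables (K : fieldType) (g : nat).
Local Notation mat := 'M[K]_(g.*2).
Local Notation J := (symplectic_form K g).
Local Notation bv := (bv K g).

Fixpoint elim_prod m (A : mat) : mat :=
  if m is m'.+1 then elim_prod m' A *m tvm (evec m' A) (- (pivot m' A)^-1) else 1%:M.

Lemma tvm_alt (x : 'cV[K]_(g.*2)) c (N : mat) :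
  tvm x c *m N = N + c *: (x *m (x^T *m J *m N)).
Proof. by rewrite /tvm mulmxDl mul1mx -scalemxAl -mulmxA. Qed.

(** A later step does not spoil an earlier one: when B is symplectic and fixes e_j, the vector B e_m
    - e_m is orthogonal to e_j. *)
Lemma elim_runP m (A : mat) : symplectic A ->
  (forall i, (i < m)%N -> pivot i A != 0) ->
  let B := (elim_run m A).2^-1 *: (elim_run m A).1 in
  [/\ (elim_run m A).2 != 0, A = elim_prod m A *m B, symplectic B &
      forall j, (j < m)%N -> B *m bv j = bv j].
Proof.
move=> hA; elim: m => [|m ih] piv /=.
  by rewrite invr1 scale1r mul1mx oner_neq0.
have [|d0 AE Bs Bf] := ih; first by move=> i hi; apply: piv; apply: ltnW.
have p0 := piv m (ltnSn m); rewrite /pivot in p0 *; rewrite /evec.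
move: (elim_run m A) d0 AE Bs Bf p0 => [N d] /= d0 AE Bs Bf p0.
set p := elim_piv m (N, d) in p0 *; set y := elim_vec m (N, d).
set B := d^-1 *: N in AE Bs Bf.
have NE : N = d *: B by rewrite /B scalerA mulfV // scale1r.
have yE : y = d *: (B *m bv m - bv m).
  by rewrite /y /elim_vec /= NE -scalemxAl scalerBr.
have pE : p = d ^+ 2 * sdot (bv m) (B *m bv m).
  by rewrite /p /elim_piv /= NE -scalemxAl sdotZr mulrA expr2.
have B'E : (d * p)^-1 *: (p *: N + y *m (y^T *m J *m N)) = tvm y p^-1 *m B.
  rewrite tvm_alt scalerDr scalerA invfM -mulrA mulVf // mulr1; congr (_ + _).
  by rewrite /B -!scalemxAr !scalerA mulrC.
rewrite B'E; split.
- by rewrite mulf_neq0.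
- by rewrite -mulmxA [tvm _ _ *m (_ *m _)]mulmxA tvmNl mul1mx.
- exact: symplecticM (tvm_symplectic _ _) Bs.
move=> j; rewrite ltnS leq_eqVlt -mulmxA tvmE => /orP [/eqP ->|jm].
  have h : sdot y (B *m bv m) = - d * sdot (bv m) (B *m bv m).
    by rewrite yE sdotZl sdotBl sdotxx sub0r mulrN mulNr.
  have -> : p^-1 * sdot y (B *m bv m) = - d^-1.
    rewrite h; apply: (mulfI p0); rewrite mulrA mulfV // mul1r mulrN pE expr2.
    by rewrite mulNr [X in _ = - X]mulrAC mulfK.
  by rewrite yE scalerA mulNr mulVf // scaleN1r opprB addrC subrK.
have h : sdot (B *m bv m) (bv j) = sdot (bv m) (bv j).
  by rewrite -{1}(Bf j jm) (symplectic_sdot _ _ Bs).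
by rewrite Bf // yE sdotZl sdotBl h subrr !mulr0 scale0r addr0.
Qed.

Lemma elim_prodE (A : mat) : symplectic A ->
  (forall i, (i < g.*2)%N -> pivot i A != 0) -> A = elim_prod g.*2 A.
Proof.
move=> hA hp; have [_ e _ h] := elim_runP hA hp.
rewrite {1}e [X in _ *m X]symplectic_fixes ?mulmx1 // => p pg.
by rewrite !h ?lt_av ?lt_cv.
Qed.
End EliminationField.

Section BasePoint.
Variables (R : comUnitRingType) (g : nat).

Definition partner i := if odd i then i.-1 else i.+1.

Lemma partner_lt i : (i < g.*2)%N -> (partner i < g.*2)%N.
Proof. by rewrite /partner; case: ifP => oi; lia. Qed.

(** The partner of e_i pairs to a sign with e_i and to zero with every other basis vector, so its
    transvection moves e_i alone. *)
Definition base_word s : seq (letter R) := [seq (partner i, partner i, 1) | i <- s].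

Lemma lmx_partner i : lmx g (partner i, partner i, 1) = tvm (dv R g i) 1.
Proof.
by rewrite /lmx /sv /= eqxx /partner /dv; case: ifP => _; rewrite ?tvmN.
Qed.

Lemma base_word_fix s i : i \notin s -> all (gtn g.*2) s -> (i < g.*2)%N ->
  wmx g (base_word s) *m bv R g i = bv R g i.
Proof.
elim: s => [|j s ih] /=; first by rewrite mul1mx.
rewrite inE negb_or => /andP [ij js] /andP [jg sg] ig.
rewrite -mulmxA ih // lmx_partner tvmE sdotC sdot_dv // (negPf ij).
by rewrite oppr0 mulr0 scale0r addr0.
Qed.

Lemma base_word_ok s : all (gtn g.*2) s -> wok g 0 (base_word s).
Proof.
rewrite /wok /base_word all_map; apply: sub_all => i /= ig.
by rewrite partner_lt.
Qed.

(* A product of transvections at which all pivots of the elimination are nonzero. *)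
Definition base_point := wmx g (base_word (iota 0 g.*2)).
End BasePoint.

Lemma map_base_word (R S : comUnitRingType) (f : {rmorphism R -> S}) s :
  map_word f (base_word R s) = base_word S s.
Proof. by rewrite /map_word -map_comp; apply: eq_map => i /=; rewrite rmorph1. Qed.

(** Elimination strips the base word from the left, one letter per step: the remaining tail fixes
    e_m, so the step only sees the letter in front of it. *)
Lemma base_run (K : fieldType) g m : (m <= g.*2)%N -> exists2 c : K, c != 0 &
  elim_run m (base_point K g) = (c *: wmx g (base_word K (iota m (g.*2 - m))), c).
Proof.
elim: m => [|m ih] hm; first by exists 1; rewrite ?oner_neq0 // subn0 scale1r.
have [|c c0 e] := ih; first exact: ltnW.
have s_lt : all (gtn g.*2) (iota m.+1 (g.*2 - m.+1)).
  by apply/allP => i; rewrite mem_iota /=; lia.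
rewrite /= e; have -> : (g.*2 - m)%N = (g.*2 - m.+1).+1 by lia.
rewrite /= lmx_partner; set T := wmx g _; set s := dv K g m.
have Tm : T *m bv K g m = bv K g m.
  by apply: base_word_fix => //; rewrite mem_iota; lia.
have sm : sdot s (bv K g m) = -1 by rewrite sdotC sdot_dv // eqxx.
have ms : sdot (bv K g m) s = 1 by rewrite sdot_dv // eqxx.
have vE : c *: (tvm s 1 *m T) *m bv K g m = c *: (bv K g m - s).
  by rewrite -scalemxAl -mulmxA Tm tvmE sm mulrN1 scaleN1r.
have pE : elim_piv m (c *: (tvm s 1 *m T), c) = - c ^+ 2.
  by rewrite /elim_piv /= vE sdotZr sdotBr sdotxx ms sub0r mulrN1 mulrN expr2.
have yE : elim_vec m (c *: (tvm s 1 *m T), c) = - c *: s.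
  by rewrite /elim_vec /= vE scalerBr addrAC subrr sub0r scaleNr.
exists (- c ^+ 3); first by rewrite oppr_eq0 expf_neq0.
rewrite /elim_step pE yE /=; congr (_, _); last by rewrite mulrN -exprS.
have TE : T = tvm s (-1) *m (tvm s 1 *m T) by rewrite mulmxA tvmNl mul1mx.
rewrite [in RHS]TE; move: (tvm s 1 *m T) => N; rewrite tvm_alt [(- c *: s)^T]linearZ /=.
rewrite -!scalemxAl -!scalemxAr !scalerA scalerDr !scalerA; congr (_ *: _ + _ *: _).
  by ring.
by ring.
Qed.

Lemma base_pivot (K : fieldType) g i : (i < g.*2)%N -> pivot i (base_point K g) != 0.
Proof.
move=> ig; have [c c0 e] := @base_run K g i.+1 ig; move: e => /= [_ e].
by apply: contraNneq c0; rewrite /pivot -e => ->; rewrite mulr0.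
Qed.

(** * Numerator and denominator of the elimination formula *)

Section Numerators.
Variables (k : fieldType) (g d : nat) (I : infinitesimal_data k g d).
Local Notation n0 := (inf_n0 I).
Variables (R : comUnitRingType) (iota : {rmorphism k -> R}).

(* [pivot ^ n0 *: exp (- pivot^-1 *: quad)] written without division by the pivot. *)
Definition num_factor m (A : 'M[R]_(g.*2)) : 'M[R]_d :=
  \sum_(j < n0) ((-1) ^+ j * pivot m A ^+ (n0 - j) / (j`!)%:R) *:
    quadR I iota (evec m A) ^+ j.

Fixpoint num_prod m A : 'M[R]_d :=
  if m is m'.+1 then num_prod m' A * num_factor m' A else 1.

Definition den_prod m (A : 'M[R]_(g.*2)) : R := \prod_(i < m) pivot i A ^+ n0.
End Numerators.

Section NumeratorsMap.
Variables (k : fieldType) (char0 : [pchar k] =i pred0).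
Variables (g d : nat) (I : infinitesimal_data k g d).
Variables (R S : comUnitRingType) (f : {rmorphism R -> S}).
Variables (iR : {rmorphism k -> R}) (iS : {rmorphism k -> S}).
Hypothesis f_iR : forall c, f (iR c) = iS c.

Lemma quadR_map x : map_mx f (quadR I iR x) = quadR I iS (map_mx f x).
Proof.
rewrite /quadR phi_map map_mxM map_trmx; congr (phi _ _).
apply: funext => a; apply: funext => b; rewrite /betaR -map_mx_comp.
by apply: eq_map_mx => c /=; rewrite f_iR.
Qed.

Lemma num_prod_map m A : map_mx f (num_prod I iR m A) = num_prod I iS m (map_mx f A).
Proof.
elim: m => [|m ih] /=; first by rewrite map_mx1.
rewrite -mulmxE map_mxM ih; congr (_ * _).
rewrite /num_factor map_mx_sum; apply: eq_bigr => j _.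
rewrite map_mxZ mulmxX_map quadR_map evec_map pivot_map; congr (_ *: _).
rewrite (rmorphM f (_ * _)) (rmorphM f (_ ^+ _)) !rmorphXn rmorphN1 rmorphV ?rmorph_nat //.
by apply: fact_unit => i; apply: natuR iR _.
Qed.

Lemma den_prod_map m A : f (den_prod I m A) = den_prod I m (map_mx f A).
Proof.
by rewrite rmorph_prod; apply: eq_bigr => i _; rewrite rmorphXn pivot_map.
Qed.
End NumeratorsMap.

Section NumeratorsField.
Variables (k : fieldType) (char0 : [pchar k] =i pred0).
Variables (g d : nat) (g0 : (0 < g)%N) (I : infinitesimal_data k g d).
Variables (K : fieldType) (iota : {rmorphism k -> K}).
Local Notation n0 := (inf_n0 I).

(** The truncated exponential of -1/pivot has degree below [n0] in 1/pivot, so the factor pivot^n0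
    clears it. *)
Lemma num_prodE m (A : 'M[K]_(g.*2)) : (forall i, (i < m)%N -> pivot i A != 0) ->
  exists2 G, realizes I iota (elim_prod m A) G & num_prod I iota m A = den_prod I m A *: G.
Proof.
elim: m => [|m ih] hp /=.
  by exists 1; [exact: realizes1|rewrite /den_prod big_ord0 scale1r].
have [|G hG e] := ih; first by move=> i hi; apply: hp; apply: ltnW.
exists (G * nexp n0 (quadR I iota (evec m A)) (- (pivot m A)^-1)).
  by apply: realizesM => //; apply: realizes_tvm.
have p0 := hp m (ltnSn m).
have -> : num_factor I iota m A =
    pivot m A ^+ n0 *: nexp n0 (quadR I iota (evec m A)) (- (pivot m A)^-1).
  rewrite /nexp scaler_sumr; apply: eq_bigr => j _; rewrite scalerA; congr (_ *: _).
  rewrite mulrA; congr (_ / _); rewrite [in RHS]exprNn exprVn mulrCA.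
  have jn : (j <= n0)%N by apply: ltnW.
  congr (_ * _); apply: (mulIf (expf_neq0 j p0)).
  by rewrite -exprD subnK // mulfVK // expf_neq0.
by rewrite e scalemx_mull scalemx_mulr scalerA /den_prod big_ord_recr.
Qed.

Lemma realizes_quotient A G G' : realizes I iota A G -> realizes I iota A G' ->
  exists2 X, realizes I iota 1%:M X & G = X * G'.
Proof.
move=> [l [hl <- <-]] [l' [hl' e <-]]; exists (fmx I iota l * fmx I iota (winv l')).
  exists (l ++ winv l'); rewrite wok_cat wok_winv hl hl' wmx_cat fmx_cat; split=> //.
  by rewrite -e wmx_winvr.
by rewrite -mulrA fmx_winvl ?mulr1.
Qed.

Lemma realizes_inv A G : realizes I iota A G -> exists G', G * G' = 1.
Proof. by move=> [l [_ _ <-]]; exists (fmx I iota (winv l)); apply: fmx_winvr. Qed.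
End NumeratorsField.


(** * Polynomiality *)

Section RationalFormula.
Variables (k : fieldType) (char0 : [pchar k] =i pred0) (g d : nat) (g0 : (0 < g)%N).
Variable I : infinitesimal_data k g d.
Variable rho : Sp int g -> 'M[k]_d.
Hypothesis rhoM : forall A B, rho (A * B)%g = rho A * rho B.
Hypothesis rho_word : forall l, wok g 0 l ->
  rho (wSp g l) = fmx I idfun (map_word (intr : int -> k) l).

Local Notation P := {poly k}.
Local Notation K := {fraction {poly k}}.
Local Notation frac := (@FracField.tofrac {poly k}).
Local Notation icast := (map_mx (intr : int -> k)).

Definition eval_at (c : k) : {rmorphism P -> k} := horner_eval c.

Definition base_letters := base_word int (iota 0 g.*2).
Definition base_Sp : Sp int g := wSp g base_letters.

Lemma base_letters_ok : wok g 0 base_letters.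
Proof. by apply: base_word_ok; apply/allP => i; rewrite mem_iota. Qed.

Definition scaled_word (l : seq (letter int)) : seq (letter P) :=
  [seq (a.1, (a.2%:~R : k) *: 'X) | a <- l].

Lemma wok_scaled l : wok g 0 (scaled_word l) = wok g 0 l.
Proof. by rewrite /wok all_map. Qed.

Lemma scaled_at0 l : wmx g (map_word (eval_at 0) (scaled_word l)) = 1%:M /\
  fmx I idfun (map_word (eval_at 0) (scaled_word l)) = 1.
Proof.
elim: l => [|a l [ih1 ih2]] //=; rewrite ih1 ih2 /lmx /= /eval_at /= /horner_eval.
rewrite hornerZ hornerX mulr0 tvm0 mul1mx nexp0 ?mul1r //.
exact: n0_gt0.
Qed.

Lemma scaled_at1 l :
  map_word (eval_at 1) (scaled_word l) = map_word (intr : int -> k) l.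
Proof.
rewrite /map_word -map_comp; apply: eq_map => a /=.
by rewrite /eval_at /= /horner_eval hornerZ hornerX mulr1.
Qed.

(* [M(t)], the word of [A base^-1] with all parameters scaled by [t], times [base],
   runs from [base] to [A].  Over k(t) the elimination writes it as a second word
   in transvections, so the two exponential products differ by a constant matrix,
   which [t = 0] shows not to depend on [A]; [t = 1] gives the formula. *)
Lemma rational_formula : exists C : 'M[k]_d, forall A : Sp int g,
  den_prod I g.*2 (icast (Sp_val A)) *: rho A =
  C * num_prod I idfun g.*2 (icast (Sp_val A)).
Proof.
have base_piv i : (i < g.*2)%N -> pivot i (base_point k g) != 0 by apply: base_pivot.
have [G rG numG] := num_prodE char0 g0 I idfun base_piv.
have [G' GG'] := realizes_inv char0 rG.
(* Forced by t = 0, where the formula reads [rho base_Sp = C * G]. *)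
exists (rho base_Sp * G') => A.
pose A1 := (A * base_Sp^-1)%g.
have [l hl e1] := symplectic_word int_euclidean (Sp_valP A1).
have AE : A = (wSp g l * base_Sp)%g.
  have -> : wSp g l = A1 by apply: val_inj.
  by rewrite /A1 -mulgA mulVg mulg1.
pose iP : {rmorphism k -> P} := polyC.
pose lP := scaled_word l ++ base_word P (iota 0 g.*2).
pose MP := wmx g lP; pose FP := fmx I iP lP.
have ok_lP : wok g 0 lP.
  by rewrite wok_cat wok_scaled hl base_word_ok //; apply/allP => i; rewrite mem_iota.
have MP0 : map_mx (eval_at 0) MP = base_point k g.
  rewrite /MP wmx_cat map_mxM !map_wmx map_base_word.
  by have [-> _] := scaled_at0 l; rewrite mul1mx.
have MP1 : map_mx (eval_at 1) MP = icast (Sp_val A).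
  rewrite /MP wmx_cat map_mxM !map_wmx map_base_word scaled_at1 AE /=.
  by rewrite map_mxM !map_wmx /base_letters map_base_word.
have hev c : forall a, eval_at c (iP a) = a by move=> a; apply: hornerC.
have lP_map c : map_word (eval_at c) lP =
    map_word (eval_at c) (scaled_word l) ++ base_word k (iota 0 g.*2).
  rewrite -(map_base_word (eval_at c)); exact: map_cat.
have base_k : rho base_Sp = fmx I idfun (base_word k (iota 0 g.*2)).
  by rewrite rho_word ?base_letters_ok // /base_letters map_base_word.
have FP0 : map_mx (eval_at 0) FP = rho base_Sp.
  rewrite (fmx_map char0 I (iS := idfun)) // lP_map fmx_cat base_k.
  by have [_ ->] := scaled_at0 l; rewrite mul1r.
have FP1 : map_mx (eval_at 1) FP = rho A.
  rewrite (fmx_map char0 I (iS := idfun)) // lP_map fmx_cat.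
  by rewrite scaled_at1 AE rhoM base_k rho_word.
pose MK := map_mx frac MP; pose FK := map_mx frac FP.
pose iK : {rmorphism k -> K} := @fconst k.
have rF : realizes I iK MK FK.
  exists (map_word frac lP); split; first by rewrite wok_map.
    by rewrite -map_wmx.
  by rewrite -(fmx_map char0 I (iR := iP)).
(* At t = 0 these pivots become those of the base point, so they are nonzero polynomials, whatever
   happens at t = 1. *)
have pivP i : (i < g.*2)%N -> pivot i MP != 0.
  move=> hi; apply: contraNneq (base_piv i hi) => h.
  by rewrite -MP0 pivot_map h rmorph0.
have pivK i : (i < g.*2)%N -> pivot i MK != 0.
  by move=> hi; rewrite pivot_map tofrac_eq0 pivP.
have MKs : symplectic MK by rewrite /MK map_wmx wmx_symplectic.
have [GK rGK numGK] := num_prodE char0 g0 I iK pivK.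
rewrite -(elim_prodE MKs pivK) in rGK.
have [X rX FX] := realizes_quotient char0 rF rGK.
have DX := realizes_const char0 (@fderivD k) (@fderivM k) (@fderiv_const k) rX.
have [X0 XE] : exists X0 : 'M[k]_d, X = map_mx iK X0.
  have h a b : exists c, X a b = iK c.
    by apply: fderiv_eq0 => //; have /matrixP/(_ a b) := DX; rewrite !mxE.
  exists (\matrix_(a, b) sval (cid (h a b))); apply/matrixP => a b; rewrite !mxE.
  by case: cid.
(* The division-free identity descends from k(t) to k[t], and so can be evaluated even where pivots
   vanish. *)
have main : den_prod I g.*2 MP *: FP = map_mx iP X0 * num_prod I iP g.*2 MP.
  apply: map_frac_inj.
  rewrite map_mxZ -[RHS]/(map_mx frac (map_mx iP X0 *m num_prod I iP g.*2 MP)) map_mxM.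
  rewrite (num_prod_map char0 I (iS := iK)) // den_prod_map -map_mx_comp.
  have -> : map_mx (frac \o iP) X0 = X by rewrite XE.
  by rewrite -/MK -/FK numGK FX mulmxE scalemx_mulr.
have main_at c : den_prod I g.*2 (map_mx (eval_at c) MP) *:
    map_mx (eval_at c) FP = X0 * num_prod I idfun g.*2 (map_mx (eval_at c) MP).
  have := congr1 (map_mx (eval_at c)) main.
  rewrite map_mxZ -mulmxE map_mxM (num_prod_map char0 I (iS := idfun)) // den_prod_map.
  by rewrite -/(ev _ (map_mx iP _)) evC.
have := main_at 1; rewrite MP1 FP1 => ->; congr (_ * _).
have := main_at 0; rewrite MP0 FP0 numG scalemx_mulr => /scalerI -> //.
  by rewrite -mulrA GG' mulr1.
by apply/prodf_neq0 => i _; rewrite expf_neq0 // base_piv.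
Qed.
End RationalFormula.


(** * Polynomial functions of a matrix and separation of variables *)

Section PolynomialFunctions.
Variables (k : fieldType) (n : nat).
Local Notation mat := 'M[k]_n.

Definition polyfun (h : mat -> k) :=
  exists p : {mpoly k[n * n]}, forall A, h A = p.@[mxvec A 0].

Lemma polyfun_ext h h' : h =1 h' -> polyfun h -> polyfun h'.
Proof. by move=> e [p hp]; exists p => A; rewrite -e. Qed.

Lemma polyfun_const c : polyfun (fun=> c).
Proof. by exists (c%:MP) => A; rewrite mevalC. Qed.

Lemma polyfun_entry i j : polyfun (fun A => A i j).
Proof. by exists 'X_(mxvec_index i j) => A; rewrite mevalXU mxvecE. Qed.

Lemma polyfunD h h' : polyfun h -> polyfun h' -> polyfun (fun A => h A + h' A).
Proof. by move=> [p hp] [q hq]; exists (p + q) => A; rewrite mevalD hp hq. Qed.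

Lemma polyfunM h h' : polyfun h -> polyfun h' -> polyfun (fun A => h A * h' A).
Proof. by move=> [p hp] [q hq]; exists (p * q) => A; rewrite mevalM hp hq. Qed.

Lemma polyfunX h m : polyfun h -> polyfun (fun A => h A ^+ m).
Proof. by move=> [p hp]; exists (p ^+ m) => A; rewrite rmorphXn /= hp. Qed.

Lemma polyfun_sum (T : Type) (r : seq T) (h : T -> mat -> k) :
  (forall i, polyfun (h i)) -> polyfun (fun A => \sum_(i <- r) h i A).
Proof.
move=> hh; elim: r => [|i r ih].
  by apply: polyfun_ext (polyfun_const 0) => A; rewrite big_nil.
by apply: polyfun_ext (polyfunD (hh i) ih) => A; rewrite big_cons.
Qed.

Lemma polyfun_prod (T : Type) (r : seq T) (h : T -> mat -> k) :
  (forall i, polyfun (h i)) -> polyfun (fun A => \prod_(i <- r) h i A).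
Proof.
move=> hh; elim: r => [|i r ih].
  by apply: polyfun_ext (polyfun_const 1) => A; rewrite big_nil.
by apply: polyfun_ext (polyfunM (hh i) ih) => A; rewrite big_cons.
Qed.

Definition polymx a b (H : mat -> 'M[k]_(a, b)) := forall i j, polyfun (fun A => H A i j).

Lemma polymx_ext a b (H H' : mat -> 'M[k]_(a, b)) : H =1 H' -> polymx H -> polymx H'.
Proof. by move=> e h i j; apply: polyfun_ext (h i j) => A; rewrite e. Qed.

Lemma polymx_const a b (M : 'M[k]_(a, b)) : polymx (fun=> M).
Proof. by move=> i j; apply: polyfun_const. Qed.

Lemma polymx_id : polymx (fun A : mat => A).
Proof. by move=> i j; apply: polyfun_entry. Qed.

Lemma polymxD a b (H H' : mat -> 'M[k]_(a, b)) :
  polymx H -> polymx H' -> polymx (fun A => H A + H' A).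
Proof.
by move=> h h' i j; apply: polyfun_ext (polyfunD (h i j) (h' i j)) => A; rewrite mxE.
Qed.

Lemma polymxZ a b (c : mat -> k) (H : mat -> 'M[k]_(a, b)) :
  polyfun c -> polymx H -> polymx (fun A => c A *: H A).
Proof.
by move=> h h' i j; apply: polyfun_ext (polyfunM h (h' i j)) => A; rewrite mxE.
Qed.

Lemma polymxM a b c (H : mat -> 'M[k]_(a, b)) (H' : mat -> 'M[k]_(b, c)) :
  polymx H -> polymx H' -> polymx (fun A => H A *m H' A).
Proof.
move=> h h' i j.
have := @polyfun_sum _ (index_enum 'I_b) (fun l A => H A i l * H' A l j)
  (fun l => polyfunM (h i l) (h' l j)).
by apply: polyfun_ext => A; rewrite mxE.
Qed.

Lemma polymx_tr a b (H : mat -> 'M[k]_(a, b)) : polymx H -> polymx (fun A => (H A)^T).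
Proof. by move=> h i j; apply: polyfun_ext (h j i) => A; rewrite mxE. Qed.

Lemma polymx_sum (T : Type) (r : seq T) a b (H : T -> mat -> 'M[k]_(a, b)) :
  (forall i, polymx (H i)) -> polymx (fun A => \sum_(i <- r) H i A).
Proof.
move=> hh; elim: r => [|i r ih].
  by apply: polymx_ext (polymx_const 0) => A; rewrite big_nil.
by apply: polymx_ext (polymxD (hh i) ih) => A; rewrite big_cons.
Qed.

Lemma polymxX d (H : mat -> 'M[k]_d) m : polymx H -> polymx (fun A => H A ^+ m).
Proof.
move=> h; elim: m => [|m ih]; first exact: polymx_const.
by apply: polymx_ext (polymxM h ih) => A; rewrite exprS.
Qed.

Lemma polyfun_comp h (H : mat -> mat) : polyfun h -> polymx H -> polyfun (fun A => h (H A)).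
Proof.
move=> [p hp] hH.
have hr (r : 'I_(n * n)) : polyfun (fun A => mxvec (H A) 0 r).
  by case/mxvec_indexP: r => i j; apply: polyfun_ext (hH i j) => A; rewrite mxvecE.
have hm (m : 'X_{1..n * n}) : polyfun (fun A => p@_m * \prod_(i < n * n) mxvec (H A) 0 i ^+ m i).
  by apply: polyfunM (polyfun_const _) _; apply: polyfun_prod => i; apply: polyfunX.
by apply: polyfun_ext (polyfun_sum (msupp p) hm) => A; rewrite hp mevalE.
Qed.

Lemma polymx_comp a b (G : mat -> 'M[k]_(a, b)) (H : mat -> mat) :
  polymx G -> polymx H -> polymx (fun A => G (H A)).
Proof. by move=> hG hH i j; apply: polyfun_comp (hG i j) hH. Qed.

(** A form of the comultiplication: a polynomial in X Y is a finite sum of functions of X times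
    polynomials in Y. *)
Definition splits (h : mat -> mat -> k) := exists r (u v : 'I_r -> mat -> k),
  (forall i, polyfun (v i)) /\ forall X Y, h X Y = \sum_(i < r) u i X * v i Y.

Lemma splits_ext h h' : h =2 h' -> splits h -> splits h'.
Proof. by move=> e [r [u [v [hv hE]]]]; exists r, u, v; split=> // X Y; rewrite -e. Qed.

Lemma splits1 u v : polyfun v -> splits (fun X Y => u X * v Y).
Proof.
by move=> hv; exists 1%N, (fun=> u), (fun=> v); split=> // X Y; rewrite big_ord1.
Qed.

Lemma splitsD h h' : splits h -> splits h' -> splits (fun X Y => h X Y + h' X Y).
Proof.
move=> [r [u [v [hv hE]]]] [r' [u' [v' [hv' hE']]]].
exists (r + r')%N, (fun i => match split i with inl a => u a | inr b => u' b end).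
exists (fun i => match split i with inl a => v a | inr b => v' b end).
split=> [i|X Y]; first by case: split.
rewrite hE hE' big_split_ord /=; congr (_ + _); apply: eq_bigr => i _.
  by rewrite (unsplitK (inl i)).
by rewrite (unsplitK (inr i)).
Qed.

Lemma splits0 : splits (fun _ _ => 0).
Proof.
exists 0%N, (fun _ _ => 0), (fun _ _ => 0).
by split=> [i|X Y]; [apply: polyfun_const|rewrite big_ord0].
Qed.

Lemma splits_sum (T : Type) (r : seq T) h :
  (forall i : T, splits (h i)) -> splits (fun X Y => \sum_(i <- r) h i X Y).
Proof.
move=> hh; elim: r => [|i r ih].
  by apply: splits_ext splits0 => X Y; rewrite big_nil.
by apply: splits_ext (splitsD (hh i) ih) => X Y; rewrite big_cons.
Qed.

Lemma splitsM h h' : splits h -> splits h' -> splits (fun X Y => h X Y * h' X Y).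
Proof.
move=> [r [u [v [hv hE]]]] [r' [u' [v' [hv' hE']]]].
apply: (@splits_ext (fun X Y => \sum_(i < r) \sum_(j < r') (u i X * u' j X) * (v i Y * v' j Y))).
  move=> X Y; rewrite hE hE' mulr_suml; apply: eq_bigr => i _.
  by rewrite mulr_sumr; apply: eq_bigr => j _; rewrite mulrACA.
apply: splits_sum => i; apply: splits_sum => j.
exact: (splits1 (fun X => u i X * u' j X) (polyfunM (hv i) (hv' j))).
Qed.

Lemma splits_const c : splits (fun _ _ => c).
Proof.
by apply: splits_ext (splits1 (fun=> c) (polyfun_const 1)) => X Y; rewrite mulr1.
Qed.

Lemma splits_prod (T : Type) (r : seq T) h :
  (forall i : T, splits (h i)) -> splits (fun X Y => \prod_(i <- r) h i X Y).
Proof.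
move=> hh; elim: r => [|i r ih].
  by apply: splits_ext (splits_const 1) => X Y; rewrite big_nil.
by apply: splits_ext (splitsM (hh i) ih) => X Y; rewrite big_cons.
Qed.

Lemma splitsX h m : splits h -> splits (fun X Y => h X Y ^+ m).
Proof.
move=> hh; elim: m => [|m ih]; first exact: splits_const.
by apply: splits_ext (splitsM hh ih) => X Y; rewrite exprS.
Qed.

Lemma polyfun_splits f : polyfun f -> splits (fun X Y => f (X *m Y)).
Proof.
move=> [p hp].
have hr (r : 'I_(n * n)) : splits (fun X Y => mxvec (X *m Y) 0 r).
  case/mxvec_indexP: r => i j.
  apply: (@splits_ext (fun X Y => \sum_(l < n) X i l * Y l j)).
    by move=> X Y; rewrite mxvecE mxE.
  by apply: splits_sum => l; apply: (splits1 (fun X => X i l)); apply: polyfun_entry.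
apply: (@splits_ext (fun X Y => \sum_(m <- msupp p)
    p@_m * \prod_(i < n * n) mxvec (X *m Y) 0 i ^+ m i)).
  by move=> X Y; rewrite hp mevalE.
apply: splits_sum => m; apply: splitsM (splits_const _) _.
by apply: splits_prod => i; apply: splitsX.
Qed.
End PolynomialFunctions.

(** Take finitely many values of maximal rank; adjoining another cannot raise it. *)
Lemma finite_row_span (k : fieldType) (T : Type) r (v : T -> 'rV[k]_r) :
  exists m (b : 'I_m -> T), forall t, (v t <= \matrix_(l < m) v (b l))%MS.
Proof.
pose has q := `[< exists m (b : 'I_m -> T), \rank (\matrix_(l < m) v (b l)) = q >].
have has0 : exists q, has q.
  exists (\rank (\matrix_(l < 0) (0 : 'rV[k]_r))); apply/asboolP.
  exists 0%N, (fun i : 'I_0 => match i with Ordinal _ h => False_rect T (notF h) end).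
  by congr (\rank _); apply/matrixP => -[].
have bound q : has q -> (q <= r)%N by move=> /asboolP [m [b <-]]; apply: rank_leq_col.
case: (ex_maxnP has0 bound) => q /asboolP [m [b hb]] qmax; exists m, b => t.
pose b' (i : 'I_m.+1) := if unlift ord0 i is Some j then b j else t.
set M := \matrix_(l < m) _ in hb *; pose M' := \matrix_(l < m.+1) v (b' l).
have rM' l : row l M' = v (b' l) by rewrite rowK.
have MM' : (M <= M')%MS.
  apply/row_subP => l; rewrite rowK -[b l](_ : b' (lift ord0 l) = _) -?rM' ?row_sub //.
  by rewrite /b' liftK.
have tM' : (v t <= M')%MS.
  by rewrite -[t](_ : b' ord0 = _) -?rM' ?row_sub // /b' unlift_none.
have rk : \rank M = \rank M'.
  apply/eqP; rewrite eqn_leq mxrankS //= hb; apply: qmax; apply/asboolP.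
  by exists m.+1, b'.
have [_ e] := mxrank_leqif_sup MM'.
by apply: submx_trans tM' _; rewrite -e rk.
Qed.

(** * Removal of the denominator by translation *)

Section Translation.
Variables (k : fieldType) (g d : nat) (rho : Sp int g -> 'M[k]_d).
Hypothesis rho1 : rho 1%g = 1.
Hypothesis rhoM : forall A B, rho (A * B)%g = rho A * rho B.
Local Notation icast := (map_mx (intr : int -> k)).
Local Notation J := (symplectic_form k g).

Lemma icastM (A B : Sp int g) : icast (Sp_val (A * B)%g) = icast (Sp_val A) *m icast (Sp_val B).
Proof. exact: map_mxM. Qed.

Lemma icastV (A : Sp int g) : icast (Sp_val A^-1%g) = - (J *m (icast (Sp_val A))^T *m J).
Proof.
have hA := symplectic_map (intr : {rmorphism int -> k}) A.
have e : - (J *m (icast (Sp_val A))^T *m J) *m icast (Sp_val A) = 1%:M.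
  rewrite mulNmx -!mulmxA [_^T *m (J *m _)]mulmxA (eqP hA).
  by rewrite mulmx_symplectic_form opprK.
by rewrite -[LHS]mul1mx -e -[LHS]mulmxA -icastM mulgV [icast (Sp_val 1%g)]map_mx1 mulmx1.
Qed.

(* The [f] for which [f *: rho] is polynomial form an ideal stable under right
   translation.  Writing [f (X B) = sum u_i(X) v_i(B)] and expressing
   [v (A^-1 A0)] in terms of finitely many [v (B_l)], one gets the nonzero
   constant [f A0 = f (A (A^-1 A0))] in that ideal. *)
Lemma polynomial_of_rational (f : 'M[k]_(g.*2) -> k) (N : 'M[k]_(g.*2) -> 'M[k]_d) A0 :
  polyfun f -> polymx N -> f (icast (Sp_val A0)) != 0 ->
  (forall A : Sp int g, f (icast (Sp_val A)) *: rho A = N (icast (Sp_val A))) ->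
  exists2 Q, polymx Q & forall A : Sp int g, rho A = Q (icast (Sp_val A)).
Proof.
move=> pf pN fA0 fN; have [r [u [v [pv fE]]]] := polyfun_splits pf.
pose vv (B : Sp int g) : 'rV[k]_r := \row_i v i (icast (Sp_val B)).
have [m [b hb]] := finite_row_span vv; set M := \matrix_(l < m) _ in hb.
(* Coordinates of the vector of values [v i X] in the chosen rows; the pseudo-inverse of [M] is
   constant, so they are polynomial in X. *)
pose kappa l (X : 'M[k]_(g.*2)) := \sum_(i < r) v i X * pinvmx M i l.
have pk l : polyfun (kappa l).
  by apply: polyfun_sum => i; apply: polyfunM (pv i) (polyfun_const _ _).
have vE (B : Sp int g) i : v i (icast (Sp_val B)) =
    \sum_(l < m) kappa l (icast (Sp_val B)) * v i (icast (Sp_val (b l))).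
  have /matrixP/(_ 0 i) := mulmxKpV (hb B); rewrite !mxE => <-.
  apply: eq_bigr => l _; rewrite !mxE; congr (_ * _).
  by apply: eq_bigr => j _; rewrite !mxE.
(* The inverse of a symplectic matrix, in polynomial form. *)
pose inv (X : 'M[k]_(g.*2)) := - (J *m X^T *m J).
have pinv : polymx (fun X => inv X *m icast (Sp_val A0)).
  apply: polymxM (polymx_const _ _).
  apply: (@polymx_ext _ _ _ _ (fun X => (-1) *: (J *m X^T *m J))).
    by move=> X; rewrite scaleN1r.
  apply: polymxZ (polyfun_const _ _) _.
  by do !apply: polymxM; try exact: polymx_const; apply: polymx_tr; apply: polymx_id.
exists (fun X => (f (icast (Sp_val A0)))^-1 *:
  \sum_(l < m) kappa l (inv X *m icast (Sp_val A0)) *: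
    (N (X *m icast (Sp_val (b l))) *m rho (b l)^-1%g)).
  apply: polymxZ (polyfun_const _ _) _; apply: polymx_sum => l; apply: polymxZ.
    exact: (polyfun_comp (pk l) pinv).
  apply: polymxM (polymx_const _ _); apply: (polymx_comp pN).
  exact: polymxM (@polymx_id _ _) (polymx_const _ _).
move=> A; apply: (scalerI fA0); rewrite scalerA mulfV // scale1r.
rewrite /inv -icastV -icastM; set B := (A^-1 * A0)%g.
have {1}-> : A0 = (A * B)%g by rewrite /B mulgA mulgV mul1g.
rewrite icastM fE.
under eq_bigr => i _ do rewrite vE mulr_sumr.
rewrite exchange_big /= scaler_suml; apply: eq_bigr => l _.
have e : rho A * rho (b l) *m rho (b l)^-1%g = rho A.
  by rewrite -[LHS]/(rho A * rho (b l) * rho (b l)^-1%g) -mulrA -rhoM mulgV rho1 mulr1.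
rewrite -icastM -fN rhoM -scalemxAl e icastM fE scalerA; congr (_ *: _); rewrite mulr_sumr.
by apply: eq_bigr => i _; rewrite mulrCA.
Qed.
End Translation.

(** * Zariski density of the integral points *)

Section Density.
Variables (k : fieldType) (char0 : [pchar k] =i pred0) (g : nat).
Local Notation icast := (map_mx (intr : int -> k)).

(** Induction on a word over k: as a function of the parameter of its first letter, h is a
    polynomial that vanishes at all natural numbers. *)
Lemma symplectic_dense (h : 'M[k]_(g.*2) -> k) : polyfun h ->
  (forall A : Sp int g, h (icast (Sp_val A)) = 0) ->
  forall A : 'M[k]_(g.*2), symplectic A -> h A = 0.
Proof.
move=> ph h0 A hA.
have [l hl <-] := symplectic_word (field_euclidean (F := k)) hA.
elim: l hl h ph h0 => [_|[[i j] c] l ih] /=.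
  by move=> h _ h0; have := h0 1%g; rewrite /= map_mx1.
move=> /andP [_ hl] h ph h0.
have hn (a : nat) : h (tvm (sv k g i j) a%:R *m wmx g l) = 0.
  apply: (ih hl (fun Y => h (tvm (sv k g i j) a%:R *m Y))).
    by apply: polyfun_comp ph _; apply: polymxM (polymx_const _ _) (@polymx_id _ _).
  move=> B; rewrite -[RHS](h0 (tv (sv int g i j) a%:Z * B)%g) icastM.
  by rewrite [icast (tvm _ _)]map_tvm map_sv.
have [p hp] := ph; set s := sv k g i j in hn *.
have [P hP] := mpoly_line p (mxvec (wmx g l) 0)
  (mxvec (s *m (s^T *m symplectic_form k g) *m wmx g l) 0).
have PE a : P.[a] = h (tvm s a *m wmx g l).
  rewrite hP hp; apply: meval_eq => r.
  rewrite /tvm mulmxDl mul1mx -scalemxAl linearD linearZ /=.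
  by rewrite [RHS]mxE [X in _ = _ + X]mxE.
rewrite /lmx /= -PE (_ : P = 0) ?horner0 //.
by apply: (poly_nat_eq char0) => a; rewrite horner0 PE hn.
Qed.
End Density.


Arguments polymx_const {k n a b} M.
Arguments polyfun_const {k n} c.

(** * Polynomial dependence of the elimination on the matrix *)

Section PolynomialElimination.
Variables (k : fieldType) (g : nat).
Local Notation mat := 'M[k]_(g.*2).

Lemma polyfun_sdot (x y : mat -> 'cV[k]_(g.*2)) : polymx x -> polymx y ->
  polyfun (fun A => sdot (x A) (y A)).
Proof.
move=> px py.
exact: polymxM (polymxM (polymx_tr px) (polymx_const (symplectic_form k g))) py 0 0.
Qed.

Lemma elim_step_poly i (N : mat -> mat) (c : mat -> k) : polymx N -> polyfun c ->
  polymx (fun A => elim_vec i (N A, c A)) /\ polyfun (fun A => elim_piv i (N A, c A)).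
Proof.
move=> pN pc; have pb := polymxM pN (polymx_const (bv k g i)); split.
  apply: polymx_ext (polymxD pb (polymxZ (polyfunM (polyfun_const (-1)) pc)
    (polymx_const (bv k g i)))) => A.
  by rewrite mulN1r scaleNr.
exact: polyfunM pc (polyfun_sdot (polymx_const _) pb).
Qed.

Lemma elim_run_poly m : polymx (fun A : mat => (elim_run m A).1) /\
  polyfun (fun A : mat => (elim_run m A).2).
Proof.
elim: m => [|m [p1 p2]]; first by split; [apply: polymx_id|apply: polyfun_const].
have [pv pp] := elim_step_poly m p1 p2.
have surj A : elim_run m A = ((elim_run m A).1, (elim_run m A).2) by case: elim_run.
split; last first.
  apply: polyfun_ext (polyfunM p2 pp) => A.
  by rewrite -surj.
apply: polymx_ext (polymxD (polymxZ pp p1) (polymxM pv (polymxM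
  (polymxM (polymx_tr pv) (polymx_const (symplectic_form k g))) p1))) => A.
by rewrite -surj.
Qed.

Lemma evec_poly m : polymx (fun A : mat => evec m A).
Proof.
have [p1 p2] := elim_run_poly m; have [pv _] := elim_step_poly m p1 p2.
by apply: polymx_ext pv => A; rewrite /evec; case: elim_run.
Qed.

Lemma pivot_poly m : polyfun (fun A : mat => pivot m A).
Proof.
have [p1 p2] := elim_run_poly m; have [_ pp] := elim_step_poly m p1 p2.
by apply: polyfun_ext pp => A; rewrite /pivot; case: elim_run.
Qed.

Variables (d : nat) (I : infinitesimal_data k g d).

Lemma den_prod_poly m : polyfun (fun A : mat => den_prod I m A).
Proof.
by apply: polyfun_prod => i; apply: polyfunX; apply: pivot_poly.
Qed.

Lemma num_prod_poly m : polymx (fun A : mat => num_prod I idfun m A).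
Proof.
elim: m => [|m ih]; first exact: polymx_const.
apply: polymxM ih _; apply: polymx_sum => j; apply: polymxZ.
  apply: polyfunM (polyfun_const _); apply: polyfunM (polyfun_const _) _.
  by apply: polyfunX; apply: pivot_poly.
apply: polymxX; apply: polymx_sum => r; apply: polymx_sum => s.
apply: polymxZ (polymx_const _).
exact: polymxM (evec_poly m) (polymx_tr (evec_poly m)) r s.
Qed.
End PolynomialElimination.

(** * Extension of a matrix representation to Sp_2g(k) *)

Section MatrixRepresentation.
Variables (k : fieldType) (char0 : [pchar k] =i pred0) (g : nat) (g3 : (2 < g)%N).
Variables (d : nat) (rho : Sp int g -> 'M[k]_d).
Hypothesis rho1 : rho 1%g = 1.
Hypothesis rhoM : forall A B, rho (A * B)%g = rho A * rho B.
Local Notation icast := (map_mx (intr : int -> k)).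

(** Each x lies in the orbit of some multiple c of [av 0], so its logarithm is a conjugate of c^2
    times that of [av 0]; one bound [n0] serves all x. *)
Lemma transvection_logs N : (rho (tv (av int g 0) 1) - 1) ^+ N = 0 ->
  exists n0 (Y : 'cV[int]_(g.*2) -> 'M[k]_d), [/\ (1 < n0)%N,
    forall x, Y x ^+ n0 = 0 &
    forall x (j : nat), rho (tv x j%:Z) = nexp n0 (Y x) j%:R].
Proof.
move=> /(unipotent_log char0) [n0 [Y0 [n01 Y0n hY0]]]; exists n0.
have rVl A : rho A^-1%g * rho A = 1 by rewrite -rhoM mulVg.
have rV A : rho A * rho A^-1%g = 1 by rewrite -rhoM mulgV.
have hpow (j : nat) : rho (tv (av int g 0) j%:Z) = nexp n0 Y0 j%:R.
  rewrite -hY0; elim: j => [|j ih].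
    by rewrite expr0 -rho1; congr rho; apply: val_inj; apply: tvm0.
  by rewrite exprS -ih -rhoM -tv_add; congr (rho (tv _ _)); lia.
suff hx x : exists Yx : 'M[k]_d, Yx ^+ n0 = 0 /\
    forall j : nat, rho (tv x j%:Z) = nexp n0 Yx j%:R.
  have [Y hY] := choice hx; exists Y; split=> // x; first by case: (hY x).
  by move=> j; case: (hY x) => _ ->.
have g0 : (0 < g)%N by lia.
have [|c [l _ e]] := reduce_vec int_euclidean g0 (_ : low 0 x); first by [].
(* Only c^2 matters, and the absolute value keeps exponents in the natural numbers, as [hpow]
   requires. *)
pose A : Sp int g := wSp g l; pose a : k := (`|c|%N ^ 2)%:R.
pose Yx := rho A^-1%g * (a *: Y0) * rho A; exists Yx.
have conj m : Yx ^+ m = rho A^-1%g * (a *: Y0) ^+ m * rho A.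
  elim: m => [|m ih]; first by rewrite !expr0 mulr1 rVl.
  by rewrite exprS ih /Yx -!mulrA (mulrA (rho A) (rho A^-1%g)) rV mul1r exprS !mulrA.
split; first by rewrite conj scalemx_expr Y0n scaler0 mulr0 mul0r.
move=> j; have -> : tv x j%:Z = (A^-1 * (tv (av int g 0) (`|c| ^ 2 * j)%N%:Z * A))%g.
  have -> : tv (av int g 0) (`|c| ^ 2 * j)%N%:Z = tv (Sp_val A *m x) j%:Z.
    rewrite e; apply: val_inj; rewrite /= tvmZ; congr tvm.
    by rewrite PoszM; congr (_ * _); lia.
  by rewrite tv_conj mulgA mulVg mul1g.
rewrite !rhoM hpow natrM -nexpZ.
have h : rho A * Yx = (a *: Y0) * rho A by rewrite /Yx !mulrA rV mul1r.
by rewrite -(nexp_conj _ _ h) mulrA rVl mul1r.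
Qed.

Lemma polynomial_of_unipotent N : (rho (tv (av int g 0) 1) - 1) ^+ N = 0 ->
  exists2 Q : 'M[k]_(g.*2) -> 'M[k]_d, polymx Q & forall A, rho A = Q (icast (Sp_val A)).
Proof.
move=> /transvection_logs [n0 [Y [n01 Yn hY]]].
have g0 : (0 < g)%N by lia.
pose beta := beta Y.
have Yphi x := Y_phi char0 g3 rho1 rhoM n01 Yn hY x.
have svE i j : phi beta (sv k g i j *m (sv k g i j)^T) = Y (sv int g i j).
  by rewrite Yphi !(map_sv (intr : {rmorphism int -> k})).
have Bnil i j : phi beta (sv k g i j *m (sv k g i j)^T) ^+ n0 = 0 by rewrite svE.
have Beq i j (c : nat) S : (i < g.*2)%N -> (j < g.*2)%N ->
    phi beta (tvm (sv k g i j) c%:R *m S *m (tvm (sv k g i j) c%:R)^T) *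
      nexp n0 (phi beta (sv k g i j *m (sv k g i j)^T)) c%:R =
    nexp n0 (phi beta (sv k g i j *m (sv k g i j)^T)) c%:R * phi beta S.
  move=> hi hj; rewrite svE -hY.
  have := equivariant_all char0 g3 rho1 rhoM n01 Yn hY (tv (sv int g i j) c%:Z) S.
  by rewrite /= (map_tvm (intr : {rmorphism int -> k})) map_sv.
pose I := InfinitesimalData n01 Bnil Beq.
have rho_word l : wok g 0 l -> rho (wSp g l) = fmx I idfun (map_word (intr : int -> k) l).
  elim: l => [_|[[i j] c] l ih] /=.
    by rewrite -rho1; congr rho; apply: val_inj.
  move=> /andP [_ /ih <-].
  have -> : wSp g ((i, j, c) :: l) = (tv (sv int g i j) c * wSp g l)%g by apply: val_inj.
  rewrite rhoM (rho_tv_int char0 rho1 rhoM n01 Yn hY); congr (nexp _ _ _ * _).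
  rewrite quadR_sv -svE /=; apply/matrixP => a b; rewrite mxE.
  by [].
have [C hC] := rational_formula char0 g0 rhoM rho_word.
apply: (polynomial_of_rational (f := fun A => den_prod I g.*2 A)
  (N := fun A => C * num_prod I idfun g.*2 A) (A0 := base_Sp g) rho1 rhoM) => //.
- exact: den_prod_poly.
- exact: polymxM (polymx_const C) (num_prod_poly I _).
rewrite /base_Sp /= map_wmx /base_letters map_base_word.
by apply/prodf_neq0 => i _; rewrite expf_neq0 // base_pivot.
Qed.

Lemma polynomial_extension N : (rho (tv (av int g 0) 1) - 1) ^+ N = 0 ->
  exists Q : Sp k g -> 'M[k]_d, [/\ Q 1%g = 1, forall A B, Q (A * B)%g = Q A * Q B,
    forall A, Q (Sp_map intr A) = rho A &
    forall i j, exists p : {mpoly k[g.*2 * g.*2]}, forall A : Sp k g,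
      Q A i j = p.@[mxvec (Sp_val A) 0]].
Proof.
move=> /polynomial_of_unipotent [Q pQ QE].
have dense (h : 'M[k]_(g.*2) -> 'M[k]_d) : polymx h ->
    (forall A : Sp int g, h (icast (Sp_val A)) = 0) -> forall A : Sp k g, h (Sp_val A) = 0.
  move=> ph h0 A; apply/matrixP => i j; rewrite [RHS]mxE.
  apply: (symplectic_dense char0 (ph i j)) (Sp_valP A) => B.
  by rewrite h0 mxE.
have sub (h h' : 'M[k]_(g.*2) -> 'M[k]_d) : polymx h -> polymx h' ->
    (forall A : Sp int g, h (icast (Sp_val A)) = h' (icast (Sp_val A))) ->
    forall A : Sp k g, h (Sp_val A) = h' (Sp_val A).
  move=> ph ph' e A; apply/eqP; rewrite -subr_eq0; apply/eqP.
  apply: (dense (fun X => h X - h' X)) => [|B]; last by rewrite e subrr.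
  apply: polymx_ext (polymxD ph (polymxZ (polyfun_const (-1)) ph')) => X.
  by rewrite scaleN1r.
have cM (M : 'M[k]_(g.*2)) : polymx (fun X => X *m M) := polymxM (@polymx_id _ _) (polymx_const M).
have cM' (M : 'M[k]_(g.*2)) : polymx (fun X => M *m X) := polymxM (polymx_const M) (@polymx_id _ _).
(* Density is applied in one variable at a time: first the left factor with [B] integral, then the
   right factor. *)
have QM1 (B : Sp int g) (A : Sp k g) :
    Q (Sp_val A *m icast (Sp_val B)) = Q (Sp_val A) * Q (icast (Sp_val B)).
  apply: (sub (fun X => Q (X *m icast (Sp_val B))) (fun X => Q X * Q (icast (Sp_val B)))).
  - exact: polymx_comp pQ (cM _).
  - exact: polymxM pQ (polymx_const _).
  by move=> A'; rewrite -icastM -!QE rhoM.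
have QM (A B : Sp k g) : Q (Sp_val A *m Sp_val B) = Q (Sp_val A) * Q (Sp_val B).
  apply: (sub (fun X => Q (Sp_val A *m X)) (fun X => Q (Sp_val A) * Q X)).
  - exact: polymx_comp pQ (cM' _).
  - exact: polymxM (polymx_const _) pQ.
  by move=> B'; rewrite QM1.
exists (fun A => Q (Sp_val A)); split.
- by rewrite -rho1 QE [icast _]map_mx1.
- exact: QM.
- by move=> A; rewrite QE.
move=> i j; have [p hp] := pQ i j; exists p => A; exact: hp.
Qed.
End MatrixRepresentation.


(** * Transport to abstract vector spaces *)

Section Coordinates.
Variables (k : fieldType) (V : lmodType k).

(** A nontrivial relation would express some [s j] through the others and leave a smaller spanning
    family. *)
Lemma minimal_span_free d (s : 'I_d -> V) :
  (forall n (t : 'I_n -> V), (n < d)%N -> exists v, forall c, v <> \sum_(i < n) c i *: t i) ->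
  (forall v, exists c : 'I_d -> k, v = \sum_(i < d) c i *: s i) ->
  forall c, \sum_(i < d) c i *: s i = 0 -> forall i, c i = 0.
Proof.
case: d s => [|d] s dmin hs c c0 j; first by case: j.
apply/eqP; apply/negPn/negP => cj.
have [v hv] := dmin d (fun i => s (lift j i)) (ltnSn d); have [e he] := hs v.
apply: (hv (fun i => e (lift j i) - e j / c j * c (lift j i))).
move: c0; rewrite (bigD1_ord j) //= => /eqP; rewrite addr_eq0 => /eqP sj.
have {}sj : s j = - \sum_(i < d) (c j)^-1 * c (lift j i) *: s (lift j i).
  apply: (scalerI cj); rewrite sj scalerN scaler_sumr; congr (- _).
  by apply: eq_bigr => i _; rewrite scalerA mulrA mulfV // mul1r.
rewrite he (bigD1_ord j) //= sj scalerN scaler_sumr -sumrN -big_split /=.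
apply: eq_bigr => i _; rewrite scalerA -scaleNr -scalerDl addrC; congr (_ *: _).
by rewrite !mulrA.
Qed.

Lemma finite_dim_coord : finite_dim V -> exists d (r : {linear V -> 'cV[k]_d})
  (s : {linear 'cV[k]_d -> V}), cancel r s /\ cancel s r.
Proof.
move=> [n0 [s0 hs0]].
pose has n := `[< exists s : 'I_n -> V, forall v, exists c : 'I_n -> k,
  v = \sum_(i < n) c i *: s i >].
have ex_has : exists n, has n by exists n0; apply/asboolP; exists s0.
case: (ex_minnP ex_has) => d /asboolP [s hs] dmin.
have free := @minimal_span_free d s _ hs.
have {}free : forall c, \sum_(i < d) c i *: s i = 0 -> forall i, c i = 0.
  apply: free => n t nd; apply: contrapT => H.
  have : has n.
    apply/asboolP; exists t => v; apply: contrapT => H'; apply: H; exists v => c e.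
    by apply: H'; exists c.
  by move=> /dmin; rewrite leqNgt nd.
have [co coE] := choice hs.
have co_uniq v c : v = \sum_(i < d) c i *: s i -> forall i, co v i = c i.
  move=> e i; apply/eqP; rewrite -subr_eq0; apply/eqP.
  apply: (free (fun i => co v i - c i)).
  under eq_bigr => l _ do rewrite scalerBl.
  by rewrite sumrB -coE -e subrr.
pose r v : 'cV[k]_d := \col_i co v i.
pose q (x : 'cV[k]_d) : V := \sum_(i < d) x i 0 *: s i.
have r_lin : linear r.
  move=> a u v; apply/colP => i; rewrite !mxE; apply: (co_uniq _ (fun i => a * co u i + co v i)).
  rewrite {1}(coE u) {1}(coE v) scaler_sumr -big_split /=.
  by apply: eq_bigr => l _; rewrite scalerDl scalerA.
have q_lin : linear q.
  move=> a x y; rewrite /q scaler_sumr -big_split /=.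
  by apply: eq_bigr => l _; rewrite !mxE scalerDl scalerA.
pose rL := HB.pack_for {linear V -> 'cV[k]_d} r (GRing.isLinear.Build k V _ *:%R r r_lin).
pose qL := HB.pack_for {linear 'cV[k]_d -> V} q (GRing.isLinear.Build k _ V *:%R q q_lin).
exists d, rL, qL; split=> [v|x] /=.
  by rewrite /q [RHS]coE; apply: eq_bigr => i _; rewrite mxE.
by apply/colP => i; rewrite mxE; apply: (co_uniq _ (fun i => x i 0)).
Qed.

Definition mxof d (f : 'cV[k]_d -> 'cV[k]_d) : 'M[k]_d :=
  \matrix_(i, j) f (delta_mx j 0) i 0.

Lemma mxofE d (f : {linear 'cV[k]_d -> 'cV[k]_d}) x : mxof f *m x = f x.
Proof.
rewrite {2}[x]matrix_sum_delta linear_sum; apply/colP => i.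
rewrite mxE summxE; apply: eq_bigr => j _.
by rewrite big_ord1 linearZ !mxE mulrC.
Qed.
End Coordinates.

Section Transport.
Variables (k : fieldType) (char0 : [pchar k] =i pred0) (g : nat) (g3 : (2 < g)%N).
Variables (V : lmodType k) (rho : representation (Sp int g) V).

Lemma algebraic_of_unipotent m : finite_dim V ->
  (forall v, iter m (fun v => rho (tv (av int g 0) 1) v - v) v = 0) -> algebraic rho.
Proof.
move=> /finite_dim_coord [d [r [s [rK sK]]]] unip.
pose rhoC A : {linear 'cV[k]_d -> 'cV[k]_d} := r \o rho A \o s.
pose rhoX A := mxof (rhoC A).
have rhoXE A x : rhoX A *m x = r (rho A (s x)) by apply: mxofE.
have rho1 : rhoX 1%g = 1.
  by apply: mulmx_eq => x; rewrite rhoXE rep_act1 sK mul1mx.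
have rhoM A B : rhoX (A * B)%g = rhoX A * rhoX B.
  by apply: mulmx_eq => x; rewrite -mulmxE -mulmxA !rhoXE rep_actM rK.
have N0 : (rhoX (tv (av int g 0) 1) - 1) ^+ m = 0.
  apply: mulmx_eq => x; rewrite mul0mx -[RHS](linear0 r) -(unip (s x)).
  elim: m {unip} x => [|m ih] x; first by rewrite expr0 mul1mx /= sK.
  rewrite exprSr -mulmxE -mulmxA ih iterSr; congr (r (iter _ _ _)).
  by rewrite mulmxBl mul1mx rhoXE linearB rK.
have [Q [Q1 QM QE Qp]] := polynomial_extension char0 g3 rho1 rhoM N0.
pose act (A : Sp k g) : {linear V -> V} := s \o mulmx (Q A) \o r.
have act1 v : act 1%g v = v by rewrite /= Q1 mul1mx rK.
have actM A B v : act (A * B)%g v = act A (act B v) by rewrite /= QM sK -mulmxE mulmxA.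
exists (Representation act1 actM); last first.
  by move=> A v; rewrite /= QE rhoXE !rK.
move=> v; have [p hp] := choice (fun ij : 'I_d * 'I_d => Qp ij.1 ij.2).
exists d, (fun i => \sum_(j < d) r v j 0 *: p (i, j)), (fun i => s (delta_mx i 0)) => A.
rewrite /= [Q A *m r v]matrix_sum_delta linear_sum; apply: eq_bigr => i _.
rewrite big_ord1 linearZ /=; congr (_ *: _).
rewrite mxE rmorph_sum /=; apply: eq_bigr => j _.
by rewrite mevalZ -(hp (i, j)) mulrC.
Qed.
End Transport.

Local Close Scope ring_scope.

Theorem theoremD (k : fieldType) (char0 : [pchar k]%R =i pred0)
    (C : coherent_sequence k) (g0 : nat) (g0_ge2 : 2 <= g0)
    (coker_fd_algebraic : forall n, g0 <= n.+2 ->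
       finite_dim (coker C n) /\ algebraic (coker_rep C n))
    (coinvariants_fd : forall n, g0 <= n.+1 ->
       finite_dim (coinvariants (coh_rep C n))) :
  (forall n, g0 <= n.+1 -> finite_dim (coh_space C n)) /\
  (forall n, g0.+1 <= n.+1 -> algebraic (coh_rep C n)).
Proof.
have fd n : g0 <= n.+1 -> finite_dim (coh_space C n).
  (* Index 0 is V_1, excluded by g_0 >= 2; every later space is the target of some [coh_map]. *)
  case: n => [|n] hn; first by have := leq_trans g0_ge2 hn.
  have [fC _] := coker_fd_algebraic n hn.
  exact: finite_dim_coherent fC (coinvariants_fd _ hn).
split=> // n hn.
case: n hn => [|n] hn; first by have := leq_trans g0_ge2 hn.
have hn' : g0 <= n.+2 by apply: ltnW.
(* The space at index [n.+1] belongs to g = n + 2, so g >= g_0 + 1 >= 3 means n > 0. *)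
have n0 : 0 < n by have := leq_trans g0_ge2 hn.
have [fC aC] := coker_fd_algebraic n hn'.
have [m hm] := coherent_unipotent n0 fC aC.
exact: (algebraic_of_unipotent char0 _ (fd _ hn') hm).
Qed.
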